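(* Let $\omega\in(0,1]$, $R\in(0,1/2]$, and let $F$ be as in the context, with $M_F:=1+\|F(p,q,t)\|_R<\infty$. Consider the Hamiltonian $H(p,q,\eta,t)=\omega pq+\eta+F(p,q,t)$. Then there exist $R_*,R_0$ with $0<R_*<R_0\le R^4$ and a family of canonical changes of variables $\mathcal{M}:\mathcal{D}_{R_*}\to\mathcal{D}_{R_0}$, $(p^{(\infty)},q^{(\infty)},\eta^{(\infty)})\mapsto(p,q,\eta)$, parametrised by $t\in\mathbb{R}^+$ (the time $t$ is left unchanged) and analytic on $\mathcal{D}_{R_*}$ for every $t\in\mathbb{R}^+$, which casts $H$ into the time-dependent Moser normal form $$H^{(\infty)}(p^{(\infty)},q^{(\infty)},\eta^{(\infty)},t)=J^{(\infty)}(x^{(\infty)},t)+\eta^{(\infty)},\qquad x^{(\infty)}:=p^{(\infty)}q^{(\infty)},$$ where $J^{(\infty)}(x,t)$ is analytic in $x$ and satisfies $J^{(\infty)}(0,t)=0$ and $\partial_xJ^{(\infty)}(0,t)=\omega$ for all $t\in\mathbb{R}^+$.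
   Context: Notation: $\mathbb{R}^+:=[0,\infty)$. For $\rho>0$, $\mathcal{Q}_\rho:=\{(p,q)\in\mathbb{C}^2:|p|,|q|\le\rho\}$, $\mathcal{S}_\rho:=\{\eta\in\mathbb{C}:|\Im\eta|\le\rho\}$, $\mathcal{D}_\rho:=\mathcal{Q}_\rho\times\mathcal{S}_\rho$. Multi-indices $\underline{\alpha}=(\alpha_1,\alpha_2)\in\mathbb{N}^2$, $|\underline{\alpha}|:=\alpha_1+\alpha_2$. The perturbation $F:\mathcal{Q}_R\times\mathbb{R}^+\to\mathbb{C}$ is, for every $t\in\mathbb{R}^+$, continuous on $\mathcal{Q}_R$, holomorphic in its interior and real for real $(p,q)$; its Taylor expansion is $F=\sum_{\underline\alpha}f_{\underline\alpha}(t)p^{\alpha_1}q^{\alpha_2}$ with $f_{\underline\alpha}(t)=0$ for all $|\underline\alpha|\le2$ and all $t$, and the real and imaginary parts of each $f_{\underline\alpha}$ belong to $C^1(\mathbb{R}^+)$. Taylor norm: for $G=\sum_{\underline\alpha}g_{\underline\alpha}(t)p^{\alpha_1}q^{\alpha_2}$, $\|G\|_\rho:=\sum_{\underline\alpha}\sup_{t\in\mathbb{R}^+}|g_{\underline\alpha}(t)|\,\rho^{|\underline\alpha|}$. The variable $\eta$ is the momentum conjugate to $t$ in the extended phase space, so $H$ is the autonomous extension of the non-autonomous Hamiltonian $\omega pq+F(p,q,t)$; ''canonical'' refers to this extended phase space with $t$ unchanged, and the transformed Hamiltonian is $H^{(\infty)}=H\circ\mathcal{M}$. *)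

(* Defs.v *)
From Stdlib Require Import Reals.
Open Scope R_scope.

Definition Cx : Type := (R * R)%type.
Definition Cre (z : Cx) : R := fst z.
Definition Cim (z : Cx) : R := snd z.
Definition RtoC (r : R) : Cx := (r, 0).
Definition C0 : Cx := (0, 0).
Definition C1 : Cx := (1, 0).
Definition Cadd (z w : Cx) : Cx := (fst z + fst w, snd z + snd w).
Definition Copp (z : Cx) : Cx := (- fst z, - snd z).
Definition Csub (z w : Cx) : Cx := Cadd z (Copp w).
Definition Cmul (z w : Cx) : Cx :=
  (fst z * fst w - snd z * snd w, fst z * snd w + snd z * fst w).
Definition Cscal (r : R) (z : Cx) : Cx := (r * fst z, r * snd z).
Definition Cmod (z : Cx) : R := sqrt (fst z * fst z + snd z * snd z).
Fixpoint Cpow (z : Cx) (n : nat) : Cx :=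
  match n with O => C1 | S n => Cmul z (Cpow z n) end.
Fixpoint Csum (g : nat -> Cx) (n : nat) : Cx :=
  match n with O => g O | S n => Cadd (Csum g n) (g (S n)) end.

Definition inQ (rho : R) (p q : Cx) : Prop := Cmod p <= rho /\ Cmod q <= rho.
Definition inS (rho : R) (e : Cx) : Prop := Rabs (Cim e) <= rho.
Definition inD (rho : R) (p q e : Cx) : Prop := inQ rho p q /\ inS rho e.

Definition cdiff1 (f : Cx -> Cx) (z d : Cx) : Prop :=
  forall eps, 0 < eps -> exists delta, 0 < delta /\
    forall h, Cmod h < delta ->
      Cmod (Csub (f (Cadd z h)) (Cadd (f z) (Cmul d h))) <= eps * Cmod h.

Definition cdiff2 (f : Cx -> Cx -> Cx) (z1 z2 d1 d2 : Cx) : Prop :=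
  forall eps, 0 < eps -> exists delta, 0 < delta /\
    forall h1 h2, Cmod h1 < delta -> Cmod h2 < delta ->
      Cmod (Csub (f (Cadd z1 h1) (Cadd z2 h2))
                 (Cadd (f z1 z2) (Cadd (Cmul d1 h1) (Cmul d2 h2))))
        <= eps * (Cmod h1 + Cmod h2).

Definition cdiff3 (f : Cx -> Cx -> Cx -> Cx) (z1 z2 z3 d1 d2 d3 : Cx) : Prop :=
  forall eps, 0 < eps -> exists delta, 0 < delta /\
    forall h1 h2 h3, Cmod h1 < delta -> Cmod h2 < delta -> Cmod h3 < delta ->
      Cmod (Csub (f (Cadd z1 h1) (Cadd z2 h2) (Cadd z3 h3))
                 (Cadd (f z1 z2 z3)
                       (Cadd (Cmul d1 h1) (Cadd (Cmul d2 h2) (Cmul d3 h3)))))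
        <= eps * (Cmod h1 + Cmod h2 + Cmod h3).

Definition cdifferentiable1 (f : Cx -> Cx) (z : Cx) : Prop :=
  exists d, cdiff1 f z d.
Definition cdifferentiable2 (f : Cx -> Cx -> Cx) (z1 z2 : Cx) : Prop :=
  exists d1 d2, cdiff2 f z1 z2 d1 d2.
Definition cdifferentiable3 (f : Cx -> Cx -> Cx -> Cx) (z1 z2 z3 : Cx) : Prop :=
  exists d1 d2 d3, cdiff3 f z1 z2 z3 d1 d2 d3.

(* analytic (= holomorphic) on a (closed) set S: holomorphic on an open
   neighbourhood of S, i.e. around every point of S there is a ball on which
   f is complex differentiable. *)
Definition analytic1_on (S : Cx -> Prop) (f : Cx -> Cx) : Prop :=
  forall z, S z -> exists r, 0 < r /\
    forall w, Cmod (Csub w z) < r -> cdifferentiable1 f w.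
Definition analytic3_on (S : Cx -> Cx -> Cx -> Prop)
    (f : Cx -> Cx -> Cx -> Cx) : Prop :=
  forall z1 z2 z3, S z1 z2 z3 -> exists r, 0 < r /\
    forall w1 w2 w3, Cmod (Csub w1 z1) < r -> Cmod (Csub w2 z2) < r ->
      Cmod (Csub w3 z3) < r -> cdifferentiable3 f w1 w2 w3.

Definition rderiv_plus (g : R -> R) (t d : R) : Prop :=
  forall eps, 0 < eps -> exists delta, 0 < delta /\
    forall h, h <> 0 -> Rabs h < delta -> 0 <= t + h ->
      Rabs ((g (t + h) - g t) / h - d) < eps.

Definition cderiv_plus (g : R -> Cx) (t : R) (d : Cx) : Prop :=
  forall eps, 0 < eps -> exists delta, 0 < delta /\
    forall h, h <> 0 -> Rabs h < delta -> 0 <= t + h ->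
      Cmod (Csub (Cscal (/ h) (Csub (g (t + h)) (g t))) d) < eps.

Definition C1_Rplus (g : R -> R) : Prop :=
  exists g' : R -> R,
    (forall t, 0 <= t -> rderiv_plus g t (g' t)) /\
    (forall t, 0 <= t -> forall eps, 0 < eps -> exists delta, 0 < delta /\
        forall s, 0 <= s -> Rabs (s - t) < delta -> Rabs (g' s - g' t) < eps).

Definition taylor_partial (f : nat -> nat -> R -> Cx) (p q : Cx) (t : R)
    (N : nat) : Cx :=
  Csum (fun n => Csum (fun a => Cmul (f a (n - a)%nat t)
                               (Cmul (Cpow p a) (Cpow q (n - a)%nat))) n) N.

Definition taylor_norm_finite (f : nat -> nat -> R -> Cx) (rho : R) : Prop :=
  exists c : nat -> nat -> R,
    (forall a b, is_lub (fun x => exists t, 0 <= t /\ x = Cmod (f a b t)) (c a b))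
    /\ exists L, Un_cv (fun N => sum_f_R0
                          (fun n => sum_f_R0 (fun a => c a (n - a)%nat) n * rho ^ n) N) L.

Definition admissible_perturbation (R0 : R) (F : Cx -> Cx -> R -> Cx)
    (f : nat -> nat -> R -> Cx) : Prop :=
  (forall t, 0 <= t -> forall p q, inQ R0 p q ->
     forall eps, 0 < eps -> exists delta, 0 < delta /\
       forall p' q', inQ R0 p' q' -> Cmod (Csub p' p) < delta ->
         Cmod (Csub q' q) < delta -> Cmod (Csub (F p' q' t) (F p q t)) < eps) /\
  (forall t, 0 <= t -> forall p q, Cmod p < R0 -> Cmod q < R0 ->
     cdifferentiable2 (fun p q => F p q t) p q) /\
  (forall t, 0 <= t -> forall p q, inQ R0 p q -> Cim p = 0 -> Cim q = 0 ->
     Cim (F p q t) = 0) /\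
  (forall t, 0 <= t -> forall p q, inQ R0 p q ->
     forall eps, 0 < eps -> exists N0, forall N, (N0 <= N)%nat ->
       Cmod (Csub (taylor_partial f p q t N) (F p q t)) < eps) /\
  (forall a b t, (a + b <= 2)%nat -> f a b t = C0) /\
  (forall a b, C1_Rplus (fun t => Cre (f a b t)) /\ C1_Rplus (fun t => Cim (f a b t))).

(* M(P,Q,E,t) = (Mp, Mq, Me)(P,Q,E,t), time unchanged.  Canonical means the
   pull-back of dp/\dq + deta/\dt is dP/\dQ + dE/\dt (t being unchanged). *)
Definition canonical_on (rho : R) (Mp Mq Me : Cx -> Cx -> Cx -> R -> Cx) : Prop :=
  forall P Q E t, inD rho P Q E -> 0 <= t ->
    exists pP pQ pE qP qQ qE eP eQ eE pt qt,
      cdiff3 (fun a b c => Mp a b c t) P Q E pP pQ pE /\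
      cdiff3 (fun a b c => Mq a b c t) P Q E qP qQ qE /\
      cdiff3 (fun a b c => Me a b c t) P Q E eP eQ eE /\
      cderiv_plus (fun s => Mp P Q E s) t pt /\
      cderiv_plus (fun s => Mq P Q E s) t qt /\
      (* dP/\dQ *)
      Csub (Cmul pP qQ) (Cmul pQ qP) = C1 /\
      (* dP/\dE *)
      Csub (Cmul pP qE) (Cmul pE qP) = C0 /\
      (* dQ/\dE *)
      Csub (Cmul pQ qE) (Cmul pE qQ) = C0 /\
      (* dP/\dt *)
      Cadd (Csub (Cmul pP qt) (Cmul pt qP)) eP = C0 /\
      (* dQ/\dt *)
      Cadd (Csub (Cmul pQ qt) (Cmul pt qQ)) eQ = C0 /\
      (* dE/\dt *)
      Cadd (Csub (Cmul pE qt) (Cmul pt qE)) eE = C1.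

Definition Ham (omega : R) (F : Cx -> Cx -> R -> Cx) (p q e : Cx) (t : R) : Cx :=
  Cadd (Cmul (RtoC omega) (Cmul p q)) (Cadd e (F p q t)).

(* Main.v *)
(* The normal form is found by the parametrization method. Write x = PQ and
   D = Q d/dQ - P d/dP. One looks for power series p, q in (P, Q), with
   coefficients bounded in time, and a = omega + g(x, t) such that
     (d/dt + a D) q =  omega q + F_p(p, q, t),
     (d/dt + a D) p = -omega p - F_q(p, q, t),
   i.e. such that (P, Q) -> (p, q) maps solutions of the system with Hamiltonian
   J(PQ, t), J' = a, to solutions of the given one.
   On the coefficient of P^i Q^j the linear part is c' + omega (j - i -+ 1) c. The
   multiplier is either 0 or at least omega in modulus, and in the latter case the
   equation has exactly one solution bounded on the whole time line. The factor j - i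
   produced by D is controlled by the same divisor, so there is no loss of domain and
   a ball in a weighted l^1 norm is invariant under the iteration. Each iteration also
   gains one degree, hence the coefficients stabilize.
   The resonant terms are fixed as follows: q has none besides Q, g is then given by
   the resonant part of the q-equation, and those of p by requiring that the
   diagonal part of the bracket {p, q} be 1. The resonant part of the p-equation is
   not imposed; writing e for its defect, (d/dt + a D){p, q} = {e, q}, whose
   diagonal part forces e = 0. Then {p, q} - 1 solves a homogeneous equation, is bounded
   in time and off-diagonal, and therefore vanishes. *)


From Stdlib Require Import Reals Lra.
From Coquelicot Require Hierarchy RInt Derive RInt_analysis Complex.

Section ScalarEquation.
Local Open Scope R_scope.

(** * Bounded solutions of scalar linear equations *)

(** No sequence of canonical maps is composed: one formal pair [(p, q)] is built, and canonicity is
    deduced from the equations that it solves. The momentum component is not an unknown. It is set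
    to [E + energy] with [energy = J(PQ, t) - omega p q - F(p, q, t)], which gives the transformed
    Hamiltonian its shape by definition; the time part of canonicity then follows from the two
    evolution equations and [{p, q} = 1].

    Because [D] is unbounded at a fixed radius, the iteration carries bounds on [grad A] and
    [grad B] beside those on [A] and [B]. In the norm the supremum over time stands inside the sum
    over coefficients, so an operator that acts on each coefficient as a function of time is
    controlled coefficient by coefficient. Smallness comes from the radius [rho] alone: the
    derivatives of [F] start in degree two, so their norm is of order [rho^2], while the ball needs
    it below a multiple of [omega rho]. Identities are proved for formal series and passed to
    functions by an evaluation compatible with sums, products, composition and the derivatives in
    [P], [Q] and time. *)

Lemma antiderivative_exists (h : R -> R) : continuity h ->
  exists I, forall t, derivable_pt_lim I t (h t).
Proof.
intros hc; exists (fun t => @RInt.RInt Hierarchy.R_CompleteNormedModule h 0 t); intros t.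
apply Derive.is_derive_Reals.
apply (@RInt_analysis.is_derive_RInt Hierarchy.R_NormedModule h
  (fun t => @RInt.RInt Hierarchy.R_CompleteNormedModule h 0 t) 0 t).
- apply Hierarchy.filter_forall; intros b; apply (@RInt.RInt_correct Hierarchy.R_CompleteNormedModule).
  apply (@RInt.ex_RInt_continuous Hierarchy.R_CompleteNormedModule); intros z _.
  apply Hierarchy.continuity_pt_filterlim, hc.
- apply Hierarchy.continuity_pt_filterlim, hc.
Qed.

Lemma nondecreasing_derivable (f f' : R -> R) :
  (forall t, derivable_pt_lim f t (f' t)) -> (forall t, 0 <= f' t) ->
  forall s t, s <= t -> f s <= f t.
Proof.
intros hf h s t hst; destruct (Rle_lt_or_eq_dec s t hst) as [l|e].
- destruct (MVT_cor2 f f' s t l) as [c [e _]]; [intros; apply hf|].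
  pose proof (h c); assert (0 <= f' c * (t - s)) by (apply Rmult_le_pos; lra); lra.
- rewrite e; lra.
Qed.

Lemma derivable_exp_lin (l t : R) :
  derivable_pt_lim (fun s => exp (l * s)) t (l * exp (l * t)).
Proof.
replace (l * exp (l * t)) with (exp (l * t) * (l * 1)) by ring.
apply (derivable_pt_lim_comp (fun s => l * s) exp).
- apply (derivable_pt_lim_scal id), derivable_pt_lim_id.
- apply derivable_pt_lim_exp.
Qed.

(** The solution is the integral of [exp (- l (t - s)) * g s] over all [s <= t]. The improper
    integral is avoided: with [I] an antiderivative of [exp (l s) * g s], the limit of [I] at minus
    infinity is caught between the nonincreasing [lo] and the nondecreasing [up]. *)
Lemma bounded_solution_pos (l G : R) (g : R -> R) : 0 < l -> continuity g ->
  (forall t, Rabs (g t) <= G) ->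
  exists c, (forall t, derivable_pt_lim c t (g t - l * c t)) /\
    forall t, Rabs (c t) <= G / l.
Proof.
intros hl hg hG.
assert (hG0 : 0 <= G) by (apply Rle_trans with (2 := hG 0), Rabs_pos).
assert (gb : forall t, - G <= g t <= G).
{ intros t; pose proof (hG t) as h; revert h; unfold Rabs; destruct (Rcase_abs (g t)); lra. }
assert (he : continuity (fun s => exp (l * s))).
{ intros t; apply derivable_continuous_pt.
  exists (l * exp (l * t)); apply derivable_exp_lin. }
destruct (antiderivative_exists (fun s => exp (l * s) * g s)) as [I hI].
{ apply (continuity_mult _ _ he hg). }
assert (hE : forall k t, derivable_pt_lim (fun s => k / l * exp (l * s)) t (k * exp (l * t))).
{ intros k t; replace (k * exp (l * t)) with (k / l * (l * exp (l * t))) by (field; lra).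
  apply (derivable_pt_lim_scal (fun s => exp (l * s))), derivable_exp_lin. }
pose (up := fun t => I t + G / l * exp (l * t)).
pose (lo := fun t => I t - G / l * exp (l * t)).
assert (hup : forall s t, s <= t -> up s <= up t).
{ apply (nondecreasing_derivable up (fun t => exp (l * t) * g t + G * exp (l * t))).
  - intros t; apply (derivable_pt_lim_plus I (fun t => G / l * exp (l * t))); [apply hI | apply hE].
  - intros t; pose proof (gb t); pose proof (exp_pos (l * t)).
    replace (exp (l * t) * g t + G * exp (l * t)) with (exp (l * t) * (g t + G)) by ring.
    apply Rmult_le_pos; lra. }
assert (hlo : forall s t, s <= t -> lo t <= lo s).
{ intros s t hst.
  enough (- lo s <= - lo t) by lra; revert s t hst.
  apply (nondecreasing_derivable (fun t => - lo t)
    (fun t => - (exp (l * t) * g t - G * exp (l * t)))).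
  - intros t; apply (derivable_pt_lim_opp lo).
    apply (derivable_pt_lim_minus I (fun t => G / l * exp (l * t))); [apply hI | apply hE].
  - intros t; pose proof (gb t); pose proof (exp_pos (l * t)).
    replace (- (exp (l * t) * g t - G * exp (l * t))) with (exp (l * t) * (G - g t)) by ring.
    apply Rmult_le_pos; lra. }
assert (hGl : 0 <= G / l) by (apply Rmult_le_pos; [lra | left; apply Rinv_0_lt_compat; lra]).
assert (hlu : forall t, lo t <= up t).
{ intros t; unfold lo, up; pose proof (exp_pos (l * t)).
  assert (0 <= G / l * exp (l * t)) by (apply Rmult_le_pos; lra); lra. }
assert (hall : forall s t, lo s <= up t).
{ intros s t; destruct (Rle_dec s t).
  - apply Rle_trans with (up s); auto.
  - apply Rle_trans with (lo t); auto; apply hlo; lra. }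
(* As [lo] is nonincreasing, its supremum [L] is its limit at minus infinity, hence that of [I],
   since the two differ by a multiple of [exp (l * t)]. *)
destruct (completeness (fun y => exists t, y = lo t)) as [L [hL1 hL2]].
{ exists (up 0); intros y [t ->]; apply hall. }
{ exists (lo 0), 0; reflexivity. }
exists (fun t => exp (- l * t) * (I t - L)); split; intros t.
- replace (g t - l * (exp (- l * t) * (I t - L))) with
    (- l * exp (- l * t) * (I t - L) + exp (- l * t) * (exp (l * t) * g t - 0)).
  + apply (derivable_pt_lim_mult (fun t => exp (- l * t)) (fun t => I t - L)).
    * apply derivable_exp_lin.
    * apply (derivable_pt_lim_minus I (fun _ => L)); [apply hI | apply derivable_pt_lim_const].
  + replace (exp (- l * t) * (exp (l * t) * g t - 0)) with
      ((exp (- l * t) * exp (l * t)) * g t) by ring.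
    rewrite <- exp_plus; replace (- l * t + l * t) with 0 by ring; rewrite exp_0; ring.
- assert (h1 : lo t <= L) by (apply hL1; exists t; reflexivity).
  assert (h2 : L <= up t) by (apply hL2; intros y [s ->]; apply hall).
  unfold lo, up in h1, h2.
  rewrite Rabs_mult, (Rabs_pos_eq (exp _)); [|left; apply exp_pos].
  apply Rle_trans with (exp (- l * t) * (G / l * exp (l * t))).
  + apply Rmult_le_compat_l; [left; apply exp_pos|]; apply Rabs_le; lra.
  + replace (exp (- l * t) * (G / l * exp (l * t))) with
      ((exp (- l * t) * exp (l * t)) * (G / l)) by ring.
    rewrite <- exp_plus; replace (- l * t + l * t) with 0 by ring; rewrite exp_0; lra.
Qed.

Lemma bounded_solution (l G : R) (g : R -> R) : l <> 0 -> continuity g ->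
  (forall t, Rabs (g t) <= G) ->
  exists c, (forall t, derivable_pt_lim c t (g t - l * c t)) /\
    forall t, Rabs (c t) <= G / Rabs l.
Proof.
intros hl hg hG; destruct (Rlt_le_dec 0 l) as [hp|hn].
- rewrite (Rabs_pos_eq l) by lra; apply bounded_solution_pos; auto.
- assert (hl0 : l < 0) by (destruct hn; [assumption | contradiction]).
  assert (hd : forall t, derivable_pt_lim (fun s => - s) t (- 1)).
  { intros t; apply (derivable_pt_lim_opp id), derivable_pt_lim_id. }
  (* Reversing time turns a negative [l] into a positive one. *)
  destruct (bounded_solution_pos (- l) G (fun t => g (- t))) as [c [hc hb]]; auto; try lra.
  { apply (continuity_comp (fun s => - s) g); auto.
    intros t; apply derivable_continuous_pt; exists (- 1); apply hd. }
  exists (fun t => - c (- t)); split; intros t.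
  + replace (g t - l * - c (- t)) with (- ((g (- - t) - - l * c (- t)) * - 1)).
    * apply (derivable_pt_lim_opp (fun t => c (- t))).
      apply (derivable_pt_lim_comp (fun s => - s) c); auto.
    * rewrite Ropp_involutive; ring.
  + rewrite Rabs_Ropp, (Rabs_left l) by lra; apply hb.
Qed.

(** A solution is a constant times [exp (- l * t)], unbounded in one of the two time directions
    unless the constant is zero. The whole line matters: on [t >= 0] alone the claim fails for
    [l > 0]. *)
Lemma bounded_homogeneous_zero (l M : R) (c : R -> R) : l <> 0 ->
  (forall t, derivable_pt_lim c t (- l * c t)) -> (forall t, Rabs (c t) <= M) ->
  forall t, c t = 0.
Proof.
intros hl hc hM t.
pose (e := fun s => exp (l * s) * c s).
assert (he : forall s, derivable_pt_lim e s 0).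
{ intros s; replace 0 with (l * exp (l * s) * c s + exp (l * s) * (- l * c s)) by ring.
  apply (derivable_pt_lim_mult (fun s => exp (l * s)) c); [apply derivable_exp_lin | apply hc]. }
assert (hcst : forall s, e s = e t).
{ assert (mono : forall f : R -> R, (forall s, derivable_pt_lim f s 0) -> forall s u, s <= u -> f s <= f u).
  { intros f hf; apply (nondecreasing_derivable f (fun _ => 0)); intros; [apply hf | lra]. }
  intros s; assert (he' : forall s, derivable_pt_lim (fun s => - e s) s 0).
  { intros u; rewrite <- Ropp_0; apply derivable_pt_lim_opp, he. }
  pose proof (mono e he) as m1; pose proof (mono _ he') as m2; simpl in m2.
  destruct (Rle_dec s t) as [h|h].
  - pose proof (m1 _ _ h); pose proof (m2 _ _ h); simpl in *; lra.
  - assert (h' : t <= s) by lra.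
    pose proof (m1 _ _ h'); pose proof (m2 _ _ h'); simpl in *; lra. }
assert (hM0 : 0 <= M) by (apply Rle_trans with (2 := hM 0), Rabs_pos).
destruct (Req_dec (e t) 0) as [h0|h0].
{ apply Rmult_integral in h0; destruct h0 as [h0|h0]; auto.
  pose proof (exp_pos (l * t)); lra. }
exfalso; set (K := Rabs (e t)).
assert (hK : 0 < K) by (apply Rabs_pos_lt; exact h0).
(* The time [- X / l] lies in the direction of growth for either sign of [l]; there [c] has modulus
   [K * exp X], at least [K * X]. *)
assert (hX : forall X, 0 < X -> K * X <= M).
{ intros X hX0.
  assert (h1 : K = exp (- X) * Rabs (c (- X / l))).
  { unfold K; rewrite <- (hcst (- X / l)); unfold e.
    rewrite Rabs_mult, (Rabs_pos_eq (exp _)); [|left; apply exp_pos].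
    f_equal; f_equal; field; exact hl. }
  pose proof (hM (- X / l)) as h2.
  assert (h3 : X <= exp X) by (pose proof (exp_ineq1_le X); lra).
  rewrite h1.
  apply Rle_trans with (exp (- X) * Rabs (c (- X / l)) * exp X).
  - apply Rmult_le_compat_l; auto.
    apply Rmult_le_pos; [left; apply exp_pos | apply Rabs_pos].
  - replace (exp (- X) * Rabs (c (- X / l)) * exp X) with
      ((exp (- X) * exp X) * Rabs (c (- X / l))) by ring.
    rewrite <- exp_plus; replace (- X + X) with 0 by ring; rewrite exp_0; lra. }
pose proof (hX ((M + 1) / K)) as h.
assert (hp : 0 < (M + 1) / K) by (apply Rdiv_lt_0_compat; lra).
specialize (h hp); replace (K * ((M + 1) / K)) with (M + 1) in h by (field; lra); lra.
Qed.

(** One solution obeys every bound at once, because uniqueness identifies it with the solution built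
    from each [G]. The estimate can then be used with any later bound on [g], in particular
    [G = 0]. *)
Lemma bounded_solution_uniform (l : R) (g : R -> R) : l <> 0 -> continuity g ->
  (exists G, forall t, Rabs (g t) <= G) ->
  exists c, (forall t, derivable_pt_lim c t (g t - l * c t)) /\
    forall G, (forall t, Rabs (g t) <= G) -> forall t, Rabs (c t) <= G / Rabs l.
Proof.
intros hl hg [G0 hG0]; destruct (bounded_solution l G0 g hl hg hG0) as [c [hc hb]].
exists c; split; auto; intros G hG t.
destruct (bounded_solution l G g hl hg hG) as [c' [hc' hb']].
enough (h0 : forall s, c s - c' s = 0) by (replace (c t) with (c' t) by (pose proof (h0 t); lra); auto).
apply (bounded_homogeneous_zero l (G0 / Rabs l + G / Rabs l)); auto.
- intros s; replace (- l * (c s - c' s)) with ((g s - l * c s) - (g s - l * c' s)) by ring.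
  apply (derivable_pt_lim_minus c c'); auto.
- intros s; unfold Rminus; apply Rle_trans with (1 := Rabs_triang _ _).
  rewrite Rabs_Ropp; apply Rplus_le_compat; auto.
Qed.

End ScalarEquation.

From HB Require Import structures.
From mathcomp Require Import all_boot all_order all_algebra.
From mathcomp Require Import boolp reals Rstruct ring lra zify.
Require Import Defs.
Set Implicit Arguments. Unset Strict Implicit. Unset Printing Implicit Defensive.
Import Order.TTheory GRing.Theory Num.Theory.
Local Open Scope ring_scope.
Bind Scope ring_scope with R Cx.

(** * Formal power series over a commutative ring *)

Definition ps (K : Type) : Type := nat -> K.

HB.instance Definition _ (K : Type) := gen_eqMixin (ps K).
HB.instance Definition _ (K : Type) := gen_choiceMixin (ps K).

Section PowerSeriesRing.
Variable K : comNzRingType.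
Implicit Types u v w : ps K.

Definition ps_trunc (n : nat) u : {poly K} := \poly_(i < n) u i.
Definition ps_add u v : ps K := fun n => u n + v n.
Definition ps_opp u : ps K := fun n => - u n.
Definition ps_zero : ps K := fun=> 0.
Definition ps_one : ps K := fun n => (n == 0%N)%:R.
Definition ps_mul u v : ps K := fun n => \sum_(k < n.+1) u k * v (n - k)%N.

Lemma coef_mul_local (p p' q q' : {poly K}) n :
  (forall i, (i <= n)%N -> p`_i = p'`_i) -> (forall i, (i <= n)%N -> q`_i = q'`_i) ->
  (p * q)`_n = (p' * q')`_n.
Proof.
move=> hp hq; rewrite !coefM; apply: eq_bigr => k _.
by rewrite hp ?hq ?leq_subr // -ltnS.
Qed.

(** A coefficient of a product depends on finitely many others, so the ring laws are inherited from
    [{poly K}]. The cutoff [N] is free, so that one cutoff serves all coefficients up to [n] in a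
    triple product. *)
Lemma ps_mul_trunc N u v n : (n < N)%N -> ps_mul u v n = (ps_trunc N u * ps_trunc N v)`_n.
Proof.
move=> hn; rewrite coefM; apply: eq_bigr => k _.
have hk := ltn_ord k; rewrite !coef_poly.
by rewrite (leq_trans hk hn) (leq_ltn_trans (leq_subr _ _) hn).
Qed.

Lemma ps_mulC : commutative ps_mul.
Proof.
by move=> u v; apply/funext => n; rewrite !(@ps_mul_trunc n.+1) // mulrC.
Qed.

Lemma ps_mulA : associative ps_mul.
Proof.
move=> u v w; apply/funext => n; rewrite !(@ps_mul_trunc n.+1) //.
transitivity ((ps_trunc n.+1 u * (ps_trunc n.+1 v * ps_trunc n.+1 w))`_n).
  apply: coef_mul_local => // i hi; rewrite coef_poly ltnS hi.
  by rewrite -(ps_mul_trunc v w) // ltnS.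
rewrite mulrA; apply: coef_mul_local => // i hi; rewrite coef_poly ltnS hi.
by rewrite (ps_mul_trunc (N := n.+1)) // ltnS.
Qed.

Lemma ps_mul1 : left_id ps_one ps_mul.
Proof.
move=> u; apply/funext => n; rewrite /ps_mul big_ord_recl /ps_one eqxx mul1r subn0.
by rewrite big1 ?addr0 // => i _; rewrite mul0r.
Qed.

Lemma ps_mulD : left_distributive ps_mul ps_add.
Proof.
move=> u v w; apply/funext => n; rewrite /ps_add /ps_mul -big_split /=.
by apply: eq_bigr => i _; rewrite mulrDl.
Qed.

Lemma ps_addA : associative ps_add.
Proof. by move=> u v w; apply/funext => n; rewrite /ps_add addrA. Qed.
Lemma ps_addC : commutative ps_add.
Proof. by move=> u v; apply/funext => n; rewrite /ps_add addrC. Qed.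
Lemma ps_add0 : left_id ps_zero ps_add.
Proof. by move=> u; apply/funext => n; rewrite /ps_add add0r. Qed.
Lemma ps_addN : left_inverse ps_zero ps_opp ps_add.
Proof. by move=> u; apply/funext => n; rewrite /ps_add addNr. Qed.

HB.instance Definition _ := GRing.isZmodule.Build (ps K) ps_addA ps_addC ps_add0 ps_addN.

Lemma ps_one_neq0 : ps_one != 0 :> ps K.
Proof. by apply/eqP => /(congr1 (fun u => u 0%N)) /eqP; rewrite /ps_one eqxx oner_eq0. Qed.

HB.instance Definition _ :=
  GRing.Zmodule_isComNzRing.Build (ps K) ps_mulA ps_mulC ps_mul1 ps_mulD ps_one_neq0.

Lemma psD u v n : (u + v) n = u n + v n. Proof. by []. Qed.
Lemma psN u n : (- u) n = - u n. Proof. by []. Qed.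
Lemma psB u v n : (u - v) n = u n - v n. Proof. by []. Qed.
Lemma ps0 n : (0 : ps K) n = 0. Proof. by []. Qed.
Lemma ps1 n : (1 : ps K) n = (n == 0%N)%:R. Proof. by []. Qed.
Lemma psM u v n : (u * v) n = \sum_(k < n.+1) u k * v (n - k)%N. Proof. by []. Qed.
Lemma ps_sum (I : Type) (r : seq I) (Q : pred I) (F : I -> ps K) n :
  (\sum_(i <- r | Q i) F i) n = \sum_(i <- r | Q i) F i n.
Proof. by apply: (big_morph (fun u : ps K => u n)). Qed.
Lemma psMn u k n : (u *+ k) n = u n *+ k.
Proof. by elim: k => [|k IH]; rewrite ?mulr0n // !mulrS psD IH. Qed.

Definition pder u : ps K := fun n => u n.+1 *+ n.+1.

Lemma pderM u v : pder (u * v) = pder u * v + u * pder v.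
Proof.
apply/funext => n.
(* The cutoff is [n.+2] because coefficient [n] of a derivative reads coefficient [n.+1]. *)
have dt w : forall i, (i <= n)%N -> ((ps_trunc n.+2 w)^`())`_i = pder w i.
  by move=> i hi; rewrite coef_deriv coef_poly ltnS (leq_ltn_trans hi).
have -> : pder (u * v) n = ((ps_trunc n.+2 u * ps_trunc n.+2 v)^`())`_n.
  by rewrite coef_deriv -ps_mul_trunc.
rewrite derivM coefD psD; congr (_ + _); rewrite coefM psM; apply: eq_bigr => k _.
  have hk : (k <= n)%N by rewrite -ltnS.
  by rewrite dt // coef_poly ltnS (leq_trans (leq_subr _ _)).
have hk : (k <= n)%N by rewrite -ltnS.
by rewrite dt ?leq_subr // coef_poly ltnS (leq_trans hk).
Qed.

Definition pX : ps K := fun n => (n == 1%N)%:R.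

Lemma pXM u n : (pX * u) n = if n is m.+1 then u m else 0.
Proof.
rewrite psM; case: n => [|n]; first by rewrite big_ord1 /pX mul0r.
rewrite (bigD1 (inord 1)) //= inordK // /pX eqxx mul1r subSS subn0 big1 ?addr0 //.
by move=> i; rewrite -val_eqE /= inordK // => /negbTE ->; rewrite mul0r.
Qed.

Definition psC (c : K) : ps K := fun n => if n == 0%N then c else 0.

Lemma psCM c u n : (psC c * u) n = c * u n.
Proof.
rewrite psM big_ord_recl /psC eqxx subn0 big1 ?addr0 // => i _.
by rewrite mul0r.
Qed.

End PowerSeriesRing.
Arguments pX {K}.

(* For [u : ps2 K], [u i j] is the coefficient of P^i Q^j. *)
Notation ps2 K := (ps (ps K)).

(** * Series in two variables: partial derivatives, the monomial derivation, the Poisson bracket *)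

Section BivariateSeries.
Variable K : comNzRingType.
Implicit Types u v w f p q : ps2 K.

Lemma ps2P u v : (forall i j, u i j = v i j) -> u = v.
Proof. by move=> h; apply/funext => i; apply/funext => j. Qed.

Lemma ps2M u v i j :
  (u * v) i j = \sum_(k < i.+1) \sum_(l < j.+1) u k l * v (i - k)%N (j - l)%N.
Proof. by rewrite psM ps_sum; apply: eq_bigr => k _; rewrite psM. Qed.

Lemma ps2_sum (I : Type) (r : seq I) (Q : pred I) (F : I -> ps2 K) i j :
  (\sum_(k <- r | Q k) F k) i j = \sum_(k <- r | Q k) F k i j.
Proof. by rewrite !ps_sum. Qed.

Definition cst (c : K) : ps2 K := psC (psC c).
Definition PP : ps2 K := pX.
Definition QQ : ps2 K := psC pX.

Lemma cstM c u i j : (cst c * u) i j = c * u i j.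
Proof. by rewrite !psCM. Qed.
Lemma PPM u i j : (PP * u) i j = if i is k.+1 then u k j else 0.
Proof. by rewrite pXM; case: i. Qed.
Lemma QQM u i j : (QQ * u) i j = if j is k.+1 then u i k else 0.
Proof. by rewrite psCM pXM. Qed.
Lemma PPE i j : PP i j = ((i == 1%N) && (j == 0%N))%:R.
Proof. by rewrite /PP /pX; case: i => [|[|i]]; case: j => [|j]. Qed.
Lemma QQE i j : QQ i j = ((i == 0%N) && (j == 1%N))%:R.
Proof. by rewrite /QQ /psC /pX; case: i => [|i]; case: j => [|[|j]]. Qed.

Definition dP u : ps2 K := pder u.
Definition dQ u : ps2 K := fun i => pder (u i).

Lemma dPE u i j : dP u i j = u i.+1 j *+ i.+1. Proof. exact: psMn. Qed.
Lemma dQE u i j : dQ u i j = u i j.+1 *+ j.+1. Proof. by []. Qed.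

Lemma dPM u v : dP (u * v) = dP u * v + u * dP v. Proof. exact: pderM. Qed.
Lemma dQM u v : dQ (u * v) = dQ u * v + u * dQ v.
Proof.
apply/funext => i; rewrite /dQ psM psD !psM -big_split /=.
have pder_sum (I : Type) (r : seq I) (F : I -> ps K) :
  pder (\sum_(k <- r) F k) = \sum_(k <- r) pder (F k).
  apply/funext => n; rewrite ps_sum /pder ps_sum -sumrMnl //.
by rewrite pder_sum; apply: eq_bigr => k _; rewrite pderM.
Qed.
Lemma dPD u v : dP (u + v) = dP u + dP v.
Proof. by apply/ps2P => i j; rewrite !psD !dPE !psD mulrnDl. Qed.
Lemma dQD u v : dQ (u + v) = dQ u + dQ v.
Proof. by apply/ps2P => i j; rewrite !psD !dQE !psD mulrnDl. Qed.
Lemma dPN u : dP (- u) = - dP u.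
Proof. by apply/ps2P => i j; rewrite !psN !dPE !psN mulNrn. Qed.
Lemma dQN u : dQ (- u) = - dQ u.
Proof. by apply/ps2P => i j; rewrite !psN !dQE !psN mulNrn. Qed.
Lemma dPdQ u : dP (dQ u) = dQ (dP u).
Proof. by apply/ps2P => i j; rewrite !(dPE, dQE) -!mulrnA mulnC. Qed.
Lemma dP_PP : dP PP = 1.
Proof.
apply/ps2P => i j; rewrite dPE PPE eqSS !ps1; case: i => [|i] /=; last by rewrite mul0rn.
by case: j.
Qed.
Lemma dQ_PP : dQ PP = 0.
Proof. by apply/ps2P => i j; rewrite dQE PPE andbF mul0rn. Qed.
Lemma dP_QQ : dP QQ = 0.
Proof. by apply/ps2P => i j; rewrite dPE QQE mul0rn. Qed.
Lemma dQ_QQ : dQ QQ = 1.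
Proof.
apply/ps2P => i j; rewrite dQE QQE eqSS !ps1; case: i => [|i] /=; last by rewrite mul0rn.
by case: j => [|j] //; rewrite /= mul0rn.
Qed.
Lemma dP_cst c : dP (cst c) = 0.
Proof. by apply/ps2P => i j; rewrite dPE mul0rn. Qed.
Lemma dQ_cst c : dQ (cst c) = 0.
Proof.
by apply/ps2P => i j; rewrite dQE /cst /psC; case: (i == 0%N); rewrite mul0rn.
Qed.

Lemma cstMn c n : cst (c *+ n) = cst c *+ n.
Proof.
apply/ps2P => i j; rewrite !psMn /cst /psC.
by case: i => [|i]; case: j => [|j] //=; rewrite mul0rn.
Qed.

(* The derivation Q d/dQ - P d/dP, whose eigenvectors are the monomials. *)
Definition grad u : ps2 K := fun i j => (j%:R - i%:R) * u i j.

Lemma gradE u : grad u = QQ * dQ u - PP * dP u.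
Proof.
apply/ps2P => i j; rewrite !psB QQM PPM /grad mulrBl; congr (_ - _).
  by case: j => [|j]; rewrite ?mul0r // dQE mulr_natl.
by case: i => [|i]; rewrite ?mul0r // dPE mulr_natl.
Qed.

Definition br u v : ps2 K := dP u * dQ v - dQ u * dP v.

(** The bracket is the divergence [dQ (dP u * v) - dP (dQ u * v)], and on the coefficient of
    [P^k Q^k] both outer derivatives multiply by the same [k.+1]. A condition on the diagonal of a
    bracket thus becomes one on a product, which can be solved for single coefficients. *)
Lemma br_diag u v k : br u v k k = - (k.+1)%:R * (grad u * v) k.+1 k.+1.
Proof.
have -> : br u v = dQ (dP u * v) - dP (dQ u * v).
  by rewrite /br dPM dQM -dPdQ; ring.
rewrite gradE mulrBl -!mulrA !psB dPE dQE QQM PPM mulNr mulr_natl.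
by rewrite mulrnBl opprB.
Qed.

(** [z] stands for a function of [P Q]. The terms in which [z] is differentiated add up to
    [grad z * br u v]. *)
Lemma grad_br_scale z u v : grad z = 0 ->
  br (z * grad u) v + br u (z * grad v) = z * (br (grad u) v + br u (grad v)).
Proof.
rewrite gradE => /eqP; rewrite subr_eq0 => /eqP hz.
rewrite /br !dPM !dQM !gradE.
have : (QQ * dQ z - PP * dP z) * br u v = 0 by rewrite hz subrr mul0r.
rewrite /br => h; apply/eqP; rewrite -subr_eq0 -[X in _ == X]h; apply/eqP.
rewrite !(dPD, dQD, dPN, dQN, dPM, dQM) ; ring.
Qed.

(** [grad] is the bracket with [P Q], so this is the Jacobi identity. *)
Lemma grad_br u v : grad (br u v) = br (grad u) v + br u (grad v).
Proof.
rewrite /br !gradE !(dPD, dQD, dPN, dQN, dPM, dQM).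
rewrite dP_PP dQ_PP dP_QQ dQ_QQ -!dPdQ; ring.
Qed.

(** * Degree filtration *)

Definition ord_ge n u := forall i j, (i + j < n)%N -> u i j = 0.

Lemma ord_geD n u v : ord_ge n u -> ord_ge n v -> ord_ge n (u + v).
Proof. by move=> hu hv i j h; rewrite !psD hu ?hv ?addr0. Qed.
Lemma ord_geN n u : ord_ge n u -> ord_ge n (- u).
Proof. by move=> hu i j h; rewrite !psN hu ?oppr0. Qed.
Lemma ord_geB n u v : ord_ge n u -> ord_ge n v -> ord_ge n (u - v).
Proof. by move=> hu hv; apply/ord_geD/ord_geN. Qed.
Lemma ord_ge_sum n (I : Type) (r : seq I) (Q : pred I) (F : I -> ps2 K) :
  (forall i, Q i -> ord_ge n (F i)) -> ord_ge n (\sum_(i <- r | Q i) F i).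
Proof. by move=> h; apply: big_ind => // u v; apply: ord_geD. Qed.
Lemma ord_ge_leq m n u : (m <= n)%N -> ord_ge n u -> ord_ge m u.
Proof. by move=> hmn hu i j h; apply: hu; apply: leq_trans hmn. Qed.

Lemma ord_geM m n u v : ord_ge m u -> ord_ge n v -> ord_ge (m + n) (u * v).
Proof.
move=> hu hv i j h; rewrite ps2M big1 // => k _; rewrite big1 // => l _.
have hk := ltn_ord k; have hl := ltn_ord l.
have [hm|hm] := ltnP (k + l) m; first by rewrite hu ?mul0r.
by rewrite hv ?mulr0 //; lia.
Qed.
Lemma ord_geMl n u v : ord_ge n v -> ord_ge n (u * v).
Proof. by move=> h; apply: (@ord_geM 0). Qed.
Lemma ord_geMr n u v : ord_ge n u -> ord_ge n (u * v).
Proof. by move=> h; rewrite mulrC; apply: ord_geMl. Qed.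
Lemma ord_geX a u : ord_ge 1 u -> ord_ge a (u ^+ a).
Proof. by move=> h; elim: a => [|a IH] //; rewrite exprS; apply: (@ord_geM 1). Qed.
Lemma ord_ge_dP n u : ord_ge n.+1 u -> ord_ge n (dP u).
Proof. by move=> h i j hij; rewrite dPE h ?mul0rn. Qed.
Lemma ord_ge_dQ n u : ord_ge n.+1 u -> ord_ge n (dQ u).
Proof. by move=> h i j hij; rewrite dQE h ?mul0rn // addnS. Qed.
Lemma ord_ge_grad n u : ord_ge n u -> ord_ge n (grad u).
Proof. by move=> h i j hij; rewrite /grad h ?mulr0. Qed.
Lemma ord_ge_PP : ord_ge 1 PP.
Proof. by case=> [|i] [|j]. Qed.
Lemma ord_ge_QQ : ord_ge 1 QQ.
Proof. by case=> [|i] [|j]. Qed.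

Lemma ord_geXB a n p p' : ord_ge 1 p -> ord_ge 1 p' -> ord_ge n (p - p') ->
  ord_ge (n + a) (p ^+ a.+1 - p' ^+ a.+1).
Proof.
move=> hp hp' h; rewrite subrXX; apply: ord_geM => //; apply: ord_ge_sum => i _.
have hi := ltn_ord i; apply: (@ord_ge_leq _ ((a.+1 - i.+1) + i)); first by lia.
by apply: ord_geM; apply: ord_geX.
Qed.

(** * Composition of formal series *)

(** When [p] and [q] have no constant term, a monomial of degree above [i + j] cannot reach the
    coefficient [(i, j)], so the finite sum is the full substitution. *)
Definition comp f p q : ps2 K := fun i j =>
  \sum_(a < (i + j).+1) \sum_(b < (i + j).+1) f a b * (p ^+ a * q ^+ b) i j.

(** The two cutoffs are independent because a derivative in one variable of [f] lowers the cutoff of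
    that variable only. *)
Definition comp_fin N M f p q : ps2 K :=
  \sum_(a < N) \sum_(b < M) cst (f a b) * (p ^+ a * q ^+ b).

Lemma comp_fin_coef N M f p q i j : comp_fin N M f p q i j =
  \sum_(a < N) \sum_(b < M) f a b * (p ^+ a * q ^+ b) i j.
Proof.
rewrite /comp_fin ps2_sum; apply: eq_bigr => a _; rewrite ps2_sum.
by apply: eq_bigr => b _; rewrite cstM.
Qed.

Section Composition.
Variables p q : ps2 K.
Hypotheses (hp : ord_ge 1 p) (hq : ord_ge 1 q).

Lemma ord_ge_mono a b : ord_ge (a + b) (p ^+ a * q ^+ b).
Proof. by apply: ord_geM; apply: ord_geX. Qed.

Lemma big_ord_extend (n N : nat) (F : nat -> K) : (n <= N)%N ->
  (forall a, (n <= a)%N -> F a = 0) -> \sum_(a < n) F a = \sum_(a < N) F a.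
Proof.
move=> h hF; rewrite -(subnKC h) big_split_ord /= [X in _ = _ + X]big1 ?addr0 //.
by move=> i _; apply: hF; rewrite leq_addr.
Qed.

Lemma comp_truncE N M f i j : (i + j < N)%N -> (i + j < M)%N ->
  comp f p q i j = comp_fin N M f p q i j.
Proof.
move=> hN hM; rewrite comp_fin_coef /comp.
pose F a := \sum_(b < M) f a b * (p ^+ a * q ^+ b) i j.
rewrite -(@big_ord_extend (i + j).+1 N F) //; last first.
  move=> a ha; rewrite /F big1 // => b _.
  by rewrite ord_ge_mono ?mulr0 //; rewrite ltn_addr.
apply: eq_bigr => a _.
apply: (big_ord_extend (F := fun b => f a b * (p ^+ a * q ^+ b) i j)) => // b hb.
by rewrite ord_ge_mono ?mulr0 // ltn_addl.
Qed.

Lemma comp_trunc n N M f : (n <= N)%N -> (n <= M)%N ->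
  ord_ge n (comp f p q - comp_fin N M f p q).
Proof.
by move=> hN hM i j h; rewrite !psB (@comp_truncE N M) ?subrr // (leq_trans h).
Qed.

Lemma comp_ord_ge n f : ord_ge n f -> ord_ge n (comp f p q).
Proof.
move=> hf i j h; rewrite /comp big1 // => a _; rewrite big1 // => b _.
have [hab|hab] := ltnP (a + b) n; first by rewrite hf ?mul0r.
by rewrite ord_ge_mono ?mulr0 // (leq_trans h).
Qed.

(** The chain rule is exact on polynomial truncations. Since [d] lowers the order by at most one,
    the error has every order and is zero. *)
Lemma comp_derivation (d : ps2 K -> ps2 K) f :
  (forall u v, d (u + v) = d u + d v) -> (forall u v, d (u * v) = d u * v + u * d v) ->
  (forall c, d (cst c) = 0) -> (forall n u, ord_ge n.+1 u -> ord_ge n (d u)) ->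
  d (comp f p q) = comp (dP f) p q * d p + comp (dQ f) p q * d q.
Proof.
move=> dD dM dc dn.
have d0 : d 0 = 0 by apply: (addrI (d 0)); rewrite -dD !addr0.
have dN u : d (- u) = - d u by apply: (addrI (d u)); rewrite -dD !subrr.
have dsum (n : nat) (F : nat -> ps2 K) : d (\sum_(i < n) F i) = \sum_(i < n) d (F i).
  by elim: n => [|n IH]; rewrite ?big_ord0 // !big_ord_recr /= dD IH.
have dX u n : d (u ^+ n.+1) = (u ^+ n * d u) *+ n.+1.
  elim: n => [|n IH]; first by rewrite expr1 expr0 mul1r.
  rewrite exprS dM IH mulrnAr mulrA -exprS [RHS]mulrS; congr (_ + _).
  by rewrite mulrC.
have d1 : d 1 = 0.
  by have := dM 1 1; rewrite !mulr1 mul1r => h; apply: (addrI (d 1)); rewrite addr0.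
have key n : d (comp_fin n.+1 n.+1 f p q) =
    comp_fin n n.+1 (dP f) p q * d p + comp_fin n.+1 n (dQ f) p q * d q.
  rewrite /comp_fin (dsum n.+1 (fun a => \sum_(b < n.+1) cst (f a b) * (p ^+ a * q ^+ b))).
  under eq_bigr => a _.
    rewrite (dsum n.+1 (fun b => cst (f a b) * (p ^+ a * q ^+ b))).
    under eq_bigr => b _ do rewrite dM dc mul0r add0r dM mulrDr.
    rewrite big_split /=; over.
  rewrite big_split /=; congr (_ + _).
    rewrite big_ord_recl [X in X + _]big1 ?add0r; last first.
      by move=> b _; rewrite expr0 d1 mul0r mulr0.
    rewrite mulr_suml; apply: eq_bigr => a _; rewrite mulr_suml; apply: eq_bigr => b _.
    rewrite lift0 dX /= mulrnAl mulrnAr.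
    rewrite dPE cstMn.
    by rewrite !mulrnAl; congr (_ *+ _); ring.
  rewrite mulr_suml; apply: eq_bigr => a _.
  rewrite big_ord_recl expr0 d1 !mulr0 add0r mulr_suml; apply: eq_bigr => b _.
  rewrite lift0 dX /= !mulrnAr.
  rewrite dQE cstMn.
  by rewrite !mulrnAl; congr (_ *+ _); ring.
suff main n : ord_ge n (d (comp f p q) - (comp (dP f) p q * d p + comp (dQ f) p q * d q)).
  apply/ps2P => i j; apply/eqP; rewrite -subr_eq0; apply/eqP.
  by have := main (i + j).+1 i j (ltnSn _); rewrite !psB.
have -> : d (comp f p q) - (comp (dP f) p q * d p + comp (dQ f) p q * d q) =
   d (comp f p q - comp_fin n.+1 n.+1 f p q)
   - (comp (dP f) p q - comp_fin n n.+1 (dP f) p q) * d p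
   - (comp (dQ f) p q - comp_fin n.+1 n (dQ f) p q) * d q.
  rewrite dD dN key; ring.
apply: ord_geB; first apply: ord_geB.
- by apply: dn; apply: comp_trunc.
- by apply: ord_geMr; apply: comp_trunc.
- by apply: ord_geMr; apply: comp_trunc.
Qed.

Lemma br_compl f v : br (comp f p q) v =
  comp (dP f) p q * br p v + comp (dQ f) p q * br q v.
Proof.
rewrite /br (comp_derivation f dPD dPM dP_cst ord_ge_dP).
rewrite (comp_derivation f dQD dQM dQ_cst ord_ge_dQ); ring.
Qed.

End Composition.

(** An outer series that starts in degree two gains a degree: each monomial of the difference keeps,
    next to a factor [p - p'] or [q - q'], another factor of order one. This gain makes the iterates
    stabilize. *)
Lemma comp_ord_geB n f p q p' q' : ord_ge 1 p -> ord_ge 1 q -> ord_ge 1 p' -> ord_ge 1 q' ->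
  ord_ge 2 f -> ord_ge n (p - p') -> ord_ge n (q - q') ->
  ord_ge n.+1 (comp f p q - comp f p' q').
Proof.
move=> hp hq hp' hq' hf hpp hqq i j h.
rewrite !psB /comp -sumrB big1 // => a _; rewrite -sumrB big1 // => b _.
rewrite -mulrBr; have [hab|hab] := ltnP (a + b) 2; first by rewrite hf ?mul0r.
suff : ord_ge n.+1 (p ^+ a * q ^+ b - p' ^+ a * q' ^+ b).
  by move=> /(_ i j h); rewrite !psB => ->; rewrite mulr0.
have -> : p ^+ a * q ^+ b - p' ^+ a * q' ^+ b =
  (p ^+ a - p' ^+ a) * q ^+ b + p' ^+ a * (q ^+ b - q' ^+ b) by ring.
apply: ord_geD.
- case: {h} (nat_of_ord a) hab => [|c] hab; first by rewrite subrr mul0r.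
  apply: (@ord_ge_leq _ (n + c + b)); first by lia.
  by apply: ord_geM; [apply: ord_geXB | apply: ord_geX].
- case: {h} (nat_of_ord b) hab => [|c] hab; first by rewrite subrr mulr0.
  apply: (@ord_ge_leq _ (a + (n + c))); first by lia.
  by apply: ord_geM; [apply: ord_geX | apply: ord_geXB].
Qed.

End BivariateSeries.
Arguments PP {K}.
Arguments QQ {K}.

(** * The complex numbers as a normed ring *)

HB.instance Definition _ := gen_eqMixin Cx.
HB.instance Definition _ := gen_choiceMixin Cx.

Ltac cx_ring :=
  rewrite /Cadd /Cmul /Copp /C0 /C1 /=; congr (_, _);
  rewrite ?(RplusE, RmultE, RoppE, RminusE, R0E, R1E) /=; ring.
Lemma Cadd_assoc : associative Cadd.
Proof. by move=> [a b] [c d] [e f]; cx_ring. Qed.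
Lemma Cadd_comm : commutative Cadd.
Proof. by move=> [a b] [c d]; cx_ring. Qed.
Lemma Cadd_0l : left_id C0 Cadd.
Proof. by move=> [a b]; cx_ring. Qed.
Lemma Cadd_Nl : left_inverse C0 Copp Cadd.
Proof. by move=> [a b]; cx_ring. Qed.
Lemma Cmul_assoc : associative Cmul.
Proof. by move=> [a b] [c d] [e f]; cx_ring. Qed.
Lemma Cmul_comm : commutative Cmul.
Proof. by move=> [a b] [c d]; cx_ring. Qed.
Lemma Cmul_1l : left_id C1 Cmul.
Proof. by move=> [a b]; cx_ring. Qed.
Lemma Cmul_Dl : left_distributive Cmul Cadd.
Proof. by move=> [a b] [c d] [e f]; cx_ring. Qed.
HB.instance Definition _ :=
  GRing.isZmodule.Build Cx Cadd_assoc Cadd_comm Cadd_0l Cadd_Nl.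
Lemma C1_neq0 : C1 != 0 :> Cx.
Proof. by apply/eqP => /(congr1 fst) /eqP; rewrite /= oner_eq0. Qed.
HB.instance Definition _ :=
  GRing.Zmodule_isComNzRing.Build Cx Cmul_assoc Cmul_comm Cmul_1l Cmul_Dl C1_neq0.

Lemma CaddE (z w : Cx) : Cadd z w = z + w. Proof. by []. Qed.
Lemma CoppE (z : Cx) : Copp z = - z. Proof. by []. Qed.
Lemma CsubE (z w : Cx) : Csub z w = z - w. Proof. by []. Qed.
Lemma CmulE (z w : Cx) : Cmul z w = z * w. Proof. by []. Qed.
Lemma C0E : C0 = 0 :> Cx. Proof. by []. Qed.
Lemma C1E : C1 = 1 :> Cx. Proof. by []. Qed.
Lemma CpowE (z : Cx) n : Cpow z n = z ^+ n.
Proof. by elim: n => [|n IH] //=; rewrite IH CmulE -exprS. Qed.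
Lemma CsumE (g : nat -> Cx) n : Csum g n = \sum_(k < n.+1) g k.
Proof. by elim: n => [|n IH]; rewrite ?big_ord1 // big_ord_recr -IH. Qed.
Definition CE := (CaddE, CsubE, CoppE, CmulE, C0E, C1E, CpowE, CsumE).

Definition cn : Cx -> R := Cmod.

Lemma cnE z : cn z = Complex.Cmod z.
Proof. by rewrite /cn /Cmod /Complex.Cmod /= !Rmult_1_r. Qed.
Lemma cn_ge0 z : 0 <= cn z.
Proof. by rewrite cnE; apply/RleP/Complex.Cmod_ge_0. Qed.
Lemma cnD (z w : Cx) : cn (z + w) <= cn z + cn w.
Proof. by rewrite !cnE; apply/RleP/Complex.Cmod_triangle. Qed.
Lemma cnM (z w : Cx) : cn (z * w) = cn z * cn w.
Proof. by rewrite !cnE; apply: Complex.Cmod_mult. Qed.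
Lemma cnN (z : Cx) : cn (- z) = cn z.
Proof. by rewrite !cnE; apply: Complex.Cmod_opp. Qed.
Lemma cn0 : cn 0 = 0.
Proof. by rewrite cnE; apply: Complex.Cmod_0. Qed.
Lemma cn1 : cn 1 = 1.
Proof. by rewrite cnE; apply: Complex.Cmod_1. Qed.
Lemma cn_eq0 z : cn z = 0 -> z = 0.
Proof. by rewrite cnE => h; apply: Complex.Cmod_eq_0. Qed.
Lemma cnB (z w : Cx) : cn (z - w) <= cn z + cn w.
Proof. by rewrite -(cnN w) cnD. Qed.
Lemma cnX (z : Cx) n : cn (z ^+ n) = cn z ^+ n.
Proof. by elim: n => [|n IH]; rewrite ?expr0 ?cn1 // !exprS cnM IH. Qed.
Lemma cn_sum (I : Type) (r : seq I) (Q : pred I) (F : I -> Cx) :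
  cn (\sum_(i <- r | Q i) F i) <= \sum_(i <- r | Q i) cn (F i).
Proof.
elim/big_rec2: _ => [|i y z _ h]; first by rewrite cn0.
by rewrite (le_trans (cnD _ _)) // lerD2l.
Qed.
Lemma cn_re (z : Cx) : `|Cre z| <= cn z.
Proof.
rewrite cnE -RabsE; apply/RleP; apply: Rle_trans (Complex.Rmax_Cmod z).
exact: Rmax_l.
Qed.
Lemma cn_im (z : Cx) : `|Cim z| <= cn z.
Proof.
rewrite cnE -RabsE; apply/RleP; apply: Rle_trans (Complex.Rmax_Cmod z).
exact: Rmax_r.
Qed.
Lemma cn_le_reim (z : Cx) : cn z <= `|Cre z| + `|Cim z|.
Proof.
rewrite /cn /Cmod RsqrtE ?RplusE ?RmultE -/(Cre z) -/(Cim z).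
rewrite -[leRHS]ger0_norm ?addr_ge0 // -sqrtr_sqr ler_wsqrtr //.
rewrite -!expr2 -[in leLHS](real_normK (num_real (Cre z))).
rewrite -[in leLHS](real_normK (num_real (Cim z))).
have := normr_ge0 (Cre z); have := normr_ge0 (Cim z); nra.
Qed.

Definition rC (r : R) : Cx := RtoC r.
Lemma cn_rC r : cn (rC r) = `|r|.
Proof. by rewrite cnE -RabsE; apply: (Complex.Cmod_R r). Qed.
Lemma rC_natr n : rC n%:R = n%:R.
Proof.
elim: n => [|n IH] //; rewrite !mulrS -IH; rewrite /rC /RtoC -CaddE /Cadd /=.
by congr (_, _); rewrite /= ?RplusE addr0.
Qed.
Lemma rCM r s : rC (r * s) = rC r * rC s.
Proof.
rewrite -CmulE /Cmul /rC /RtoC /=; congr (_, _);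
  rewrite ?(RplusE, RmultE, RoppE, RminusE, R0E) /=; ring.
Qed.
Lemma rCD r s : rC (r + s) = rC r + rC s.
Proof.
rewrite -CaddE /Cadd /rC /RtoC /=; congr (_, _);
  rewrite ?(RplusE, RmultE, RoppE, RminusE, R0E) /=; ring.
Qed.
Lemma rCN r : rC (- r) = - rC r.
Proof. rewrite -CoppE /Copp /rC /RtoC /=; congr (_, _); rewrite ?(RoppE, R0E) /=; ring. Qed.
Lemma cn_natr n : cn n%:R = n%:R.
Proof. by rewrite -rC_natr cn_rC ger0_norm. Qed.
Lemma cnMn z n : cn (z *+ n) = cn z *+ n.
Proof. by rewrite -mulr_natl cnM cn_natr mulr_natl. Qed.

(** * Square partial sums of double series and of their products *)

Section DoubleSums.
Variable V : nmodType.

Definition dsum n (x : nat -> nat -> V) : V := \sum_(i < n) \sum_(j < n) x i j.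

Lemma sum_triangle (F : nat -> nat -> V) n :
  \sum_(i < n) \sum_(k < i.+1) F k (i - k)%N = \sum_(k < n) \sum_(m < n - k) F k m.
Proof.
elim: n => [|n IH]; first by rewrite !big_ord0.
rewrite big_ord_recr /= IH [RHS]big_ord_recr /= subSnn big_ord1.
rewrite [X in _ + X]big_ord_recr /= subnn addrA -big_split /=; congr (_ + _).
by apply: eq_bigr => k _; rewrite subSn ?(ltnW (ltn_ord k)) // big_ord_recr.
Qed.

Definition outside n (x : nat -> nat -> V) i j := if (i < n)%N && (j < n)%N then 0 else x i j.

Lemma dsum_split n m x : (n <= m)%N -> dsum m x = dsum n x + dsum m (outside n x).
Proof.
move=> h; rewrite /dsum (big_ord_widen m (fun i => \sum_(j < n) x i j)) //.
rewrite [X in X + _]big_mkcond -big_split /=; apply: eq_bigr => i _; rewrite /outside.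
case: ifP => hi /=; last by rewrite add0r.
rewrite [X in X + _](big_ord_widen m (fun j => x i j)) // [X in X + _]big_mkcond -big_split /=.
by apply: eq_bigr => j _; case: ifP; rewrite ?addr0 ?add0r.
Qed.

End DoubleSums.

Section TwistedCoefficients.
Variable K : comNzRingType.
Implicit Types u v : ps2 K.

Definition tm u (x y : K) i j := u i j * (x ^+ i * y ^+ j).

Lemma dsum_mul n u v x y : dsum n (tm (u * v) x y) =
  \sum_(k < n) \sum_(m < n - k) \sum_(l < n) \sum_(o < n - l)
     tm u x y k l * tm v x y m o.
Proof.
rewrite -(sum_triangle (fun k m => \sum_(l < n) \sum_(o < n - l) tm u x y k l * tm v x y m o)).
apply: eq_bigr => i _.
under [RHS]eq_bigr => k _ do
  rewrite -(sum_triangle (fun l o => tm u x y k l * tm v x y (i - k)%N o)).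
rewrite exchange_big /=; apply: eq_bigr => j _.
rewrite {1}/tm ps2M mulr_suml; apply: eq_bigr => k _.
rewrite mulr_suml; apply: eq_bigr => l _; rewrite /tm.
have -> : x ^+ i = x ^+ k * x ^+ (i - k) by rewrite -exprD subnKC // -ltnS.
have -> : y ^+ j = y ^+ l * y ^+ (j - l) by rewrite -exprD subnKC // -ltnS.
ring.
Qed.

(** Over quadruples of indices, the square sum of a product series is the part of the product of
    square sums where the exponents add up to less than [n]. Comparing the two becomes a comparison
    of index sets. *)
Lemma dsum_mul_cond n u v x y : dsum n (tm (u * v) x y) =
  \sum_(t : ('I_n * 'I_n) * ('I_n * 'I_n) | (t.1.1 + t.1.2 < n)%N && (t.2.1 + t.2.2 < n)%N)
     tm u x y t.1.1 t.2.1 * tm v x y t.1.2 t.2.2.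
Proof.
rewrite dsum_mul.
rewrite -(pair_big (fun s : 'I_n * 'I_n => (s.1 + s.2 < n)%N) (fun s : 'I_n * 'I_n => (s.1 + s.2 < n)%N)
  (fun s t => tm u x y s.1 t.1 * tm v x y s.2 t.2)) /=.
rewrite -(pair_big_dep xpredT (fun (i j : 'I_n) => (i + j < n)%N)
  (fun i j => \sum_(t : 'I_n * 'I_n | (t.1 + t.2 < n)%N) tm u x y i t.1 * tm v x y j t.2)) /=.
apply: eq_bigr => k _.
have hk := ltn_ord k.
rewrite (big_ord_widen n (fun m => \sum_(l < n) \sum_(o < n - l) tm u x y k l * tm v x y m o));
  last exact: leq_subr.
apply: eq_big => [m|m _]; first by rewrite ltn_subRL.
rewrite -(pair_big_dep xpredT (fun (i j : 'I_n) => (i + j < n)%N)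
  (fun i j => tm u x y k i * tm v x y m j)) /=.
apply: eq_bigr => l _.
rewrite (big_ord_widen n (fun o => tm u x y k l * tm v x y m o)) ?leq_subr //.
by apply: eq_bigl => o; rewrite ltn_subRL.
Qed.

Lemma dsum_mul_full n u v x y : dsum n (tm u x y) * dsum n (tm v x y) =
  \sum_(t : ('I_n * 'I_n) * ('I_n * 'I_n))
     tm u x y t.1.1 t.2.1 * tm v x y t.1.2 t.2.2.
Proof.
rewrite -(pair_big xpredT xpredT
  (fun (s t : 'I_n * 'I_n) => tm u x y s.1 t.1 * tm v x y s.2 t.2)) /=.
rewrite -(pair_big xpredT xpredT
  (fun i j : 'I_n => \sum_(t : 'I_n * 'I_n) tm u x y i t.1 * tm v x y j t.2)) /=.
rewrite /dsum mulr_suml; apply: eq_bigr => k _; rewrite mulr_sumr; apply: eq_bigr => m _.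
rewrite -(pair_big xpredT xpredT
  (fun i j : 'I_n => tm u x y k i * tm v x y m j)) /=.
by rewrite mulr_suml; apply: eq_bigr => l _; rewrite mulr_sumr.
Qed.

End TwistedCoefficients.

Lemma ler_sum_sub (n N : nat) (F G : nat -> R) : (n <= N)%N ->
  (forall i, (i < n)%N -> F i <= G i) -> (forall i, 0 <= G i) ->
  \sum_(i < n) F i <= \sum_(i < N) G i.
Proof.
move=> h hFG hG; rewrite -(subnKC h) big_split_ord /= -[leLHS]addr0.
apply: lerD; first by apply: ler_sum => i _; apply: hFG.
exact: sumr_ge0.
Qed.

Lemma ler_dsum n m (x y : nat -> nat -> R) : (n <= m)%N ->
  (forall i j, (i < n)%N -> (j < n)%N -> x i j <= y i j) -> (forall i j, 0 <= y i j) ->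
  dsum n x <= dsum m y.
Proof.
move=> h hxy hy.
apply: (ler_sum_sub (F := fun i => \sum_(j < n) x i j) (G := fun i => \sum_(j < m) y i j)) => //.
  move=> i hi.
  by apply: (ler_sum_sub (F := x i) (G := y i)) => // j hj; apply: hxy.
by move=> i; apply: sumr_ge0.
Qed.

Definition nonneg (U : nat -> nat -> R) := forall i j, 0 <= U i j.

Lemma nonneg_tm (U : ps2 R) r : 0 <= r -> nonneg U -> nonneg (tm U r r).
Proof. by move=> hr hU i j; rewrite /tm !mulr_ge0 ?exprn_ge0. Qed.

Lemma nonneg_mul (U V : ps2 R) : nonneg U -> nonneg V -> nonneg (U * V).
Proof.
by move=> hU hV i j; rewrite ps2M; do 2!(apply: sumr_ge0 => ? _); rewrite mulr_ge0.
Qed.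

Lemma dsum_mul_ge (U V : ps2 R) r n : 0 <= r -> nonneg U -> nonneg V ->
  dsum n (tm (U * V) r r) <= dsum n (tm U r r) * dsum n (tm V r r).
Proof.
move=> hr hU hV; rewrite dsum_mul_cond dsum_mul_full big_mkcond /=.
apply: ler_sum => t _; case: ifP => // _.
by rewrite mulr_ge0 // nonneg_tm.
Qed.

(** Two indices below [n] add up to less than [n + n]. Hence the terms missing from the square sum
    of a product lie in a tail of the product series, which is how evaluation is shown to be
    multiplicative. *)
Lemma dsum_mul_le (U V : ps2 R) r n : 0 <= r -> nonneg U -> nonneg V ->
  dsum n (tm U r r) * dsum n (tm V r r) <= dsum (n + n) (tm (U * V) r r).
Proof.
move=> hr hU hV; rewrite dsum_mul.
have hU' := nonneg_tm hr hU; have hV' := nonneg_tm hr hV.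
rewrite {1 2}/dsum mulr_suml.
pose G k m := \sum_(l < n + n) \sum_(o < n + n - l) tm U r r k l * tm V r r m o.
have hG k m : 0 <= G k m by do 2!(apply: sumr_ge0 => ? _); rewrite mulr_ge0.
apply: (ler_sum_sub (F := fun k => (\sum_(j < n) tm U r r k j) * \sum_(i < n) \sum_(j < n) tm V r r i j)
  (G := fun k => \sum_(m < n + n - k) G k m)); first by rewrite leq_addr.
  move=> k hk; rewrite mulr_sumr.
  apply: (ler_sum_sub (F := fun m => (\sum_(j < n) tm U r r k j) * \sum_(j < n) tm V r r m j)
     (G := G k)) => //; first by lia.
  move=> m hm; rewrite mulr_suml.
  apply: (ler_sum_sub (F := fun l => tm U r r k l * \sum_(j < n) tm V r r m j)
    (G := fun l => \sum_(o < n + n - l) tm U r r k l * tm V r r m o)); first by rewrite leq_addr.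
    move=> l hl; rewrite mulr_sumr.
    apply: (@ler_sum_sub n (n + n - l) (fun o => tm U r r k l * tm V r r m o)
      (fun o => tm U r r k l * tm V r r m o)) => //; first by lia.
    by move=> i; rewrite mulr_ge0.
  by move=> i; apply: sumr_ge0 => o _; rewrite mulr_ge0.
by move=> i; apply: sumr_ge0.
Qed.

(** * Absolutely convergent double series *)

Definition has_dsum (x : nat -> nat -> Cx) (l : Cx) :=
  forall e : R, 0 < e -> exists N, forall n, (N <= n)%N -> cn (dsum n x - l) <= e.

Lemma dsum_cauchy (W : nat -> nat -> R) (M : R) : nonneg W -> (forall n, dsum n W <= M) ->
  forall e : R, 0 < e -> exists N, forall n m, (N <= n)%N -> dsum m W <= dsum n W + e.
Proof.
move=> hW hM e he.
have [l [hub hl]] : {l | is_lub (fun y => exists n, y = dsum n W) l}.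
  apply: completeness; last by exists (dsum 0 W), 0%N.
  by exists M => y [n ->]; apply/RleP.
have [N hN] : exists N, l - e < dsum N W.
  apply: contrapT => /forallNP h.
  have h1 : l <= l - e.
    by apply/RleP; apply: hl => y [n ->]; apply/RleP; rewrite leNgt; apply/negP/h.
  lra.
exists N => n m h.
have h1 : dsum m W <= l by apply/RleP; apply: hub; exists m.
have h2 : dsum N W <= dsum n W by apply: ler_dsum.
lra.
Qed.

Lemma dsum_dom_split (x : nat -> nat -> Cx) (W : nat -> nat -> R) n m : (n <= m)%N ->
  (forall i j, cn (x i j) <= W i j) -> cn (dsum m x - dsum n x) <= dsum m W - dsum n W.
Proof.
move=> h hx; rewrite (dsum_split x h) (dsum_split W h).
have -> : dsum n x + dsum m (outside n x) - dsum n x = dsum m (outside n x) by ring.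
have -> : dsum n W + dsum m (outside n W) - dsum n W = dsum m (outside n W) by ring.
rewrite /dsum (le_trans (cn_sum _ _ _)) //; apply: ler_sum => i _.
rewrite (le_trans (cn_sum _ _ _)) //; apply: ler_sum => j _.
by rewrite /outside; case: ifP; rewrite ?cn0.
Qed.

Lemma Cx_complete (s : nat -> Cx) :
  (forall e : R, 0 < e -> exists N, forall n m, (N <= n)%N -> (n <= m)%N -> cn (s m - s n) <= e) ->
  exists l, forall e : R, 0 < e -> exists N, forall n, (N <= n)%N -> cn (s n - l) <= e.
Proof.
move=> h.
have proj (f : Cx -> R) : (forall z w, f (z - w) = f z - f w) ->
    (forall z, `|f z| <= cn z) -> exists l, Un_cv (fun n => f (s n)) l.
  move=> fB fn.
  suff /R_complete [l hl] : Cauchy_crit (fun n => f (s n)) by exists l.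
  move=> e /RltP he; have he2 : 0 < e / 4 by rewrite divr_gt0.
  have [N hN] := h _ he2.
  exists N => n m /ssrnat.leP hn /ssrnat.leP hm; apply/RltP.
  have b k : (N <= k)%N -> `|f (s k) - f (s N)| <= e / 4.
    by move=> hk; rewrite -fB (le_trans (fn _)) // hN.
  rewrite RdistE.
  have -> : f (s n) - f (s m) = (f (s n) - f (s N)) - (f (s m) - f (s N)) by ring.
  apply: le_lt_trans (ler_normB _ _) _; have := b n hn; have := b m hm; lra.
have [a ha] : exists l, Un_cv (fun n => Cre (s n)) l by apply: proj => // z; apply: cn_re.
have [b hb] : exists l, Un_cv (fun n => Cim (s n)) l by apply: proj => // z; apply: cn_im.
exists (a, b) => e he; have he2 : 0 < e / 2 by rewrite divr_gt0.
have /RltP he3 := he2.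
have [N1 h1] := ha _ he3; have [N2 h2] := hb _ he3.
exists (maxn N1 N2) => n; rewrite geq_max => /andP [/ssrnat.leP hn1 /ssrnat.leP hn2].
apply: le_trans (cn_le_reim _) _.
have -> : Cre (s n - (a, b)) = Cre (s n) - a by [].
have -> : Cim (s n - (a, b)) = Cim (s n) - b by [].
have /RltP := h1 n hn1; have /RltP := h2 n hn2; rewrite !RdistE; lra.
Qed.

Section Dominated.
Variables (W : nat -> nat -> R) (M : R).
Hypotheses (W0 : nonneg W) (WM : forall n, dsum n W <= M).

Lemma has_dsum_ex (x : nat -> nat -> Cx) : (forall i j, cn (x i j) <= W i j) ->
  exists l, has_dsum x l.
Proof.
move=> hx; apply: (@Cx_complete (fun n => dsum n x)) => e he.
have [N hN] := dsum_cauchy W0 WM he.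
exists N => n m hn hm; apply: le_trans (dsum_dom_split hm hx) _.
by have := hN n m hn; lra.
Qed.

(** The index [N] depends on the majorant alone, so it serves a whole family of dominated series;
    differentiation in time relies on this uniformity. *)
Lemma has_dsum_tail (e : R) : 0 < e -> exists N, forall n x l, (N <= n)%N ->
  (forall i j, cn (x i j) <= W i j) -> has_dsum x l -> cn (l - dsum n x) <= e.
Proof.
move=> he; have he2 : 0 < e / 2 by rewrite divr_gt0.
have [N hN] := dsum_cauchy W0 WM he2.
exists N => n x l hn hx hl; have [N' hN'] := hl _ he2.
have h1 := hN' (maxn n N') (leq_maxr _ _).
have h2 := dsum_dom_split (leq_maxl n N') hx.
have h3 := hN n (maxn n N') hn.
have -> : l - dsum n x = (dsum (maxn n N') x - dsum n x) - (dsum (maxn n N') x - l) by ring.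
by apply: le_trans (cnB _ _) _; lra.
Qed.

Lemma has_dsum_le (x : nat -> nat -> Cx) l : (forall i j, cn (x i j) <= W i j) ->
  has_dsum x l -> cn l <= M.
Proof.
move=> hx hl; rewrite leNgt; apply/negP => h.
have he : 0 < (cn l - M) / 2 by lra.
have [N hN] := hl _ he; have h1 := hN N (leqnn _).
have h2 : cn (dsum N x) <= M.
  apply: le_trans (WM N); rewrite /dsum (le_trans (cn_sum _ _ _)) //.
  by apply: ler_sum => i _; rewrite (le_trans (cn_sum _ _ _)) //; apply: ler_sum.
have : cn l <= cn (dsum N x) + cn (dsum N x - l).
  have {1}-> : l = dsum N x - (dsum N x - l) by ring.
  exact: cnB.
lra.
Qed.

End Dominated.

Lemma has_dsum_unique x l l' : has_dsum x l -> has_dsum x l' -> l = l'.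
Proof.
move=> h h'; apply/eqP; rewrite -subr_eq0; apply/eqP/cn_eq0/eqP.
rewrite eq_le cn_ge0 andbT leNgt; apply/negP => hc.
have he : 0 < cn (l - l') / 4 by rewrite divr_gt0.
have [N hN] := h _ he; have [N' hN'] := h' _ he.
have h1 := hN (maxn N N') (leq_maxl _ _); have h2 := hN' (maxn N N') (leq_maxr _ _).
have : cn (l - l') <= cn (dsum (maxn N N') x - l') + cn (dsum (maxn N N') x - l).
  have {1}-> : l - l' = (dsum (maxn N N') x - l') - (dsum (maxn N N') x - l) by ring.
  exact: cnB.
lra.
Qed.

Lemma has_dsum_lin x y l l' (a : Cx) : has_dsum x l -> has_dsum y l' ->
  has_dsum (fun i j => x i j + a * y i j) (l + a * l').
Proof.
move=> hx hy e he.
have ha : 0 < cn a + 1 by have := cn_ge0 a; lra.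
have he2 : 0 < e / 2 by rewrite divr_gt0.
have he3 : 0 < e / 2 / (cn a + 1) by rewrite divr_gt0.
have [N hN] := hx _ he2; have [N' hN'] := hy _ he3.
exists (maxn N N') => n; rewrite geq_max => /andP [hn hn'].
have -> : dsum n (fun i j => x i j + a * y i j) = dsum n x + a * dsum n y.
  rewrite /dsum mulr_sumr -big_split; apply: eq_bigr => i _ /=.
  by rewrite mulr_sumr -big_split.
have -> : dsum n x + a * dsum n y - (l + a * l') = (dsum n x - l) + a * (dsum n y - l') by ring.
apply: le_trans (cnD _ _) _; rewrite cnM.
have h1 := hN n hn; have := hN' n hn'; rewrite ler_pdivlMr // => h2.
have := cn_ge0 (dsum n y - l'); lra.
Qed.

Lemma has_dsum_finite x n : (forall i j, ~~ ((i < n)%N && (j < n)%N) -> x i j = 0) ->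
  has_dsum x (dsum n x).
Proof.
move=> hx e he; exists n => m hm; rewrite (dsum_split x hm).
have -> : dsum m (outside n x) = 0.
  rewrite /dsum big1 // => i _; rewrite big1 // => j _; rewrite /outside.
  by case: ifP => // /negbT /hx.
by rewrite addr0 subrr cn0 ltW.
Qed.

Lemma eq_has_dsum x y l : (forall i j, x i j = y i j) -> has_dsum x l -> has_dsum y l.
Proof.
move=> h hx e he; have [N hN] := hx e he; exists N => n hn.
suff -> : dsum n y = dsum n x by apply: hN.
by rewrite /dsum; apply: eq_bigr => i _; apply: eq_bigr => j _; rewrite h.
Qed.

(** * Weighted l^1 norms of formal series *)

Definition bd (r : R) (U : ps2 R) (N : R) :=
  nonneg U /\ forall n, dsum n (tm U r r) <= N.

Lemma bd_le (r N N' : R) U : N <= N' -> bd r U N -> bd r U N'.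
Proof. by move=> h [h0 h1]; split=> // n; apply: le_trans h. Qed.

Lemma bd_ge0 (r N : R) U : bd r U N -> 0 <= N.
Proof. by case=> _ /(_ 0%N); rewrite /dsum big_ord0. Qed.

Lemma dsumD (V : nmodType) n (x y : nat -> nat -> V) :
  dsum n (fun i j => x i j + y i j) = dsum n x + dsum n y.
Proof. by rewrite /dsum -big_split; apply: eq_bigr => i _; rewrite -big_split. Qed.

Lemma dsumZ (K : pzRingType) n (a : K) (x : nat -> nat -> K) :
  dsum n (fun i j => a * x i j) = a * dsum n x.
Proof. by rewrite /dsum mulr_sumr; apply: eq_bigr => i _; rewrite mulr_sumr. Qed.

Lemma eq_dsum (V : nmodType) n (x y : nat -> nat -> V) :
  (forall i j, x i j = y i j) -> dsum n x = dsum n y.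
Proof. by move=> h; apply: eq_bigr => i _; apply: eq_bigr. Qed.

Lemma bd_lin (r N N' k : R) U V : 0 <= k -> bd r U N -> bd r V N' ->
  bd r (U + (fun i j => k * V i j) : ps2 R) (N + k * N').
Proof.
move=> hk [hU hU'] [hV hV']; split=> [i j|n]; first by rewrite !psD addr_ge0 // mulr_ge0.
rewrite (eq_dsum _ (y := fun i j => tm U r r i j + k * tm V r r i j)); last first.
  by move=> i j; rewrite /tm !psD; ring.
by rewrite dsumD dsumZ lerD // ler_wpM2l.
Qed.

Lemma bdM (r N N' : R) U V : 0 <= r -> bd r U N -> bd r V N' -> bd r (U * V) (N * N').
Proof.
move=> hr [hU hU'] [hV hV']; split; first exact: nonneg_mul.
move=> n; apply: le_trans (dsum_mul_ge _ hr hU hV) _.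
have h0 W : nonneg W -> 0 <= dsum n (tm W r r).
  by move=> hW; apply: sumr_ge0 => i _; apply: sumr_ge0 => j _; apply: nonneg_tm.
by apply: ler_pM; rewrite ?h0.
Qed.

Lemma bd1 (r : R) : 0 <= r -> bd r 1 1.
Proof.
move=> hr; split=> [[|i] [|j]|n] //; rewrite ?ps1 //.
case: n => [|n]; first by rewrite /dsum big_ord0.
rewrite /dsum big_ord_recl [X in _ + X]big1 ?addr0; last first.
  by move=> i _; rewrite big1 // => j _; rewrite /tm !ps1 /= mul0r.
rewrite big_ord_recl [X in _ + X]big1 ?addr0; last first.
  by move=> j _; rewrite /tm !ps1 /= mul0r.
by rewrite /tm !ps1 /= !mul1r.
Qed.

Lemma bdX (r N : R) U a : 0 <= r -> bd r U N -> bd r (U ^+ a) (N ^+ a).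
Proof.
move=> hr hU; elim: a => [|a IH]; first by rewrite !expr0; apply: bd1.
by rewrite !exprS; apply: bdM.
Qed.

(** Exchanging the sums leaves [c a b] times the norm of [U ^+ a * V ^+ b], which is at most
    [s ^+ a * s ^+ b]. *)
Lemma bd_comp (r s M N N' : R) c U V : 0 <= r -> bd s c M -> bd r U N -> bd r V N' ->
  N <= s -> N' <= s -> bd r (comp c U V) M.
Proof.
move=> hr [hc hc'] hU hV hN hN'.
have hUV a b : bd r (U ^+ a * V ^+ b) (N ^+ a * N' ^+ b) by apply: bdM => //; apply: bdX.
split=> [i j|n].
  rewrite /comp; apply: sumr_ge0 => a _; apply: sumr_ge0 => b _.
  by rewrite mulr_ge0 //; case: (hUV a b).
(* For [i] and [j] below [n] the degree [i + j] stays below [n + n]; the inner sums get this common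
   range so that they can be exchanged with the outer ones. *)
pose F i j := \sum_(a < n + n) \sum_(b < n + n)
   c a b * ((U ^+ a * V ^+ b) i j * (r ^+ i * r ^+ j)).
apply: (@le_trans _ _ (dsum n F)).
  apply: ler_dsum => // i j.
    move=> hi hj; rewrite /tm /F /comp mulr_suml.
    apply: (@ler_sum_sub _ _ (fun a => (\sum_(b < (i + j).+1) c a b * (U ^+ a * V ^+ b) i j) *
      (r ^+ i * r ^+ j)) (fun a => \sum_(b < n + n) c a b * ((U ^+ a * V ^+ b) i j * (r ^+ i * r ^+ j)))).
    - by lia.
    - move=> a ha; rewrite mulr_suml.
      apply: (@ler_sum_sub _ _ (fun b => c a b * (U ^+ a * V ^+ b) i j * (r ^+ i * r ^+ j))
       (fun b => c a b * ((U ^+ a * V ^+ b) i j * (r ^+ i * r ^+ j)))) => //.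
      + by lia.
      + by move=> b _; rewrite -mulrA.
      + by move=> b; rewrite !mulr_ge0 ?exprn_ge0 //; case: (hUV a b).
    - move=> a; apply: sumr_ge0 => b _.
      by rewrite !mulr_ge0 ?exprn_ge0 //; case: (hUV a b).
  rewrite /F; apply: sumr_ge0 => a _; apply: sumr_ge0 => b _.
  by rewrite !mulr_ge0 ?exprn_ge0 //; case: (hUV a b).
have -> : dsum n F = dsum (n + n) (fun a b => c a b * dsum n (tm (U ^+ a * V ^+ b) r r)).
  rewrite /dsum /F.
  under eq_bigr => i _ do rewrite exchange_big /=.
  rewrite exchange_big /=.
  under eq_bigr => b _ do (under eq_bigr => i _ do rewrite exchange_big /=).
  under eq_bigr => b _ do rewrite exchange_big /=.
  apply: eq_bigr => a _; apply: eq_bigr => b _.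
  by rewrite mulr_sumr; apply: eq_bigr => i _; rewrite mulr_sumr.
apply: le_trans (hc' (n + n)%N); apply: ler_dsum => // a b; last first.
  have hs : 0 <= s by apply: le_trans hN; apply: bd_ge0 hU.
  exact: nonneg_tm.
move=> _ _; rewrite /tm ler_wpM2l //.
apply: le_trans ((hUV a b).2 n) _.
have h0 := bd_ge0 hU; have h0' := bd_ge0 hV.
by apply: ler_pM; rewrite ?exprn_ge0 // lerXn2r // nnegrE (le_trans _ hN, le_trans _ hN').
Qed.

Definition dom (u : ps2 Cx) (U : ps2 R) := forall i j, cn (u i j) <= U i j.

Lemma domD u v U V : dom u U -> dom v V -> dom (u + v) (U + V).
Proof. by move=> hu hv i j; rewrite !psD (le_trans (cnD _ _)) // lerD. Qed.
Lemma domN u U : dom u U -> dom (- u) U.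
Proof. by move=> hu i j; rewrite !psN cnN. Qed.
Lemma domM u v U V : dom u U -> dom v V -> dom (u * v) (U * V).
Proof.
move=> hu hv i j; rewrite !ps2M (le_trans (cn_sum _ _ _)) //; apply: ler_sum => k _.
rewrite (le_trans (cn_sum _ _ _)) //; apply: ler_sum => l _.
by rewrite cnM ler_pM ?cn_ge0.
Qed.
Lemma dom1 : dom 1 1.
Proof. by move=> [|i] [|j]; rewrite !ps1 /= ?cn1 ?cn0. Qed.
Lemma domX u U a : dom u U -> dom (u ^+ a) (U ^+ a).
Proof.
move=> h; elim: a => [|a IH]; first by rewrite !expr0; apply: dom1.
by rewrite !exprS; apply: domM.
Qed.
Lemma dom_comp f p q c U V : dom f c -> dom p U -> dom q V ->
  dom (comp f p q) (comp c U V).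
Proof.
move=> hf hp hq i j; rewrite /comp.
rewrite (le_trans (cn_sum _ _ _)) //; apply: ler_sum => a _.
rewrite (le_trans (cn_sum _ _ _)) //; apply: ler_sum => b _.
by rewrite cnM ler_pM ?cn_ge0 //; apply: domM; apply: domX.
Qed.

Section UniformNorm.
Variable T : Type.
Implicit Types u v f p q : T -> ps2 Cx.

(* The Taylor norm of radius [r], with the supremum over [T], is at most [N]; a
   common majorant [U] replaces the suprema. *)
Definition nb (r : R) u (N : R) := exists2 U, bd r U N & forall t, dom (u t) U.

Lemma nb_le (r N N' : R) u : N <= N' -> nb r u N -> nb r u N'.
Proof. by move=> h [U hU hu]; exists U => //; apply: bd_le hU. Qed.
Lemma nb_ge0 (r N : R) u : nb r u N -> 0 <= N.
Proof. by case=> U /bd_ge0. Qed.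
Lemma nbD (r N N' : R) u v : nb r u N -> nb r v N' -> nb r (fun t => u t + v t) (N + N').
Proof.
move=> [U hU hu] [V hV hv]; exists (U + (fun i j => 1 * V i j) : ps2 R).
  by rewrite -(mul1r N'); apply: bd_lin.
by move=> t; apply: domD => // i j; rewrite mul1r; apply: hv.
Qed.
Lemma nbN (r N : R) u : nb r u N -> nb r (fun t => - u t) N.
Proof. by move=> [U hU hu]; exists U => // t; apply: domN. Qed.
Lemma nbB (r N N' : R) u v : nb r u N -> nb r v N' -> nb r (fun t => u t - v t) (N + N').
Proof. by move=> hu hv; apply: nbD => //; apply: nbN. Qed.
Lemma nbM (r N N' : R) u v : 0 <= r -> nb r u N -> nb r v N' ->
  nb r (fun t => u t * v t) (N * N').
Proof.
move=> hr [U hU hu] [V hV hv]; exists (U * V); first exact: bdM.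
by move=> t; apply: domM.
Qed.
Lemma nb_comp (r s M N N' : R) f p q : 0 <= r -> nb s f M -> nb r p N -> nb r q N' ->
  N <= s -> N' <= s -> nb r (fun t => comp (f t) (p t) (q t)) M.
Proof.
move=> hr [c hc hf] [U hU hu] [V hV hv] h h'; exists (comp c U V).
  exact: bd_comp hU hV h h'.
by move=> t; apply: dom_comp.
Qed.

(** Suprema over time are taken before the sum, so an operator bounded on each coefficient, however
    nonlocal in time, is bounded in this norm. The solution operators of the linear equations in
    time are estimated this way. *)
Lemma nb_coef (r N k : R) u v : 0 <= k ->
  (forall i j G, (forall t, cn (u t i j) <= G) -> forall t, cn (v t i j) <= k * G) ->
  nb r u N -> nb r v (k * N).
Proof.
move=> hk huv [U hU hu]; exists (fun i j => k * U i j); last first.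
  by move=> t i j; apply: huv => s; apply: hu.
split=> [i j|n]; first by rewrite mulr_ge0 //; case: hU.
rewrite (eq_dsum _ (y := fun i j => k * tm U r r i j)) => [|i j]; last by rewrite /tm; ring.
by rewrite dsumZ ler_wpM2l //; case: hU.
Qed.

Lemma nb_mask (r N : R) (m : nat -> nat -> bool) u : nb r u N ->
  nb r (fun t i j => if m i j then u t i j else 0) N.
Proof.
rewrite -{2}[N]mul1r; apply: nb_coef => // i j G h t; rewrite mul1r.
by case: ifP => // _; rewrite cn0 (le_trans _ (h t)) ?cn_ge0.
Qed.

Lemma nb_shiftQ (r N : R) u : 0 < r -> nb r u N -> nb r (fun t i j => u t i j.+1) (N / r).
Proof.
move=> hr [U [hU hU'] hu]; exists (fun i j => U i j.+1); last by move=> t i j; apply: hu.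
split=> [i j|n]; first exact: hU.
rewrite ler_pdivlMr // mulrC -dsumZ; apply: le_trans (hU' n.+1).
apply: (ler_sum_sub (F := fun i => \sum_(j < n) (r * tm (fun i j => U i j.+1) r r i j))
  (G := fun i => \sum_(j < n.+1) tm U r r i j)) => //.
  move=> i _; rewrite big_ord_recl -[leLHS]add0r lerD //.
    by apply: nonneg_tm => //; apply: ltW.
  apply: ler_sum => j _; rewrite /tm lift0 [r ^+ j.+1]exprS le_eqVlt; apply/orP; left.
  by apply/eqP; ring.
by move=> i; apply: sumr_ge0 => j _; apply: nonneg_tm => //; apply: ltW.
Qed.

(** Shrinking the radius from [s] to [r] gains a factor [r / s] for each degree that is absent.
    Orders 2, 1 and 0 serve the choice of the radius, the size of the image and mere restriction. *)
Lemma nb_ord_ge (m : nat) (r s N : R) u : 0 <= r -> r <= s -> 0 < s ->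
  (forall t, ord_ge m (u t)) -> nb s u N -> nb r u ((r / s) ^+ m * N).
Proof.
move=> hr hrs hs hm [U [hU hU'] hu].
exists (fun i j => if (i + j < m)%N then 0 else U i j); last first.
  by move=> t i j; case: ifP => h; [rewrite hm ?cn0 | apply: hu].
split=> [i j|n]; first by case: ifP.
have h0 : 0 <= r / s by rewrite divr_ge0 // ltW.
apply: (@le_trans _ _ ((r / s) ^+ m * dsum n (tm U s s))); last by rewrite ler_wpM2l ?exprn_ge0.
rewrite -dsumZ; apply: ler_dsum => // i j; last first.
  by rewrite mulr_ge0 ?exprn_ge0 //; apply: nonneg_tm => //; apply: ltW.
move=> _ _; rewrite /tm; case: ifP => h.
  by rewrite mul0r mulr_ge0 ?exprn_ge0 // mulr_ge0 // mulr_ge0 ?exprn_ge0 // ltW.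
have e1 : r ^+ i * r ^+ j = (r / s) ^+ (i + j) * (s ^+ i * s ^+ j).
  by rewrite -!exprD -exprMn divfK // gt_eqF.
rewrite [leRHS]mulrCA ler_wpM2l // e1 ler_wpM2r ?mulr_ge0 ?exprn_ge0 ?(ltW hs) //.
by apply: ler_wiXn2l => //; [rewrite ler_pdivrMr ?mul1r | lia].
Qed.

(** This is Cauchy's estimate on one monomial: [s ^+ i.+1 - r ^+ i.+1] is [s - r] times a sum of
    [i.+1] terms, each at least [r ^+ i]. *)
Lemma powS_bound (r s : R) i : 0 <= r -> r < s -> i.+1%:R * r ^+ i * (s - r) <= s ^+ i.+1.
Proof.
move=> hr hs; have hs0 : 0 <= s by lra.
rewrite [i.+1%:R * _]mulrC -mulrA [i.+1%:R * _]mulrC.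
have -> : r ^+ i * ((s - r) * i.+1%:R) = (s - r) * (\sum_(k < i.+1) r ^+ i).
  by rewrite sumr_const card_ord -mulr_natr; ring.
apply: (@le_trans _ _ (s ^+ i.+1 - r ^+ i.+1)); last by have := exprn_ge0 i.+1 hr; lra.
rewrite subrXX ler_wpM2l; [|lra|]; first by lra.
apply: ler_sum => k _; have hk := ltn_ord k.
have {1}-> : r ^+ i = r ^+ (i.+1 - k.+1) * r ^+ k by rewrite -exprD; congr (_ ^+ _); lia.
by apply: ler_wpM2r; rewrite ?exprn_ge0 // lerXn2r // ?nnegrE // ltW.
Qed.

Lemma nb_dP (r s N : R) u : 0 <= r -> r < s -> nb s u N ->
  nb r (fun t => dP (u t)) (N / (s - r)).
Proof.
move=> hr hs [U [hU hU'] hu]; exists (dP U); last first.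
  by move=> t i j; rewrite !dPE cnMn lerMn2r hu orbT.
split=> [i j|n]; first by rewrite dPE mulrn_wge0.
have hs0 : 0 <= s by lra.
have hsr : 0 < s - r by lra.
rewrite ler_pdivlMr // mulrC -dsumZ; apply: le_trans (hU' n.+1).
rewrite /dsum [leRHS]big_ord_recl -[leLHS]add0r lerD //.
  by apply: sumr_ge0 => j _; apply: nonneg_tm.
apply: ler_sum => i _; rewrite lift0.
apply: (@ler_sum_sub _ _ (fun j => (s - r) * tm (dP U) r r i j) (fun j => tm U s s i.+1 j)) => //.
- move=> j _; rewrite /tm dPE -mulr_natr.
  have -> : (s - r) * (U i.+1 j * i.+1%:R * (r ^+ i * r ^+ j)) =
    U i.+1 j * ((i.+1%:R * r ^+ i * (s - r)) * r ^+ j) by ring.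
  rewrite ler_wpM2l //; apply: ler_pM; rewrite ?exprn_ge0 ?powS_bound //.
    by rewrite !mulr_ge0 ?exprn_ge0 // ltW.
  by rewrite lerXn2r // ?nnegrE // ltW.
- by move=> j; apply: nonneg_tm.
Qed.

Lemma nb_dQ (r s N : R) u : 0 <= r -> r < s -> nb s u N ->
  nb r (fun t => dQ (u t)) (N / (s - r)).
Proof.
move=> hr hs [U [hU hU'] hu]; exists (dQ U); last first.
  by move=> t i j; rewrite !dQE cnMn lerMn2r hu orbT.
split=> [i j|n]; first by rewrite dQE mulrn_wge0.
have hs0 : 0 <= s by lra.
have hsr : 0 < s - r by lra.
rewrite ler_pdivlMr // mulrC -dsumZ; apply: le_trans (hU' n.+1).
apply: (ler_sum_sub (F := fun i => \sum_(j < n) ((s - r) * tm (dQ U) r r i j))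
  (G := fun i => \sum_(j < n.+1) tm U s s i j)) => //; last first.
  by move=> i; apply: sumr_ge0 => j _; apply: nonneg_tm.
move=> i _; rewrite big_ord_recl -[leLHS]add0r lerD //; first exact: nonneg_tm.
apply: ler_sum => j _; rewrite lift0 /tm dQE -mulr_natr.
have -> : (s - r) * (U i j.+1 * j.+1%:R * (r ^+ i * r ^+ j)) =
    U i j.+1 * (r ^+ i * (j.+1%:R * r ^+ j * (s - r))) by ring.
rewrite ler_wpM2l //; apply: ler_pM; rewrite ?exprn_ge0 ?powS_bound //.
  by rewrite !mulr_ge0 ?exprn_ge0 // ltW.
by rewrite lerXn2r // ?nnegrE // ltW.
Qed.

End UniformNorm.

(** * Evaluation of formal series *)

(* Junk value 0 where the series does not converge. *)
Definition ev (u : ps2 Cx) (x y : Cx) : Cx :=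
  match pselect (exists l, has_dsum (tm u x y) l) with
  | left h => projT1 (cid h)
  | right _ => 0
  end.

(** A single series is seen as a family over [unit], so that the norm lemmas for families apply to
    it. *)
Definition ab (r : R) (u : ps2 Cx) (N : R) := nb r (fun _ : unit => u) N.

Lemma nb_at (T : Type) (r N : R) (u : T -> ps2 Cx) t : nb r u N -> ab r (u t) N.
Proof. by move=> [U hU hu]; exists U. Qed.

Lemma nbX (T : Type) (r N : R) (u : T -> ps2 Cx) a : 0 <= r ->
  nb r u N -> nb r (fun t => u t ^+ a) (N ^+ a).
Proof.
move=> hr [U hU hu]; exists (U ^+ a); first exact: bdX.
by move=> t; apply: domX.
Qed.

Lemma dom_tm (r : R) u U x y : dom u U -> cn x <= r -> cn y <= r ->
  forall i j, cn (tm u x y i j) <= tm U r r i j.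
Proof.
move=> hu hx hy i j; rewrite /tm !cnM !cnX.
have hr : 0 <= r by apply: le_trans hx; apply: cn_ge0.
have hX z k : 0 <= cn z ^+ k by apply/exprn_ge0/cn_ge0.
apply: ler_pM; [exact: cn_ge0 | by rewrite mulr_ge0 | exact: hu |].
by apply: ler_pM; rewrite ?hX // lerXn2r ?nnegrE ?cn_ge0.
Qed.

Lemma has_dsum_ev u x y l : has_dsum (tm u x y) l -> ev u x y = l.
Proof.
move=> h; rewrite /ev; case: pselect => [h'|]; last by case; exists l.
by apply: has_dsum_unique h; case: cid.
Qed.

Section Evaluation.
Variables (r : R) (x y : Cx).
Hypotheses (hx : cn x <= r) (hy : cn y <= r).

Let hr : 0 <= r. Proof. by apply: le_trans hx; apply: cn_ge0. Qed.

Lemma ev_has_dsum (N : R) u : ab r u N -> has_dsum (tm u x y) (ev u x y).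
Proof.
move=> [U [hU hU'] /(_ tt) hu].
have [l hl] := has_dsum_ex (nonneg_tm hr hU) hU' (dom_tm hu hx hy).
by rewrite (has_dsum_ev hl).
Qed.

Lemma ev_le (N : R) u : ab r u N -> cn (ev u x y) <= N.
Proof.
move=> h; have hl := ev_has_dsum h.
case: h => U [hU hU'] /(_ tt) hu.
exact: (has_dsum_le hU' (dom_tm hu hx hy)).
Qed.

Lemma ev_lin (N N' : R) (a : Cx) u v : ab r u N -> ab r v N' ->
  ev (u + cst a * v) x y = ev u x y + a * ev v x y.
Proof.
move=> hu hv; apply: has_dsum_ev.
apply: (@eq_has_dsum (fun i j => tm u x y i j + a * tm v x y i j)).
  by move=> i j; rewrite /tm !psD cstM; ring.
by apply: has_dsum_lin; [apply: ev_has_dsum hu | apply: ev_has_dsum hv].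
Qed.

Lemma cst1 (K : comNzRingType) : cst 1 = 1 :> ps2 K.
Proof. by apply/ps2P => i j; rewrite -[cst 1]mulr1 cstM mul1r. Qed.
Lemma cstN1 (K : comNzRingType) : cst (-1) = -1 :> ps2 K.
Proof. by apply/ps2P => i j; rewrite -[cst _]mulr1 cstM mulN1r. Qed.

Lemma ev0 : ev 0 x y = 0.
Proof.
apply: has_dsum_ev => e he; exists 0%N => n _.
rewrite /dsum big1 => [|i _]; first by rewrite subrr cn0 ltW.
by rewrite big1 // => j _; rewrite /tm !ps0 mul0r.
Qed.

Lemma ab0 : ab r 0 0.
Proof.
exists 0 => [|t i j]; last by rewrite !ps0 cn0.
split=> // n; rewrite /dsum big1 // => i _.
by rewrite big1 // => j _; rewrite /tm !ps0 mul0r.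
Qed.

Lemma evD (N N' : R) u v : ab r u N -> ab r v N' -> ev (u + v) x y = ev u x y + ev v x y.
Proof.
move=> hu hv; have := ev_lin 1 hu hv; by rewrite cst1 !mul1r.
Qed.
Lemma evN (N : R) u : ab r u N -> ev (- u) x y = - ev u x y.
Proof.
by move=> hu; have := ev_lin (-1) ab0 hu; rewrite cstN1 ev0 !add0r !mulN1r.
Qed.
Lemma evB (N N' : R) u v : ab r u N -> ab r v N' -> ev (u - v) x y = ev u x y - ev v x y.
Proof. by move=> hu hv; rewrite (evD hu (nbN hv)) (evN hv). Qed.
Lemma evZ (N : R) a u : ab r u N -> ev (cst a * u) x y = a * ev u x y.
Proof. by move=> hu; have := ev_lin a ab0 hu; rewrite ev0 !add0r. Qed.

Lemma ev_finite u n : (forall i j, ~~ ((i < n)%N && (j < n)%N) -> u i j = 0) ->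
  ev u x y = dsum n (tm u x y).
Proof.
move=> h; apply: has_dsum_ev; apply: has_dsum_finite => i j /h hij.
by rewrite /tm hij mul0r.
Qed.

Lemma ev1 : ev 1 x y = 1.
Proof.
rewrite (@ev_finite _ 1) => [|[|i] [|j]] //.
by rewrite /dsum !big_ord_recl !big_ord0 /tm (_ : (1 : ps2 Cx) 0%N 0%N = 1) //=; ring.
Qed.

Lemma evM (N N' : R) u v : ab r u N -> ab r v N' -> ev (u * v) x y = ev u x y * ev v x y.
Proof.
move=> hu hv; have lu := ev_has_dsum hu; have lv := ev_has_dsum hv.
have luv := ev_has_dsum (nbM hr hu hv).
case: hu => U bU /(_ tt) du; case: hv => V bV /(_ tt) dv.
have [hU hU'] := bU; have [hV hV'] := bV; have [hUV hUV'] := bdM hr bU bV.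
have tU := nonneg_tm hr hU; have tV := nonneg_tm hr hV; have tUV := nonneg_tm hr hUV.
set L := ev u x y; set L' := ev v x y; set L'' := ev (u * v) x y.
(* The terms of the full product absent from the square sum of [u * v] are dominated by those of the
   majorants, which are enclosed between the square sums of [U * V] at [n] and at [n + n]. *)
have key n : cn (dsum n (tm u x y) * dsum n (tm v x y) - dsum n (tm (u * v) x y)) <=
    dsum (n + n) (tm (U * V) r r) - dsum n (tm (U * V) r r).
  apply: (@le_trans _ _ (dsum n (tm U r r) * dsum n (tm V r r) - dsum n (tm (U * V) r r)));
    last by rewrite lerD2r dsum_mul_le.
  rewrite !dsum_mul_full !dsum_mul_cond.
  rewrite (bigID (fun t : ('I_n * 'I_n) * ('I_n * 'I_n) =>
     (t.1.1 + t.1.2 < n)%N && (t.2.1 + t.2.2 < n)%N)) /=.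
  rewrite [X in _ <= X - _](bigID (fun t : ('I_n * 'I_n) * ('I_n * 'I_n) =>
     (t.1.1 + t.1.2 < n)%N && (t.2.1 + t.2.2 < n)%N)) /=.
  rewrite ![_ + _ - _]addrAC !subrr !add0r (le_trans (cn_sum _ _ _)) //.
  by apply: ler_sum => t _; rewrite cnM; apply: ler_pM; rewrite ?cn_ge0 ?dom_tm.
apply/eqP; rewrite -subr_eq0; apply/eqP/cn_eq0/eqP.
rewrite eq_le cn_ge0 andbT leNgt; apply/negP => hc.
set d := cn (L'' - L * L') in hc.
have hLp : 0 < cn L + N' + 1 by have := cn_ge0 L; have := bd_ge0 bV; lra.
have hd : 0 < d / 8 by rewrite divr_gt0.
have hd' : 0 < d / 8 / (cn L + N' + 1) by rewrite divr_gt0.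
have [n1 h1] := lu _ hd'; have [n2 h2] := lv _ hd'; have [n3 h3] := luv _ hd.
have [n4 h4] := dsum_cauchy tUV hUV' hd.
have [n [m1 m2 m3 m4]] : exists n, [/\ n1 <= n, n2 <= n, n3 <= n & n4 <= n]%N.
  by clear; exists (n1 + n2 + n3 + n4)%N; split; lia.
have {}h1 := h1 n m1; have {}h2 := h2 n m2; have {}h3 := h3 n m3.
have {}h4 := h4 n (n + n)%N m4; have h5 := key n.
move: h1 h2; rewrite !ler_pdivlMr // => h1 h2.
have hS : cn (dsum n (tm v x y)) <= N'.
  apply: le_trans (hV' n); rewrite (le_trans (cn_sum _ _ _)) //.
  apply: ler_sum => i _; rewrite (le_trans (cn_sum _ _ _)) //.
  by apply: ler_sum => j _; apply: dom_tm.
have : d <= cn (dsum n (tm (u * v) x y) - L'') +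
   (cn (dsum n (tm u x y) * dsum n (tm v x y) - dsum n (tm (u * v) x y)) +
   (cn ((dsum n (tm u x y) - L) * dsum n (tm v x y)) + cn (L * (dsum n (tm v x y) - L')))).
  rewrite /d -[cn (L'' - _)]cnN.
  have -> : - (L'' - L * L') = (dsum n (tm (u * v) x y) - L'') +
   ((dsum n (tm u x y) * dsum n (tm v x y) - dsum n (tm (u * v) x y)) -
   ((dsum n (tm u x y) - L) * dsum n (tm v x y) + L * (dsum n (tm v x y) - L'))) by ring.
  by rewrite (le_trans (cnD _ _)) // lerD2l (le_trans (cnB _ _)) // lerD2l cnD.
rewrite !cnM.
have := cn_ge0 L; have := cn_ge0 (dsum n (tm u x y) - L).
have := cn_ge0 (dsum n (tm v x y) - L'); have := bd_ge0 bV.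
move: h1 h2 h3 h4 h5 hS.
set A := cn (dsum n (tm u x y) - L); set B := cn (dsum n (tm v x y) - L').
set S := cn (dsum n (tm v x y)).
move=> h1 h2 h3 h4 h5 hS hN' hB hA hL hfin.
have : A * S <= A * N' by rewrite ler_wpM2l.
have : 0 <= A * cn L by rewrite mulr_ge0.
have : 0 <= B * N' by rewrite mulr_ge0.
rewrite !mulrDr !mulr1 in h1 h2.
move: h1 h2 h3 h4 h5 hfin hA hB hc hd; clear; lra.
Qed.

Lemma evX (N : R) u a : ab r u N -> ev (u ^+ a) x y = ev u x y ^+ a.
Proof.
move=> hu; have hX b : ab r (u ^+ b) (N ^+ b) by apply: nbX.
elim: a => [|a IH]; first by rewrite !expr0 ev1.
by rewrite !exprS (evM hu (hX a)) IH.
Qed.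

Lemma ev_sum (I : Type) (s : seq I) (F : I -> ps2 Cx) :
  (forall i, exists N, ab r (F i) N) ->
  (exists N, ab r (\sum_(i <- s) F i) N) /\
  ev (\sum_(i <- s) F i) x y = \sum_(i <- s) ev (F i) x y.
Proof.
move=> hF; elim: s => [|i s [[N hN] IH]].
  by rewrite !big_nil ev0; split=> //; exists 0; apply: ab0.
rewrite !big_cons; have [N' hN'] := hF i; split; last by rewrite (evD hN' hN) IH.
by exists (N' + N); apply: nbD.
Qed.

(** Evaluation respects the finitely many terms of [f] with both exponents below [n]. The rest of
    [f] has small norm, and [nb_comp] keeps it small after substitution. *)
Lemma ev_comp (s M N N' : R) f p q : ab s f M -> ab r p N -> ab r q N' ->
  N <= s -> N' <= s -> ord_ge 1 p -> ord_ge 1 q ->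
  ev (comp f p q) x y = ev f (ev p x y) (ev q x y).
Proof.
move=> hf hp hq hN hN' op oq.
have hs : 0 <= s by apply: le_trans hN; apply: nb_ge0 hp.
have hps : cn (ev p x y) <= s by apply: le_trans hN; apply: ev_le.
have hqs : cn (ev q x y) <= s by apply: le_trans hN'; apply: ev_le.
have [c bc /(_ tt) dc] := hf; have [hc hc'] := bc.
have tc := nonneg_tm hs hc.
have hX u a N0 : ab r u N0 -> ab r (u ^+ a) (N0 ^+ a) by apply: nbX.
have hcst (a : Cx) N0 u : ab r u N0 -> exists N1, ab r (cst a * u) N1.
  move=> hu; exists (cn a * N0); apply: nb_coef hu; first exact: cn_ge0.
  by move=> i j G h t; rewrite cstM cnM ler_wpM2l ?cn_ge0 //; apply: (h tt).
set L := ev f _ _; set l := ev (comp f p q) x y.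
have lf : has_dsum (tm f (ev p x y) (ev q x y)) L.
  have [l' hl'] := has_dsum_ex tc hc' (dom_tm dc hps hqs).
  by rewrite /L (has_dsum_ev hl').
apply/eqP; rewrite -subr_eq0; apply/eqP/cn_eq0/eqP.
rewrite eq_le cn_ge0 andbT leNgt; apply/negP => hcl.
set d := cn (l - L) in hcl.
have hd : 0 < d / 4 by rewrite divr_gt0.
have [n1 h1] := has_dsum_tail tc hc' hd.
have [n2 h2] := dsum_cauchy tc hc' hd.
have {}h1 := h1 (n1 + n2)%N _ _ (leq_addr _ _) (dom_tm dc hps hqs) lf.
have {}h2 m := h2 (n1 + n2)%N m (leq_addl _ _).
set n := (n1 + n2)%N in h1 h2.
have [[N1 hN1] e1] : (exists N1, ab r (comp_fin n n f p q) N1) /\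
   ev (comp_fin n n f p q) x y = dsum n (tm f (ev p x y) (ev q x y)).
  have hmon a b : exists N1, ab r (p ^+ a * q ^+ b) N1.
    by exists (N ^+ a * N' ^+ b); apply: nbM => //; apply: hX.
  have hin' (a : 'I_n) := @ev_sum _ (index_enum 'I_n) (fun b : 'I_n => cst (f a b) * (p ^+ a * q ^+ b))
    (fun b => let: ex_intro N1 h := hmon a b in hcst (f a b) N1 _ h).
  have [h e] := @ev_sum _ (index_enum 'I_n) (fun a : 'I_n =>
     \sum_(b < n) cst (f a b) * (p ^+ a * q ^+ b)) (fun a => (hin' a).1).
  split; first exact: h.
  rewrite /comp_fin e /dsum; apply: eq_bigr => a _; rewrite (hin' a).2.
  apply: eq_bigr => b _; have [N2 hN2] := hmon a b; rewrite (evZ _ hN2).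
  by rewrite /tm (evM (hX _ a _ hp) (hX _ b _ hq)) (evX _ hp) (evX _ hq).
pose f' : ps2 Cx := outside n f.
have e2 : comp f p q = comp f' p q + comp_fin n n f p q.
  apply/ps2P => i j; pose m := (n + (i + j).+1)%N.
  have hm : (i + j < m)%N by rewrite /m addnS ltnS leq_addl.
  rewrite !psD (comp_truncE _ _ _ hm hm) // (comp_truncE _ _ _ hm hm) //.
  rewrite !comp_fin_coef addrC.
  have hnm : (n <= m)%N by rewrite /m leq_addr.
  have := dsum_split (fun a b => f a b * (p ^+ a * q ^+ b) i j) hnm.
  rewrite /dsum => ->; congr (_ + _).
  apply: eq_bigr => a _; apply: eq_bigr => b _; rewrite /f' /outside.
  by case: ifP; rewrite ?mul0r.
have hf' : ab s f' (d / 4).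
  exists (outside n c : ps2 R); last by move=> t a b; rewrite /f' /outside; case: ifP; rewrite ?cn0.
  split=> [a b|m]; first by rewrite /outside; case: ifP.
  apply: (@le_trans _ _ (dsum (n + m) (outside n (tm c s s)))).
    apply: ler_dsum; rewrite ?leq_addl // => a b.
      by move=> _ _; rewrite /tm /outside; case: ifP; rewrite ?mul0r.
    by rewrite /outside; case: ifP.
  rewrite -(lerD2l (dsum n (tm c s s))) -dsum_split ?leq_addr //; exact: (h2 (n + m)%N).
have hcf' : ab r (comp f' p q) (d / 4) by exact: (nb_comp hr hf' hp hq hN hN').
have h3 := ev_le hcf'.
have e3 : l = ev (comp f' p q) x y + dsum n (tm f (ev p x y) (ev q x y)).
  by rewrite /l e2 (evD hcf' hN1) e1.
have : d <= cn (ev (comp f' p q) x y) + cn (L - dsum n (tm f (ev p x y) (ev q x y))).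
  rewrite /d e3.
  have -> : ev (comp f' p q) x y + dsum n (tm f (ev p x y) (ev q x y)) - L =
    ev (comp f' p q) x y - (L - dsum n (tm f (ev p x y) (ev q x y))) by ring.
  exact: cnB.
lra.
Qed.

End Evaluation.

(** * Differentiability of evaluated series *)

Section PowerIncrement.
Variables (z h : Cx) (r sg s : R).
Hypotheses (hs : 0 <= s) (hs1 : s <= 1) (hsg : 0 < sg) (hh : cn h <= s * sg)
  (hz : cn z + sg <= r).

Lemma incr_le : cn z <= r.
Proof. by have := hz; have := hsg; lra. Qed.
Lemma incrD_le : cn (z + h) <= r.
Proof.
apply: le_trans (cnD _ _) _.
have : s * sg <= sg by rewrite ler_piMl // ltW.
by have := hz; have := hh; lra.
Qed.
Let hr : 0 <= r. Proof. exact: le_trans (cn_ge0 _) incr_le. Qed.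

Lemma cn_pow_incr w i : cn w <= r -> cn (w ^+ i) <= r ^+ i.
Proof. by move=> h0; rewrite cnX lerXn2r ?nnegrE ?cn_ge0. Qed.

Lemma cn_pow_incrB i : cn ((z + h) ^+ i - z ^+ i) <= s * r ^+ i.
Proof.
elim: i => [|i IH]; first by rewrite !expr0 subrr cn0 mulr1.
have -> : (z + h) ^+ i.+1 - z ^+ i.+1 = z * ((z + h) ^+ i - z ^+ i) + h * (z + h) ^+ i.
  by rewrite !exprS; ring.
apply: le_trans (cnD _ _) _; rewrite !cnM exprS.
have h1 := cn_pow_incr i incrD_le.
have : cn z * cn ((z + h) ^+ i - z ^+ i) <= cn z * (s * r ^+ i) by rewrite ler_wpM2l ?cn_ge0.
have : cn h * cn ((z + h) ^+ i) <= s * sg * r ^+ i by apply: ler_pM; rewrite ?cn_ge0.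
have : s * r ^+ i * (cn z + sg) <= s * r ^+ i * r by rewrite ler_wpM2l // mulr_ge0 ?exprn_ge0.
lra.
Qed.

Lemma cn_pow_incr1 i : cn (z ^+ i.-1 *+ i * h) <= s * r ^+ i.
Proof.
case: i => [|i] /=; first by rewrite mulr0n mul0r cn0 mulr_ge0.
rewrite cnM cnMn cnX.
have h1 : cn z < r by have := hz; have := hsg; lra.
have h2 := powS_bound i (cn_ge0 z) h1.
apply: (@le_trans _ _ (cn z ^+ i *+ i.+1 * (s * (r - cn z)))).
  rewrite ler_wpM2l ?mulrn_wge0 ?exprn_ge0 ?cn_ge0 //.
  apply: le_trans hh _; rewrite ler_wpM2l //; have := hz; lra.
rewrite -mulr_natr mulrCA ler_wpM2l //; apply: le_trans h2.
by rewrite [_ * i.+1%:R]mulrC.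
Qed.

(** With the increment measured by [s], the remainder is bounded against [r ^+ i] by a constant free
    of [i], so it can be summed against a norm of radius [r]. The induction closes because
    [cn z + sg <= r]. *)
Lemma cn_pow_incr2 i : cn ((z + h) ^+ i - z ^+ i - z ^+ i.-1 *+ i * h) <= s ^+ 2 * r ^+ i.
Proof.
elim: i => [|i IH].
  by rewrite !expr0 subrr mulr0n mul0r subrr cn0 mulr1 exprn_ge0.
have -> : (z + h) ^+ i.+1 - z ^+ i.+1 - z ^+ i *+ i.+1 * h =
    z * ((z + h) ^+ i - z ^+ i - z ^+ i.-1 *+ i * h) + h * ((z + h) ^+ i - z ^+ i).
  have -> : z ^+ i *+ i.+1 = z ^+ i + z * (z ^+ i.-1 *+ i).
    by rewrite mulrS mulrnAr; case: i {IH} => [|i] //=; rewrite -exprS.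
  by rewrite !exprS; ring.
apply: le_trans (cnD _ _) _; rewrite !cnM [r ^+ i.+1]exprS expr2.
have h1 := cn_pow_incrB i.
have : cn z * cn ((z + h) ^+ i - z ^+ i - z ^+ i.-1 *+ i * h) <= cn z * (s ^+ 2 * r ^+ i).
  by rewrite ler_wpM2l ?cn_ge0.
have : cn h * cn ((z + h) ^+ i - z ^+ i) <= s * sg * (s * r ^+ i).
  by apply: ler_pM; rewrite ?cn_ge0.
have : s * s * r ^+ i * (cn z + sg) <= s * s * r ^+ i * r.
  by rewrite ler_wpM2l // !mulr_ge0 ?exprn_ge0.
rewrite expr2; lra.
Qed.

End PowerIncrement.

Section ShiftedSums.
Variables (W : nat -> nat -> R) (M : R).
Hypotheses (W0 : nonneg W) (WM : forall n, dsum n W <= M).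
Variable x : nat -> nat -> Cx.
Hypothesis xW : forall i j, cn (x i j) <= W i j.

Lemma dsum_edge n : \sum_(i < n) W i n <= dsum n.+1 W - dsum n W.
Proof.
rewrite lerBrDr /dsum addrC -big_split /= big_ord_recr /= -[leLHS]addr0 lerD //.
  by apply: ler_sum => i _; rewrite big_ord_recr.
exact: sumr_ge0.
Qed.

(** The shift turns the square of indices into a rectangle; the extra column tends to zero, being
    dominated by an increment of the bounded sums of [W]. *)
Lemma has_dsum_shiftl l : has_dsum x l ->
  has_dsum (fun i j => if i is k.+1 then x k j else 0) l.
Proof.
move=> hx e he; have he2 : 0 < e / 2 by rewrite divr_gt0.
have [n1 h1] := hx _ he2; have [n2 h2] := dsum_cauchy W0 WM he2.
exists (maxn n1 n2).+1 => -[//|n]; rewrite ltnS geq_max => /andP [hn1 hn2].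
have -> : dsum n.+1 (fun i j => if i is k.+1 then x k j else 0) = dsum n x + \sum_(i < n) x i n.
  rewrite /dsum big_ord_recl big1 // add0r -big_split /=; apply: eq_bigr => i _.
  by rewrite ?lift0 /= big_ord_recr.
have -> : dsum n x + \sum_(i < n) x i n - l = (dsum n x - l) + \sum_(i < n) x i n by ring.
apply: le_trans (cnD _ _) _; have := h1 n hn1; have := h2 n n.+1 hn2; have := dsum_edge n.
suff : cn (\sum_(i < n) x i n) <= \sum_(i < n) W i n by lra.
by rewrite (le_trans (cn_sum _ _ _)) //; apply: ler_sum.
Qed.

End ShiftedSums.

Lemma dsum_transpose (V : nmodType) n (x : nat -> nat -> V) :
  dsum n (fun i j => x j i) = dsum n x.
Proof. by rewrite /dsum exchange_big. Qed.

Lemma has_dsum_transpose x l : has_dsum x l -> has_dsum (fun i j => x j i) l.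
Proof.
by move=> h e he; have [N hN] := h e he; exists N => n hn; rewrite dsum_transpose hN.
Qed.

Lemma has_dsum_shiftr (W : nat -> nat -> R) (M : R) x l : nonneg W ->
  (forall n, dsum n W <= M) -> (forall i j, cn (x i j) <= W i j) -> has_dsum x l ->
  has_dsum (fun i j => if j is k.+1 then x i k else 0) l.
Proof.
move=> W0 WM xW hx.
apply: (has_dsum_transpose (x := fun i j => if i is k.+1 then x j k else 0)).
apply: (@has_dsum_shiftl (fun i j => W j i) M _ _ (fun i j => x j i)) => //.
  by move=> n; rewrite dsum_transpose.
exact: has_dsum_transpose.
Qed.

Lemma tm_dP (K : comNzRingType) (u : ps2 K) x y i j :
  tm (dP u) x y i j = u i.+1 j * (x ^+ i *+ i.+1) * y ^+ j.
Proof. by rewrite /tm dPE !(mulrnAl, mulrnAr); congr (_ *+ _); ring. Qed.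
Lemma tm_dQ (K : comNzRingType) (u : ps2 K) x y i j :
  tm (dQ u) x y i j = u i j.+1 * x ^+ i * (y ^+ j *+ j.+1).
Proof. by rewrite /tm dQE !(mulrnAl, mulrnAr); congr (_ *+ _); ring. Qed.

Lemma ev_expand (r sg s N : R) u x y h k : ab r u N ->
  0 <= s -> s <= 1 -> 0 < sg -> cn x + sg <= r -> cn y + sg <= r ->
  cn h <= s * sg -> cn k <= s * sg ->
  cn (ev u (x + h) (y + k) - (ev u x y + (ev (dP u) x y * h + ev (dQ u) x y * k)))
    <= 3 * s ^+ 2 * N.
Proof.
move=> hu hs hs1 hsg hx hy hh hk.
have xr := incr_le hsg hx; have yr := incr_le hsg hy.
have hr : 0 <= r by apply: le_trans xr; apply: cn_ge0.
have xhr := incrD_le hs1 hsg hh hx; have ykr := incrD_le hs1 hsg hk hy.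
have l1 := ev_has_dsum xhr ykr hu; have l2 := ev_has_dsum xr yr hu.
have hr' : 0 <= r - sg by have := cn_ge0 x; lra.
have hrr : r - sg < r by lra.
have xr' : cn x <= r - sg by lra.
have yr' : cn y <= r - sg by lra.
(* The derivative is reindexed so that its terms stand at the exponents of [u], and the remainder is
   estimated monomial by monomial. The truncated [i.-1] at [i = 0] is harmless thanks to the
   multiple [i]. *)
have l3 : has_dsum (fun i j => u i j * (x ^+ i.-1 *+ i) * y ^+ j) (ev (dP u) x y).
  have hd := nb_dP hr' hrr hu; have lP := ev_has_dsum xr' yr' hd.
  case: hd => V [hV hV'] /(_ tt) dV.
  have := has_dsum_shiftl (nonneg_tm hr' hV) hV' (dom_tm dV xr' yr') lP.
  apply: eq_has_dsum => -[|i] j; first by rewrite mulr0n mulr0 mul0r.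
  exact: tm_dP.
have l4 : has_dsum (fun i j => u i j * x ^+ i * (y ^+ j.-1 *+ j)) (ev (dQ u) x y).
  have hd := nb_dQ hr' hrr hu; have lQ := ev_has_dsum xr' yr' hd.
  case: hd => V [hV hV'] /(_ tt) dV.
  have := has_dsum_shiftr (nonneg_tm hr' hV) hV' (dom_tm dV xr' yr') lQ.
  apply: eq_has_dsum => i [|j]; first by rewrite mulr0n mulr0.
  exact: tm_dQ.
have := has_dsum_lin (-1) l1 (has_dsum_lin 1 l2 (has_dsum_lin k (has_dsum_lin (h - 1) l3 l3) l4)).
move=> l5.
case: hu => U [hU hU'] /(_ tt) dU.
have -> : ev u (x + h) (y + k) - (ev u x y + (ev (dP u) x y * h + ev (dQ u) x y * k)) =
  ev u (x + h) (y + k) + -1 * (ev u x y + 1 * (ev (dP u) x y + (h - 1) * ev (dP u) x y +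
   k * ev (dQ u) x y)) by ring.
apply: (has_dsum_le (W := fun i j => 3 * s ^+ 2 * tm U r r i j) _ _ l5).
  by move=> n; rewrite dsumZ ler_wpM2l // mulr_ge0 ?exprn_ge0.
move=> i j; rewrite /tm.
set X := (x + h) ^+ i; set Y := (y + k) ^+ j.
have -> : u i j * (X * Y) + -1 * (u i j * (x ^+ i * y ^+ j) + 1 *
   (u i j * (x ^+ i.-1 *+ i) * y ^+ j + (h - 1) * (u i j * (x ^+ i.-1 *+ i) * y ^+ j) +
     k * (u i j * x ^+ i * (y ^+ j.-1 *+ j)))) =
   u i j * ((X - x ^+ i - x ^+ i.-1 *+ i * h) * Y + (x ^+ i.-1 *+ i * h) * (Y - y ^+ j) +
     x ^+ i * (Y - y ^+ j - y ^+ j.-1 *+ j * k)) by ring.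
rewrite cnM.
(* The factor 3 counts the pieces of the remainder of a monomial: second order in [x], mixed, second
   order in [y]. *)
have -> : 3 * s ^+ 2 * (U i j * (r ^+ i * r ^+ j)) =
  U i j * (s ^+ 2 * r ^+ i * r ^+ j + s * r ^+ i * (s * r ^+ j) + r ^+ i * (s ^+ 2 * r ^+ j)) by ring.
apply: ler_pM; rewrite ?cn_ge0 //.
apply: le_trans (cnD _ _) _; apply: lerD; first (apply: le_trans (cnD _ _) _; apply: lerD);
  rewrite cnM; apply: ler_pM; rewrite ?cn_ge0 //.
- exact: (cn_pow_incr2 hs hs1 hsg hh hx).
- exact: (cn_pow_incr hsg hx _ ykr).
- exact: (cn_pow_incr1 hs hsg hh hx).
- exact: (cn_pow_incrB hs hs1 hsg hk hy).
- exact: (cn_pow_incr hsg hx _ xr).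
- exact: (cn_pow_incr2 hs hs1 hsg hk hy).
Qed.

Lemma ev_cdiff2 (r N : R) u x y : ab r u N -> cn x < r -> cn y < r ->
  cdiff2 (fun x y => ev u x y) x y (ev (dP u) x y) (ev (dQ u) x y).
Proof.
move=> hu hx hy eps /RltP he.
pose sg := Num.min (r - cn x) (r - cn y).
have hsg : 0 < sg by rewrite lt_min; apply/andP; split; lra.
have sx : sg <= r - cn x by rewrite ge_min lexx.
have sy : sg <= r - cn y by rewrite ge_min lexx orbT.
have hxs : cn x + sg <= r by clearbody sg; lra.
have hys : cn y + sg <= r by clearbody sg; lra.
have hN : 0 <= N := nb_ge0 hu.
have hN3 : 0 < 3 * N + 1 by lra.
(* The remainder is at most [3 * s ^+ 2 * N], so [s * (3 * N + 1) <= eps * sg] is enough; the added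
   1 allows [N = 0]. *)
pose s0 := Num.min 1 (eps * sg / (3 * N + 1)).
have hs0 : 0 < s0 by rewrite lt_min ltr01 divr_gt0 // mulr_gt0.
exists (s0 * sg); split; first by apply/RltP; rewrite mulr_gt0.
move=> h k /RltP hh /RltP hk; apply/RleP; rewrite !CE.
rewrite -/(cn _) -/(cn h) -/(cn k) in hh hk *.
pose s := Num.max (cn h) (cn k) / sg.
have hs : 0 <= s by rewrite divr_ge0 ?(ltW hsg) // le_max cn_ge0.
have hss : s <= s0.
  by rewrite ler_pdivrMr // ge_max (ltW hh) (ltW hk).
have hs1 : s <= 1 by apply: le_trans hss _; rewrite ge_min lexx.
have h1 : cn h <= s * sg by rewrite divfK ?gt_eqF // le_max lexx.
have k1 : cn k <= s * sg by rewrite divfK ?gt_eqF // le_max lexx orbT.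
apply: le_trans (ev_expand hu hs hs1 hsg hxs hys h1 k1) _.
have h2 : s * (3 * N + 1) <= eps * sg.
  by rewrite -ler_pdivlMr //; apply: le_trans hss _; rewrite ge_min lexx orbT.
have h3 : s * sg <= cn h + cn k.
  by rewrite divfK ?gt_eqF // ge_max lerDl lerDr !cn_ge0.
have h4 : s * (s * (3 * N + 1)) <= s * (eps * sg) by rewrite ler_wpM2l.
have h5 : eps * (s * sg) <= eps * (cn h + cn k) by rewrite ler_wpM2l // ltW.
have h6 : 0 <= s * s by rewrite mulr_ge0.
rewrite !(RmultE, RplusE) -/(cn h) -/(cn k).
move: h4 h5 h6; rewrite expr2; clear; lra.
Qed.

(** * Complex functions of time *)

Definition ctC (g : R -> Cx) :=
  continuity (fun t => Cre (g t)) /\ continuity (fun t => Cim (g t)).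
Definition derC (g : R -> Cx) t d :=
  derivable_pt_lim (fun t => Cre (g t)) t (Cre d) /\
  derivable_pt_lim (fun t => Cim (g t)) t (Cim d).

Lemma ctC_cst c : ctC (fun=> c).
Proof. by split; apply: continuity_const. Qed.
Lemma ctCD g h : ctC g -> ctC h -> ctC (fun t => g t + h t).
Proof.
move=> [a b] [c d]; split; [exact: (continuity_plus _ _ a c) | exact: (continuity_plus _ _ b d)].
Qed.
Lemma ctCN g : ctC g -> ctC (fun t => - g t).
Proof. by move=> [a b]; split; [exact: (continuity_opp _ a) | exact: (continuity_opp _ b)]. Qed.
Lemma ctCM g h : ctC g -> ctC h -> ctC (fun t => g t * h t).
Proof.
move=> [a b] [c d]; split.
  exact: (continuity_minus _ _ (continuity_mult _ _ a c) (continuity_mult _ _ b d)).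
exact: (continuity_plus _ _ (continuity_mult _ _ a d) (continuity_mult _ _ b c)).
Qed.
Lemma ctC_sum (n : nat) (F : nat -> R -> Cx) :
  (forall i, ctC (F i)) -> ctC (fun t => \sum_(i < n) F i t).
Proof.
move=> h; elim: n => [|n IH].
  have -> : (fun t => \sum_(i < 0) F i t) = (fun=> 0) by apply/funext => t; rewrite big_ord0.
  exact: ctC_cst.
have -> : (fun t => \sum_(i < n.+1) F i t) = (fun t => \sum_(i < n) F i t + F n t).
  by apply/funext => t; rewrite big_ord_recr.
exact: ctCD.
Qed.

Lemma derC_ctC g d : (forall t, derC g t (d t)) -> ctC g.
Proof.
move=> h; split=> t; apply: derivable_continuous_pt; have [a b] := h t.
  by exists (Cre (d t)).
by exists (Cim (d t)).
Qed.
Lemma derC_cst c t : derC (fun=> c) t 0.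
Proof. by split; apply: derivable_pt_lim_const. Qed.
Lemma derCD g h t a b : derC g t a -> derC h t b -> derC (fun t => g t + h t) t (a + b).
Proof.
by move=> [? ?] [? ?]; split; apply: (derivable_pt_lim_plus (fun _ => _) (fun _ => _)).
Qed.
Lemma derCN g t a : derC g t a -> derC (fun t => - g t) t (- a).
Proof. by move=> [? ?]; split; apply: (derivable_pt_lim_opp (fun _ => _)). Qed.
Lemma derCM g h t a b : derC g t a -> derC h t b ->
  derC (fun t => g t * h t) t (a * h t + g t * b).
Proof.
move=> [a1 a2] [b1 b2].
have e1 := derivable_pt_lim_minus _ _ _ _ _
  (derivable_pt_lim_mult _ _ _ _ _ a1 b1) (derivable_pt_lim_mult _ _ _ _ _ a2 b2).
have e2 := derivable_pt_lim_plus _ _ _ _ _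
  (derivable_pt_lim_mult _ _ _ _ _ a1 b2) (derivable_pt_lim_mult _ _ _ _ _ a2 b1).
have r1 : Cre (a * h t + g t * b) = Rminus (Rplus (Rmult (Cre a) (Cre (h t))) (Rmult (Cre (g t)) (Cre b)))
  (Rplus (Rmult (Cim a) (Cim (h t))) (Rmult (Cim (g t)) (Cim b))).
  rewrite /Cre /Cim -CaddE -!CmulE /Cadd /Cmul /= !(RminusE, RplusE, RmultE); ring.
have r2 : Cim (a * h t + g t * b) = Rplus (Rplus (Rmult (Cre a) (Cim (h t))) (Rmult (Cre (g t)) (Cim b)))
  (Rplus (Rmult (Cim a) (Cre (h t))) (Rmult (Cim (g t)) (Cre b))).
  rewrite /Cre /Cim -CaddE -!CmulE /Cadd /Cmul /= !(RminusE, RplusE, RmultE); ring.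
by split; [rewrite r1; exact: e1 | rewrite r2; exact: e2].
Qed.
Lemma derC_sum (n : nat) (F : nat -> R -> Cx) (D : nat -> Cx) t :
  (forall i, derC (F i) t (D i)) -> derC (fun t => \sum_(i < n) F i t) t (\sum_(i < n) D i).
Proof.
move=> h; elim: n => [|n IH].
  have -> : (fun t => \sum_(i < 0) F i t) = (fun=> 0) by apply/funext => s; rewrite big_ord0.
  by rewrite big_ord0; exact: derC_cst.
have -> : (fun t => \sum_(i < n.+1) F i t) = (fun t => \sum_(i < n) F i t + F n t).
  by apply/funext => s; rewrite big_ord_recr.
by rewrite big_ord_recr; exact: derCD.
Qed.
Lemma derC_uniq g t a b : derC g t a -> derC g t b -> a = b.
Proof.
case: a b => [a1 a2] [b1 b2] [/= h1 h2] [/= h3 h4].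
by rewrite (uniqueness_limite _ _ _ _ h1 h3) (uniqueness_limite _ _ _ _ h2 h4).
Qed.
Lemma derCMn g t a n : derC g t a -> derC (fun t => g t *+ n) t (a *+ n).
Proof.
move=> h; elim: n => [|n IH]; first exact: derC_cst.
have -> : (fun t => g t *+ n.+1) = (fun t => g t + g t *+ n) by apply/funext => s; rewrite mulrS.
by rewrite mulrS; apply: derCD.
Qed.
Lemma ctCMn g n : ctC g -> ctC (fun t => g t *+ n).
Proof.
move=> h; elim: n => [|n IH]; first exact: ctC_cst.
have -> : (fun t => g t *+ n.+1) = (fun t => g t + g t *+ n) by apply/funext => s; rewrite mulrS.
exact: ctCD.
Qed.

Lemma Cre_rC l z : Cre (rC l * z) = l * Cre z.
Proof. by rewrite -CmulE /Cmul /rC /RtoC /Cre /= Rmult_0_l Rminus_0_r. Qed.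
Lemma Cim_rC l z : Cim (rC l * z) = l * Cim z.
Proof. by rewrite -CmulE /Cmul /rC /RtoC /Cim /= Rmult_0_l Rplus_0_r. Qed.

Lemma derC_mvt g d (G : R) t h : (forall t, derC g t (d t)) -> (forall t, cn (d t) <= G) ->
  cn (g (t + h) - g t) <= 2 * G * `|h|.
Proof.
move=> hd hG.
have key (f : Cx -> R) : (forall z w, f (z - w) = f z - f w) -> (forall z, `|f z| <= cn z) ->
    (forall s, derivable_pt_lim (fun t => f (g t)) s (f (d s))) ->
    `|f (g (t + h) - g t)| <= G * `|h|.
  move=> fB fn fd; rewrite fB.
  have [c [hc _]] := MVT_abs (fun t => f (g t)) (fun t => f (d t)) t (t + h) (fun c _ => fd c).
  move: hc; rewrite !RabsE RmultE !RminusE => ->.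
  have -> : t + h - t = h by ring.
  by rewrite ler_wpM2r // (le_trans (fn _)).
apply: le_trans (cn_le_reim _) _.
have h1 : `|Cre (g (t + h) - g t)| <= G * `|h|.
  by apply: key => //; [exact: cn_re | move=> s; case: (hd s)].
have h2 : `|Cim (g (t + h) - g t)| <= G * `|h|.
  by apply: key => //; [exact: cn_im | move=> s; case: (hd s)].
lra.
Qed.

(** The bound is asked for every [G], the form that [nb_coef] takes. The factor 2 comes from solving
    for the real and imaginary parts separately. *)
Definition is_bounded_solution (l : R) (g c : R -> Cx) :=
  (forall t, derC c t (g t - rC l * c t)) /\
  forall G, (forall t, cn (g t) <= G) -> forall t, cn (c t) <= 2 / `|l| * G.

Lemma bounded_solution_ex l g G : l != 0 -> ctC g -> (forall t, cn (g t) <= G) ->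
  exists c, is_bounded_solution l g c.
Proof.
move=> /eqP hl [g1 g2] hG.
have b1 H : (forall t, cn (g t) <= H) -> forall t, Rle (Rabs (Cre (g t))) H.
  by move=> hH t; apply/RleP; rewrite RabsE (le_trans (cn_re _)).
have b2 H : (forall t, cn (g t) <= H) -> forall t, Rle (Rabs (Cim (g t))) H.
  by move=> hH t; apply/RleP; rewrite RabsE (le_trans (cn_im _)).
have [c1 [d1 e1]] := bounded_solution_uniform _ _ hl g1 (ex_intro _ _ (b1 _ hG)).
have [c2 [d2 e2]] := bounded_solution_uniform _ _ hl g2 (ex_intro _ _ (b2 _ hG)).
exists (fun t => (c1 t, c2 t) : Cx); split.
  move=> t; split.
    have -> : Cre (g t - rC l * (c1 t, c2 t)) = Rminus (Cre (g t)) (Rmult l (c1 t)).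
      by rewrite RminusE RmultE -(Cre_rC l (c1 t, c2 t)).
    exact: d1.
  have -> : Cim (g t - rC l * (c1 t, c2 t)) = Rminus (Cim (g t)) (Rmult l (c2 t)).
    by rewrite RminusE RmultE -(Cim_rC l (c1 t, c2 t)).
  exact: d2.
move=> H hH t; apply: le_trans (cn_le_reim _) _ => /=.
have /RleP := e1 H (b1 _ hH) t; have /RleP := e2 H (b2 _ hH) t.
rewrite !RabsE !RdivE -/(Cre (c1 t, c2 t)) -/(Cim (c1 t, c2 t)).
have -> : 2 / `|l| * H = H / `|l| + H / `|l| by ring.
by move=> h1 h2; apply: lerD.
Qed.

(* Junk value 0 where there is no bounded solution. *)
Definition sol (l : R) (g : R -> Cx) : R -> Cx :=
  match pselect (exists c, is_bounded_solution l g c) with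
  | left h => projT1 (cid h)
  | right _ => fun=> 0
  end.

Lemma sol_is_bounded_solution l g G : l != 0 -> ctC g -> (forall t, cn (g t) <= G) ->
  is_bounded_solution l g (sol l g).
Proof.
move=> hl hg hG; rewrite /sol; case: pselect => [h|]; first by case: cid.
by case; apply: bounded_solution_ex hl hg hG.
Qed.

Lemma homogeneous_zero (l M : R) (c : R -> Cx) : l != 0 ->
  (forall t, derC c t (- (rC l * c t))) -> (forall t, cn (c t) <= M) -> forall t, c t = 0.
Proof.
move=> /eqP hl hd hM t.
have e1 : Cre (c t) = 0.
  apply: (bounded_homogeneous_zero l M (fun t => Cre (c t)) hl) => s.
    have [h _] := hd s.
    have -> : Rmult (Ropp l) (Cre (c s)) = Cre (- (rC l * c s)).
      by rewrite RmultE RoppE mulNr -Cre_rC.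
    exact: h.
  by apply/RleP; rewrite RabsE (le_trans (cn_re _)).
have e2 : Cim (c t) = 0.
  apply: (bounded_homogeneous_zero l M (fun t => Cim (c t)) hl) => s.
    have [_ h] := hd s.
    have -> : Rmult (Ropp l) (Cim (c s)) = Cim (- (rC l * c s)).
      by rewrite RmultE RoppE mulNr -Cim_rC.
    exact: h.
  by apply/RleP; rewrite RabsE (le_trans (cn_im _)).
by case: (c t) e1 e2 => a b /= -> ->.
Qed.

(** * Time-dependent series *)

Definition ctS (u : R -> ps2 Cx) := forall i j, ctC (fun t => u t i j).
Definition derS (u ud : R -> ps2 Cx) := forall t i j, derC (fun s => u s i j) t (ud t i j).

Lemma ctSD u v : ctS u -> ctS v -> ctS (fun t => u t + v t).
Proof. by move=> hu hv i j; apply: ctCD. Qed.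
Lemma ctSN u : ctS u -> ctS (fun t => - u t).
Proof. by move=> hu i j; apply: ctCN. Qed.
Lemma ctS_cst w : ctS (fun=> w).
Proof. by move=> i j; apply: ctC_cst. Qed.
Lemma ctSM u v : ctS u -> ctS v -> ctS (fun t => u t * v t).
Proof.
move=> hu hv i j.
have -> : (fun t => (u t * v t) i j) =
  (fun t => \sum_(k < i.+1) \sum_(l < j.+1) u t k l * v t (i - k)%N (j - l)%N).
  by apply/funext => t; rewrite ps2M.
apply: (ctC_sum i.+1 (F := fun k t => \sum_(l < j.+1) u t k l * v t (i - k)%N (j - l)%N)) => k.
by apply: (ctC_sum j.+1 (F := fun l t => u t k l * v t (i - k)%N (j - l)%N)) => l; apply: ctCM.
Qed.
Lemma ctSX u a : ctS u -> ctS (fun t => u t ^+ a).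
Proof.
move=> hu; elim: a => [|a IH]; first exact: ctS_cst.
have -> : (fun t => u t ^+ a.+1) = (fun t => u t * u t ^+ a) by apply/funext => t; rewrite exprS.
exact: ctSM.
Qed.
Lemma ctS_comp f p q : ctS f -> ctS p -> ctS q -> ctS (fun t => comp (f t) (p t) (q t)).
Proof.
move=> hf hp hq i j.
apply: (ctC_sum (i + j).+1 (F := fun a t => \sum_(b < (i + j).+1) f t a b * (p t ^+ a * q t ^+ b) i j)) => a.
apply: (ctC_sum (i + j).+1 (F := fun b t => f t a b * (p t ^+ a * q t ^+ b) i j)) => b.
by apply: ctCM => //; apply: (ctSM (u := fun t => p t ^+ a)); apply: ctSX.
Qed.
Lemma ctS_grad u : ctS u -> ctS (fun t => grad (u t)).
Proof. by move=> hu i j; apply: ctCM => //; apply: ctC_cst. Qed.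
Lemma ctS_dP u : ctS u -> ctS (fun t => dP (u t)).
Proof.
move=> hu i j; have -> : (fun t => dP (u t) i j) = (fun t => u t i.+1 j *+ i.+1).
  by apply/funext => t; rewrite dPE.
exact: ctCMn.
Qed.
Lemma ctS_dQ u : ctS u -> ctS (fun t => dQ (u t)).
Proof. by move=> hu i j; apply: (ctCMn (g := fun t => u t i j.+1)). Qed.

Lemma derSD u v ud vd : derS u ud -> derS v vd ->
  derS (fun t => u t + v t) (fun t => ud t + vd t).
Proof. by move=> hu hv t i j; apply: derCD. Qed.
Lemma derSN u ud : derS u ud -> derS (fun t => - u t) (fun t => - ud t).
Proof. by move=> hu t i j; apply: derCN. Qed.
Lemma derS_cst w : derS (fun=> w) (fun=> 0).
Proof. by move=> t i j; apply: derC_cst. Qed.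
Lemma derSM u v ud vd : derS u ud -> derS v vd ->
  derS (fun t => u t * v t) (fun t => ud t * v t + u t * vd t).
Proof.
move=> hu hv t i j.
have -> : (fun t => (u t * v t) i j) =
  (fun t => \sum_(k < i.+1) \sum_(l < j.+1) u t k l * v t (i - k)%N (j - l)%N).
  by apply/funext => s; rewrite ps2M.
have -> : (ud t * v t + u t * vd t) i j =
  \sum_(k < i.+1) \sum_(l < j.+1) (ud t k l * v t (i - k)%N (j - l)%N + u t k l * vd t (i - k)%N (j - l)%N).
  rewrite !psD !ps2M -big_split; apply: eq_bigr => k _ /=; by rewrite -big_split.
apply: (derC_sum i.+1 (F := fun k t => \sum_(l < j.+1) u t k l * v t (i - k)%N (j - l)%N)
  (D := fun k => \sum_(l < j.+1) (ud t k l * v t (i - k)%N (j - l)%N + u t k l * vd t (i - k)%N (j - l)%N))) => k.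
apply: (derC_sum j.+1 (F := fun l t => u t k l * v t (i - k)%N (j - l)%N)
  (D := fun l => ud t k l * v t (i - k)%N (j - l)%N + u t k l * vd t (i - k)%N (j - l)%N)) => l.
exact: derCM.
Qed.
Lemma derS_grad u ud : derS u ud -> derS (fun t => grad (u t)) (fun t => grad (ud t)).
Proof.
move=> hu t i j; have := derCM (derC_cst (j%:R - i%:R) t) (hu t i j).
by rewrite mul0r add0r.
Qed.
Lemma derS_dP u ud : derS u ud -> derS (fun t => dP (u t)) (fun t => dP (ud t)).
Proof.
move=> hu t i j; have -> : (fun t => dP (u t) i j) = (fun t => u t i.+1 j *+ i.+1).
  by apply/funext => s; rewrite dPE.
by rewrite dPE; apply: derCMn.
Qed.
Lemma derS_dQ u ud : derS u ud -> derS (fun t => dQ (u t)) (fun t => dQ (ud t)).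
Proof. by move=> hu t i j; apply: (derCMn (g := fun t => u t i j.+1)). Qed.
Lemma derS_br u v ud vd : derS u ud -> derS v vd ->
  derS (fun t => br (u t) (v t)) (fun t => br (ud t) (v t) + br (u t) (vd t)).
Proof.
move=> hu hv.
have := derSD (derSM (derS_dP hu) (derS_dQ hv)) (derSN (derSM (derS_dQ hu) (derS_dP hv))).
move=> h t i j; have := h t i j; congr derC.
suff -> : br (ud t) (v t) + br (u t) (vd t) =
  dP (ud t) * dQ (v t) + dP (u t) * dQ (vd t) - (dQ (ud t) * dP (v t) + dQ (u t) * dP (vd t)) by [].
by rewrite /br; ring.
Qed.

Definition lim0 (phi : R -> Cx) := forall e : R, 0 < e -> exists2 dl : R, 0 < dl &
  forall h, h != 0 -> `|h| < dl -> cn (phi h) <= e.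

Lemma lim0_sum (n : nat) (F : nat -> R -> Cx) :
  (forall i, lim0 (F i)) -> lim0 (fun h => \sum_(i < n) F i h).
Proof.
move=> hF; elim: n => [|n IH] e he.
  by exists 1 => // h _ _; rewrite big_ord0 cn0 ltW.
have he2 : 0 < e / 2 by rewrite divr_gt0.
have [d1 hd1 h1] := IH _ he2; have [d2 hd2 h2] := hF n _ he2.
exists (Num.min d1 d2); first by rewrite lt_min hd1.
move=> h hn; rewrite lt_min => /andP [l1 l2]; rewrite big_ord_recr.
apply: le_trans (cnD _ _) _; have := h1 h hn l1; have := h2 h hn l2; lra.
Qed.

Lemma lim0Ml a phi : lim0 phi -> lim0 (fun h => phi h * a).
Proof.
move=> hphi e he; have ha : 0 < cn a + 1 by have := cn_ge0 a; lra.
have [dl hd h1] := hphi (e / (cn a + 1)) (divr_gt0 he ha).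
exists dl => // h hn hh; have := h1 h hn hh; rewrite ler_pdivlMr // cnM => h2.
by apply: le_trans h2; rewrite ler_wpM2l ?cn_ge0 // lerDl.
Qed.

Lemma derC_lim0 g t d : derC g t d -> lim0 (fun h => rC h^-1 * (g (t + h) - g t) - d).
Proof.
move=> [hr hi] e he; have /RltP he2 : 0 < e / 2 by rewrite divr_gt0.
have [d1 h1] := hr _ he2; have [d2 h2] := hi _ he2.
have /RltP p1 := cond_pos d1; have /RltP p2 := cond_pos d2.
exists (Num.min (pos d1) (pos d2)); first by rewrite lt_min p1.
move=> h /eqP hn; rewrite lt_min => /andP [/RltP l1 /RltP l2].
rewrite -RabsE in l1 l2.
have /RltP := h1 h hn l1; have /RltP := h2 h hn l2; rewrite !RabsE => e2 e1.
apply: le_trans (cn_le_reim _) _.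
have -> : Cre (rC h^-1 * (g (t + h) - g t) - d) = Cre (rC h^-1 * (g (t + h) - g t)) - Cre d by [].
have -> : Cim (rC h^-1 * (g (t + h) - g t) - d) = Cim (rC h^-1 * (g (t + h) - g t)) - Cim d by [].
rewrite Cre_rC Cim_rC.
have -> : Cre (g (t + h) - g t) = Cre (g (t + h)) - Cre (g t) by [].
have -> : Cim (g (t + h) - g t) = Cim (g (t + h)) - Cim (g t) by [].
move: e1 e2; rewrite !(RminusE, RplusE, RdivE) ![_ / h]mulrC; lra.
Qed.

(** By the mean value theorem the difference quotients of the coefficients share the majorant
    [2 * U], so the error series has a tail small uniformly in [h]; its finitely many other terms
    tend to zero. *)
Lemma ev_tderiv (r M N : R) u ud x y t : derS u ud -> nb r u M -> nb r ud N ->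
  cn x <= r -> cn y <= r -> cderiv_plus (fun s => ev (u s) x y) t (ev (ud t) x y).
Proof.
move=> hd hu hud hx hy eps /RltP he.
have hr : 0 <= r by apply: le_trans hx; apply: cn_ge0.
pose z (h : R) : ps2 Cx := cst (rC h^-1) * (u (t + h) - u t) - ud t.
have hz h : ev (z h) x y = rC h^-1 * (ev (u (t + h)) x y - ev (u t) x y) - ev (ud t) x y.
  have a1 := nb_at (t + h) hu; have a2 := nb_at t hu; have a3 := nb_at t hud.
  have a4 := nbB a1 a2.
  have a5 : ab r (cst (rC h^-1) * (u (t + h) - u t)) (cn (rC h^-1) * (M + M)).
    apply: nb_coef a4; first exact: cn_ge0.
    by move=> i j G hG _; rewrite cstM cnM ler_wpM2l ?cn_ge0 //; apply: (hG tt).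
  by rewrite /z (evB hx hy a5 a3) (evZ hx hy _ a4) (evB hx hy a1 a2).
case: hud => U [hU hU'] dU.
have dz h i j : h != 0 -> cn (z h i j) <= 3 * U i j.
  move=> hn; rewrite /z !psB cstM psB.
  apply: le_trans (cnB _ _) _; rewrite cnM cn_rC normfV.
  have h1 : cn (u (t + h) i j - u t i j) <= 2 * U i j * `|h|.
    by apply: (@derC_mvt (fun s => u s i j) (fun s => ud s i j)) => s; [apply: hd | apply: dU].
  have h2 := dU t i j.
  have : `|h|^-1 * cn (u (t + h) i j - u t i j) <= 2 * U i j.
    by rewrite ler_pdivrMl ?normr_gt0 // mulrC.
  lra.
pose W i j := tm (fun i j => 3 * U i j) r r i j.
have hW : nonneg W by apply: nonneg_tm => // i j; rewrite mulr_ge0.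
have hWM n : dsum n W <= 3 * N.
  rewrite (eq_dsum _ (y := fun i j => 3 * tm U r r i j)); first by rewrite dsumZ ler_wpM2l.
  by move=> i j; rewrite /W /tm; ring.
have he2 : 0 < eps / 4 by rewrite divr_gt0.
have [n hn] := has_dsum_tail hW hWM he2.
have [dl hdl hlim] : exists2 dl : R, 0 < dl & forall h, h != 0 -> `|h| < dl ->
    cn (dsum n (tm (z h) x y)) <= eps / 4.
  suff : lim0 (fun h => dsum n (tm (z h) x y)) by move=> /(_ _ he2).
  apply: (lim0_sum n (F := fun i h => \sum_(j < n) tm (z h) x y i j)) => i.
  apply: (lim0_sum n (F := fun j h => tm (z h) x y i j)) => j.
  apply: (@lim0Ml _ (fun h => z h i j)) => e he'.
  have [dl hdl h1] := derC_lim0 (hd t i j) he'; exists dl => // h hn0 hh.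
  by rewrite /z !psB cstM psB; apply: h1.
exists dl; split; first exact/RltP.
move=> h /eqP hn0 /RltP; rewrite RabsE => hh _; apply/RltP; rewrite !CE.
have -> : Cscal (Rinv h) (ev (u (Rplus t h)) x y - ev (u t) x y) =
  rC h^-1 * (ev (u (t + h)) x y - ev (u t) x y).
  by rewrite -CmulE /Cscal /Cmul /rC /RtoC /= !Rmult_0_l Rminus_0_r Rplus_0_r.
rewrite -hz -/(cn _).
have dz' : dom (z h) (fun i j => 3 * U i j) by move=> i j; apply: dz.
have hs : has_dsum (tm (z h) x y) (ev (z h) x y).
  have [l hl] := has_dsum_ex hW hWM (dom_tm dz' hx hy).
  by rewrite (has_dsum_ev hl).
have h1 := hn n _ _ (leqnn n) (dom_tm dz' hx hy) hs.
have h2 := hlim h hn0 hh.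
have : cn (ev (z h) x y) <= cn (ev (z h) x y - dsum n (tm (z h) x y)) + cn (dsum n (tm (z h) x y)).
  have {1}-> : ev (z h) x y = (ev (z h) x y - dsum n (tm (z h) x y)) + dsum n (tm (z h) x y) by ring.
  exact: cnD.
lra.
Qed.

(** * The normal form equations and their solution *)

Section Resonances.
Variable K : comNzRingType.

(** [res_diag w] is the part of [w] in the monomials [P^i Q^(i+1)], divided by [Q], hence a series
    in [P Q]. Likewise [res_P w] is the diagonal of [w] without its constant term, divided by
    [Q]. *)
Definition res_diag (w : ps2 K) : ps2 K := fun i j => if i == j then w i j.+1 else 0.
Definition res_P (w : ps2 K) : ps2 K := fun i j => if i == j.+1 then w i j.+1 else 0.

Lemma grad_PP : grad PP = - PP :> ps2 K.
Proof. by rewrite gradE dP_PP dQ_PP; ring. Qed.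
Lemma grad_QQ : grad QQ = QQ :> ps2 K.
Proof. by rewrite gradE dP_QQ dQ_QQ; ring. Qed.
Lemma gradD (u v : ps2 K) : grad (u + v) = grad u + grad v.
Proof. by rewrite !gradE dPD dQD; ring. Qed.
Lemma grad_res_diag w : grad (res_diag w) = 0.
Proof.
apply/ps2P => i j; rewrite /grad /res_diag.
by case: eqP => [->|_]; rewrite ?subrr ?mul0r ?mulr0.
Qed.
Lemma grad_res_P w : grad (res_P w) = - res_P w.
Proof.
apply/ps2P => i j; rewrite !psN /grad /res_P.
case: eqP => [->|_]; last by rewrite mulr0 oppr0.
by rewrite -addn1 natrD; ring.
Qed.
Lemma ord_ge_res_diag n w : ord_ge n.+1 w -> ord_ge n (res_diag w).
Proof. by move=> h i j hij; rewrite /res_diag; case: ifP => // _; apply: h; rewrite addnS. Qed.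
Lemma ord_ge_res_P n w : ord_ge n.+1 w -> ord_ge n (res_P w).
Proof. by move=> h i j hij; rewrite /res_P; case: ifP => // _; apply: h; rewrite addnS. Qed.
Lemma res_diagB v w : res_diag (v - w) = res_diag v - res_diag w.
Proof. by apply/ps2P => i j; rewrite !psB /res_diag; case: ifP; rewrite ?subr0. Qed.
Lemma res_PB v w : res_P (v - w) = res_P v - res_P w.
Proof. by apply/ps2P => i j; rewrite !psB /res_P; case: ifP; rewrite ?subr0. Qed.

(** Multiplication by a series in [P Q] preserves the difference of the two exponents, so only one
    such line of coefficients of [u] matters. *)
Lemma diag_mul_zero (w u : ps2 K) i j : (forall k l, k != l -> w k l = 0) ->
  (forall k l, (k <= i)%N -> (l <= j)%N -> (k + j = l + i)%N -> u k l = 0) -> (w * u) i j = 0.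
Proof.
move=> hw hu; rewrite ps2M big1 // => k _; rewrite big1 // => l _.
have hk := ltn_ord k; have hl := ltn_ord l.
have [e|n] := eqVneq (k : nat) (l : nat); last by rewrite hw ?mul0r.
by rewrite hu ?mulr0 ?leq_subr //; lia.
Qed.

End Resonances.

Section NormalForm.
Variables (om rho phi : R) (f : R -> ps2 Cx).
Hypotheses (om0 : 0 < om) (rho0 : 0 < rho).
Hypotheses (f_ct : ctS f) (f_ord : forall t, ord_ge 3 (f t)).
Hypotheses (fP : nb (2 * rho) (fun t => dP (f t)) phi).
Hypotheses (fQ : nb (2 * rho) (fun t => dQ (f t)) phi).
Hypothesis phi_small : 16 * phi <= om * rho.

Implicit Types A B : R -> ps2 Cx.

(* The term [res_P] is the one for which the diagonal part of {p, q} is 1, which by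
   [br_diag] is the condition (grad p * q)_(k, k) = - [k = 1]. *)
Definition pser A B t : ps2 Cx := PP + A t + res_P (grad (A t) * B t).
Definition qser B t : ps2 Cx := QQ + B t.
Definition Fp A B t := comp (dP (f t)) (pser A B t) (qser B t).
Definition Fq A B t := comp (dQ (f t)) (pser A B t) (qser B t).
Definition gser A B t := res_diag (Fp A B t).
(** Of [g * grad p] and [g * grad q] only the parts from [A] and [B] are kept: the other terms of
    [p] and [q] are resonant, and so are their products with [g]. *)
Definition rhsA A B t := - Fq A B t - gser A B t * grad (A t).
Definition rhsB A B t := Fp A B t - gser A B t * grad (B t).
(** The resonant coefficients are set to zero because those of [p] are carried by [PP] and [res_P]
    in [pser], and those of [q] by [QQ] alone. *)
Definition stepA A B t : ps2 Cx := fun i j => if i == j.+1 then 0 else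
  sol (om * (j%:R - i%:R + 1)) (fun s => rhsA A B s i j) t.
Definition stepB A B t : ps2 Cx := fun i j => if j == i.+1 then 0 else
  sol (om * (j%:R - i%:R - 1)) (fun s => rhsB A B s i j) t.

(** The right sides have norm at most [2 * phi] and solving costs a factor [4 / om], so this is the
    radius of a ball that the step maps into itself. *)
Definition kap := 8 * phi / om.

Lemma phi_ge0 : 0 <= phi. Proof. exact: nb_ge0 fP. Qed.
Lemma kap_ge0 : 0 <= kap.
Proof. by rewrite divr_ge0 ?mulr_ge0 ?phi_ge0 // ltW. Qed.
Lemma kap_le : kap <= rho / 2.
Proof. rewrite ler_pdivrMr //; have := phi_small; lra. Qed.

Record admissible A B : Prop := Admissible {
  adm_ctA : ctS A; adm_ctB : ctS B;
  adm_ordA : forall t, ord_ge 2 (A t); adm_ordB : forall t, ord_ge 2 (B t);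
  adm_resA : forall t j, A t j.+1 j = 0; adm_resB : forall t i, B t i i.+1 = 0;
  adm_nbA : nb rho A kap; adm_nbB : nb rho B kap;
  adm_nbDA : nb rho (fun t => grad (A t)) kap; adm_nbDB : nb rho (fun t => grad (B t)) kap }.

Lemma sum_delta_le n b (c : R) : 0 <= c -> \sum_(j < n) (if j == b :> nat then c else 0) <= c.
Proof.
move=> hc; have [hb|hb] := ltnP b n.
  rewrite (bigD1 (Ordinal hb)) //= eqxx big1 ?addr0 // => j hj.
  by rewrite -val_eqE /= in hj; rewrite (negbTE hj).
rewrite big1 // => j _; case: eqP => // e.
by have := ltn_ord j; rewrite e ltnNge hb.
Qed.

Lemma nb_monomial (T : Type) a b (u : ps2 Cx) : (a + b = 1)%N ->
  (forall i j, u i j = ((i == a) && (j == b))%:R) -> nb rho (fun _ : T => u) rho.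
Proof.
move=> hab hu; exists (fun i j => ((i == a) && (j == b))%:R); last first.
  by move=> _ i j; rewrite hu; case: (_ && _); rewrite ?cn1 ?cn0.
split=> [i j|n]; first exact: ler0n.
have r0 : 0 <= rho by apply: ltW.
apply: le_trans (sum_delta_le n a r0); apply: ler_sum => i _.
case: (nat_of_ord i == a) / eqP => [->|ne]; last first.
  by rewrite big1 // => j _; rewrite /tm; case: eqP ne; rewrite ?mul0r.
apply: le_trans (sum_delta_le n b r0); apply: ler_sum => j _.
rewrite /tm eqxx /=; case: eqP => [->|_]; last by rewrite mul0r.
by rewrite mul1r -exprD hab expr1.
Qed.

Lemma nb_PP (T : Type) : nb rho (fun _ : T => PP) rho.
Proof. by apply: (@nb_monomial T 1 0) => // i j; rewrite PPE. Qed.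
Lemma nb_QQ (T : Type) : nb rho (fun _ : T => QQ) rho.
Proof. by apply: (@nb_monomial T 0 1) => // i j; rewrite QQE. Qed.

(** * One step of the iteration preserves the ball *)

Section Step.
Variables A B : R -> ps2 Cx.
Hypothesis adm : admissible A B.

Let rho_ge0 : 0 <= rho. Proof. exact: ltW. Qed.

Lemma ord_ge_res_gradM t : ord_ge 3 (res_P (grad (A t) * B t)).
Proof.
by apply: ord_ge_res_P; apply: (@ord_geM _ 2 2); [apply: ord_ge_grad; apply: adm_ordA adm t | apply: adm_ordB adm t].
Qed.
Lemma ord_ge_pser t : ord_ge 1 (pser A B t).
Proof.
apply: ord_geD; first apply: ord_geD; first exact: ord_ge_PP.
  by apply: ord_ge_leq (adm_ordA adm t).
by apply: ord_ge_leq (ord_ge_res_gradM t).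
Qed.
Lemma ord_ge_qser t : ord_ge 1 (qser B t).
Proof.
by apply: ord_geD; [exact: ord_ge_QQ | apply: ord_ge_leq (adm_ordB adm t)].
Qed.
Lemma ord_ge_Fp t : ord_ge 2 (Fp A B t).
Proof.
by apply: comp_ord_ge; [exact: ord_ge_pser | exact: ord_ge_qser | exact/ord_ge_dP/f_ord].
Qed.
Lemma ord_ge_Fq t : ord_ge 2 (Fq A B t).
Proof.
by apply: comp_ord_ge; [exact: ord_ge_pser | exact: ord_ge_qser | exact/ord_ge_dQ/f_ord].
Qed.

Lemma ctS_mask (u : R -> ps2 Cx) (m : nat -> nat -> bool) (v : R -> ps2 Cx) :
  (forall i j, m i j -> ctC (fun t => u t i j)) ->
  (forall t i j, v t i j = if m i j then u t i j else 0) -> ctS v.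
Proof.
move=> hu hv i j; have -> : (fun t => v t i j) = (fun t => if m i j then u t i j else 0).
  by apply/funext.
by case h : (m i j); [apply: hu | apply: ctC_cst].
Qed.

Lemma ctS_res_P u : ctS u -> ctS (fun t => res_P (u t)).
Proof.
move=> hu; apply: (@ctS_mask (fun t i j => u t i j.+1) (fun i j => i == j.+1)) => //.
Qed.
Lemma ctS_res_diag u : ctS u -> ctS (fun t => res_diag (u t)).
Proof.
move=> hu; apply: (@ctS_mask (fun t i j => u t i j.+1) (fun i j => i == j)) => //.
Qed.
Lemma ctS_pser : ctS (pser A B).
Proof.
have [cA cB _ _ _ _ _ _ _ _] := adm.
apply: ctSD; first by apply: ctSD => //; apply: ctS_cst.
by apply: ctS_res_P; apply: ctSM => //; apply: ctS_grad.
Qed.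
Lemma ctS_qser : ctS (qser B).
Proof. by apply: ctSD; [apply: ctS_cst | exact: adm_ctB adm]. Qed.
Lemma ctS_Fp : ctS (Fp A B).
Proof. by apply: ctS_comp; [exact: ctS_dP | exact: ctS_pser | exact: ctS_qser]. Qed.
Lemma ctS_Fq : ctS (Fq A B).
Proof. by apply: ctS_comp; [exact: ctS_dQ | exact: ctS_pser | exact: ctS_qser]. Qed.
Lemma ctS_gser : ctS (gser A B).
Proof. exact/ctS_res_diag/ctS_Fp. Qed.
Lemma ctS_rhsA : ctS (rhsA A B).
Proof.
apply: ctSD; first exact/ctSN/ctS_Fq.
by apply/ctSN/ctSM; [exact: ctS_gser | exact/ctS_grad/(adm_ctA adm)].
Qed.
Lemma ctS_rhsB : ctS (rhsB A B).
Proof.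
apply: ctSD; first exact/ctS_Fp.
by apply/ctSN/ctSM; [exact: ctS_gser | exact/ctS_grad/(adm_ctB adm)].
Qed.

Lemma nb_res_P (N : R) u : nb rho u N -> nb rho (fun t : R => res_P (u t)) (N / rho).
Proof. by move=> hu; apply: (nb_mask (fun i j => i == j.+1)); apply: nb_shiftQ. Qed.
Lemma nb_res_diag (N : R) u : nb rho u N -> nb rho (fun t : R => res_diag (u t)) (N / rho).
Proof. by move=> hu; apply: (nb_mask (fun i j => i == j)); apply: nb_shiftQ. Qed.

(** The sum [rho + kap + kap^2 / rho] stays below [2 * rho] because [kap <= rho / 2]; this is why
    the derivatives of [f] are measured at radius [2 * rho]. *)
Lemma nb_pser : nb rho (pser A B) (2 * rho).
Proof.
have [_ _ _ _ _ _ nA nB nDA nDB] := adm.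
have h := nbD (nbD (nb_PP R) nA) (nb_res_P (nbM rho_ge0 nDA nB)).
apply: nb_le h; have k0 := kap_ge0; have k1 := kap_le.
have : kap * kap / rho <= kap.
  rewrite ler_pdivrMr // ler_wpM2l //; have := rho0; lra.
have := rho0; lra.
Qed.
Lemma nb_qser : nb rho (qser B) (2 * rho).
Proof.
have h := nbD (nb_QQ R) (adm_nbB adm).
by apply: nb_le h; have := kap_le; have := rho0; lra.
Qed.
Lemma nb_Fp : nb rho (Fp A B) phi.
Proof. exact: (nb_comp rho_ge0 fP nb_pser nb_qser). Qed.
Lemma nb_Fq : nb rho (Fq A B) phi.
Proof. exact: (nb_comp rho_ge0 fQ nb_pser nb_qser). Qed.
Lemma nb_gser : nb rho (gser A B) (phi / rho).
Proof. exact/nb_res_diag/nb_Fp. Qed.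

Lemma rhs_bound : phi + phi / rho * kap <= om * kap / 4.
Proof.
have -> : om * kap / 4 = phi + phi.
  by rewrite /kap; have : om != 0 by [rewrite gt_eqF]; move=> h; field.
rewrite lerD2l mulrAC ler_pdivrMr // ler_wpM2l ?phi_ge0 //.
have := kap_le; have := rho0; lra.
Qed.
Lemma nb_rhsA : nb rho (rhsA A B) (om * kap / 4).
Proof.
apply: nb_le rhs_bound _; apply: nbB; first exact/nbN/nb_Fq.
by apply: nbM; [exact: rho_ge0 | exact: nb_gser | exact: adm_nbDA adm].
Qed.
Lemma nb_rhsB : nb rho (rhsB A B) (om * kap / 4).
Proof.
apply: nb_le rhs_bound _; apply: nbB; first exact: nb_Fp.
by apply: nbM; [exact: rho_ge0 | exact: nb_gser | exact: adm_nbDB adm].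
Qed.

Lemma nb_coef_bound (N : R) (u : R -> ps2 Cx) i j : nb rho u N -> exists G, forall t, cn (u t i j) <= G.
Proof. by move=> [U _ hU]; exists (U i j) => t; apply: hU. Qed.

(** A nonzero integer has modulus at least 1, which absorbs the shift by [s]. The second inequality
    is what makes the divisor pay for [grad]. *)
Lemma nat_diff_bound (i j : nat) (s : R) : (s = 1 \/ s = -1) -> j%:R - i%:R + s != 0 ->
  1 <= `|j%:R - i%:R + s| /\ `|j%:R - i%:R| <= 2 * `|j%:R - i%:R + s|.
Proof.
move=> hs hn; have h1 : 1 <= `|j%:R - i%:R + s|.
  have [z ez] : exists z : int, j%:R - i%:R + s = z%:~R.
    by case: hs => ->; [exists (j%:Z - i%:Z + 1) | exists (j%:Z - i%:Z - 1)];
      rewrite ?intrD ?rmorphN.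
  rewrite ez in hn *; rewrite -intr_norm ler1z -gtz0_ge1 normr_gt0.
  by apply: contraNneq hn => ->.
split=> //; have : `|j%:R - i%:R| <= `|j%:R - i%:R + s| + `|s|.
  have {1}-> : j%:R - i%:R = (j%:R - i%:R + s) - s by ring.
  exact: ler_normB.
have -> : `|s| = 1 by case: hs => ->; rewrite ?normrN normr1.
lra.
Qed.

Lemma lamA_neq0 i j : (i == j.+1) = false -> (j%:R - i%:R + 1 : R) != 0.
Proof.
move=> /negbT h; apply: contraNneq h => e; rewrite -(eqr_nat R) -addn1 natrD.
by apply/eqP; lra.
Qed.
Lemma lamB_neq0 i j : (j == i.+1) = false -> (j%:R - i%:R - 1 : R) != 0.
Proof.
move=> /negbT h; apply: contraNneq h => e; rewrite -(eqr_nat R) -addn1 natrD.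
by apply/eqP; lra.
Qed.

Lemma stepAP i j : (i == j.+1) = false ->
  is_bounded_solution (om * (j%:R - i%:R + 1)) (fun s => rhsA A B s i j) (fun t => stepA A B t i j).
Proof.
move=> h; have [G hG] := nb_coef_bound i j nb_rhsA.
have hl : om * (j%:R - i%:R + 1) != 0 by apply: mulf_neq0; [rewrite gt_eqF | exact: lamA_neq0].
have -> : (fun t => stepA A B t i j) = sol (om * (j%:R - i%:R + 1)) (fun s => rhsA A B s i j).
  by apply/funext => t; rewrite /stepA h.
exact: (sol_is_bounded_solution hl (ctS_rhsA i j) hG).
Qed.
Lemma stepBP i j : (j == i.+1) = false ->
  is_bounded_solution (om * (j%:R - i%:R - 1)) (fun s => rhsB A B s i j) (fun t => stepB A B t i j).
Proof.
move=> h; have [G hG] := nb_coef_bound i j nb_rhsB.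
have hl : om * (j%:R - i%:R - 1) != 0 by apply: mulf_neq0; [rewrite gt_eqF | exact: lamB_neq0].
have -> : (fun t => stepB A B t i j) = sol (om * (j%:R - i%:R - 1)) (fun s => rhsB A B s i j).
  by apply/funext => t; rewrite /stepB h.
exact: (sol_is_bounded_solution hl (ctS_rhsB i j) hG).
Qed.

(** The constant [4 / om] combines the factor 2 of the real and imaginary parts with the factor 2 of
    [nat_diff_bound]. *)
Lemma sol_coef_bound (i j : nat) (s : R) (z : Cx) (G : R) : (s = 1 \/ s = -1) -> j%:R - i%:R + s != 0 ->
  0 <= G -> cn z <= 2 / `|om * (j%:R - i%:R + s)| * G ->
  cn z <= 4 / om * G /\ cn ((j%:R - i%:R) * z) <= 4 / om * G.
Proof.
move=> hs hn hG hz; have [h1 h2] := nat_diff_bound hs hn.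
rewrite normrM (gtr0_norm om0) invfM in hz.
set d := `|j%:R - i%:R + s| in h1 h2 hz.
have d0 : 0 < d by lra.
have di : 0 < d^-1 <= 1 by rewrite invr_gt0 d0 invf_le1.
have oi : 0 < om^-1 by rewrite invr_gt0.
have k : 0 <= om^-1 * G by rewrite mulr_ge0 // ltW.
have hz' : cn z <= 2 * (om^-1 * G) * d^-1.
  by apply: le_trans hz _; rewrite le_eqVlt; apply/orP; left; apply/eqP; ring.
have hz2 : 2 * (om^-1 * G) * d^-1 <= 2 * (om^-1 * G).
  by apply: ler_piMr; [rewrite mulr_ge0 | case/andP: di].
have -> : 4 / om * G = 4 * (om^-1 * G) by ring.
split; first lra.
have -> : (j%:R - i%:R : Cx) = rC (j%:R - i%:R) by rewrite rCD rCN !rC_natr.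
rewrite cnM cn_rC; apply: (@le_trans _ _ (2 * d * (2 * (om^-1 * G) * d^-1))).
  by apply: ler_pM; rewrite ?cn_ge0.
rewrite le_eqVlt; apply/orP; left; apply/eqP.
by have : d != 0 by [rewrite gt_eqF]; move: (om^-1) => o hd; field.
Qed.

Lemma nb_step (lam : R) u v : (lam = 1 \/ lam = -1) -> nb rho u (om * kap / 4) ->
  (forall i j, (j%:R - i%:R + lam : R) != 0 ->
     is_bounded_solution (om * (j%:R - i%:R + lam)) (fun s => u s i j) (fun t => v t i j)) ->
  (forall i j t, (j%:R - i%:R + lam : R) = 0 -> v t i j = 0) ->
  nb rho v kap /\ nb rho (fun t => grad (v t)) kap.
Proof.
move=> hlam hu hv hv0.
have ek : kap = 4 / om * (om * kap / 4).
  by have : om != 0 by [rewrite gt_eqF]; move=> h; field.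
have o4 : 0 <= 4 / om by rewrite divr_ge0 // ltW.
have main i j G : (forall t, cn (u t i j) <= G) -> forall t,
    cn (v t i j) <= 4 / om * G /\ cn (grad (v t) i j) <= 4 / om * G.
  move=> hG t; have hG0 : 0 <= G by apply: le_trans (hG t); apply: cn_ge0.
  have [e|ne] := eqVneq (j%:R - i%:R + lam : R) 0.
    by rewrite /grad (hv0 _ _ _ e) mulr0 cn0; split; apply: mulr_ge0.
  by apply: (sol_coef_bound hlam ne hG0); apply: (hv i j ne).2.
rewrite {1 2}ek; split; apply: (nb_coef o4 _ hu) => i j G hG t.
  by have [] := main i j G hG t.
by have [] := main i j G hG t.
Qed.

Lemma step_admissible : admissible (stepA A B) (stepB A B).
Proof.
have cA : ctS (stepA A B).
  apply: (@ctS_mask (stepA A B) (fun i j => i != j.+1)) => [i j /negbTE h|t i j].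
    by have [h1 _] := stepAP h; apply: (derC_ctC h1).
  by rewrite /stepA; case: (i == j.+1).
have cB : ctS (stepB A B).
  apply: (@ctS_mask (stepB A B) (fun i j => j != i.+1)) => [i j /negbTE h|t i j].
    by have [h1 _] := stepBP h; apply: (derC_ctC h1).
  by rewrite /stepB; case: (j == i.+1).
have hA i j : (j%:R - i%:R + 1 : R) != 0 -> (i == j.+1) = false.
  by move=> h; apply/negbTE; apply: contraNneq h => ->; rewrite -addn1 natrD; apply/eqP; ring.
have hB i j : (j%:R - i%:R - 1 : R) != 0 -> (j == i.+1) = false.
  by move=> h; apply/negbTE; apply: contraNneq h => ->; rewrite -addn1 natrD; apply/eqP; ring.
have [nA nDA] : nb rho (stepA A B) kap /\ nb rho (fun t => grad (stepA A B t)) kap.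
  apply: (nb_step (lam := 1)); [by left | exact: nb_rhsA | by move=> i j /hA /stepAP |].
  move=> i j t e; rewrite /stepA; case: eqP => // /eqP /negbTE /lamA_neq0.
  by rewrite e eqxx.
have [nB nDB] : nb rho (stepB A B) kap /\ nb rho (fun t => grad (stepB A B t)) kap.
  apply: (nb_step (lam := -1)); [by right | exact: nb_rhsB | by move=> i j /hB /stepBP |].
  move=> i j t e; rewrite /stepB; case: eqP => // /eqP /negbTE /lamB_neq0.
  by rewrite e eqxx.
have oG t : ord_ge 1 (gser A B t) by apply/ord_ge_res_diag/ord_ge_Fp.
split=> //.
- move=> t i j hij; rewrite /stepA; case h : (i == j.+1) => //.
  have [_ hb] := stepAP h; apply: cn_eq0; apply/eqP; rewrite eq_le cn_ge0 andbT.
  (* The low coefficients of the right side vanish at all times, and the bound with [G = 0] makes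
     the solution vanish too. *)
  have := hb 0 _ t; rewrite mulr0 /stepA h; apply=> s.
  have : ord_ge 2 (rhsA A B s).
    apply: ord_geB; first exact/ord_geN/ord_ge_Fq.
    by apply: ord_ge_leq (ord_geM (oG s) (ord_ge_grad (adm_ordA adm s))).
  by move=> /(_ i j hij) ->; rewrite cn0.
- move=> t i j hij; rewrite /stepB; case h : (j == i.+1) => //.
  have [_ hb] := stepBP h; apply: cn_eq0; apply/eqP; rewrite eq_le cn_ge0 andbT.
  have := hb 0 _ t; rewrite mulr0 /stepB h; apply=> s.
  have : ord_ge 2 (rhsB A B s).
    apply: ord_geB; first exact/ord_ge_Fp.
    by apply: ord_ge_leq (ord_geM (oG s) (ord_ge_grad (adm_ordB adm s))).
  by move=> /(_ i j hij) ->; rewrite cn0.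
- by move=> t j; rewrite /stepA eqxx.
- by move=> t j; rewrite /stepB eqxx.
Qed.

End Step.

(** Composition with [dP f] and [dQ f] gains one degree since these start in degree two; the
    products gain at least one from the orders of [g], [grad A] and [grad B]. *)
Lemma step_causal A B A' B' n : admissible A B -> admissible A' B' ->
  (forall t, ord_ge n (A t - A' t)) -> (forall t, ord_ge n (B t - B' t)) ->
  forall t, ord_ge n.+1 (stepA A B t - stepA A' B' t) /\
            ord_ge n.+1 (stepB A B t - stepB A' B' t).
Proof.
move=> h h' hA hB.
have gB (u v : ps2 Cx) : grad u - grad v = grad (u - v).
  by apply/ps2P => i j; rewrite !psB /grad !psB mulrBr.
have hDA s : ord_ge n (grad (A s) - grad (A' s)) by rewrite gB; apply: ord_ge_grad.
have hDB s : ord_ge n (grad (B s) - grad (B' s)) by rewrite gB; apply: ord_ge_grad.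
have hp s : ord_ge n (pser A B s - pser A' B' s).
  have -> : pser A B s - pser A' B' s = (A s - A' s) +
     res_P (grad (A s) * B s - grad (A' s) * B' s) by rewrite res_PB /pser; ring.
  apply: ord_geD => //; apply: ord_ge_res_P.
  have -> : grad (A s) * B s - grad (A' s) * B' s =
     (grad (A s) - grad (A' s)) * B s + grad (A' s) * (B s - B' s) by ring.
  apply: ord_geD.
    by apply: ord_ge_leq (ord_geM (hDA s) (adm_ordB h s)); rewrite addn2.
  by apply: ord_ge_leq (ord_geM (ord_ge_grad (adm_ordA h' s)) (hB s)); rewrite add2n.
have hq s : ord_ge n (qser B s - qser B' s).
  by have -> : qser B s - qser B' s = B s - B' s by [rewrite /qser; ring].
have hFp s : ord_ge n.+1 (Fp A B s - Fp A' B' s).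
  apply: comp_ord_geB => //; try exact: ord_ge_pser; try exact: ord_ge_qser h _.
    exact: ord_ge_qser h' _.
  exact/ord_ge_dP/f_ord.
have hFq s : ord_ge n.+1 (Fq A B s - Fq A' B' s).
  apply: comp_ord_geB => //; try exact: ord_ge_pser; try exact: ord_ge_qser h _.
    exact: ord_ge_qser h' _.
  exact/ord_ge_dQ/f_ord.
have hg s : ord_ge n (gser A B s - gser A' B' s).
  by rewrite -res_diagB; apply: ord_ge_res_diag.
have og s : ord_ge 1 (gser A' B' s) by apply/ord_ge_res_diag/(ord_ge_Fp h').
have hrA s : ord_ge n.+1 (rhsA A B s - rhsA A' B' s).
  have -> : rhsA A B s - rhsA A' B' s = - (Fq A B s - Fq A' B' s) -
     ((gser A B s - gser A' B' s) * grad (A s) + gser A' B' s * (grad (A s) - grad (A' s))).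
    rewrite /rhsA; move: (Fq A B s) (Fq A' B' s) (gser A B s) (gser A' B' s).
    by move: (grad (A s)) (grad (A' s)) => a1 a2 a3 a4 a5 a6; ring.
  apply: ord_geB; first exact: ord_geN; apply: ord_geD.
    by apply: ord_ge_leq (ord_geM (hg s) (ord_ge_grad (adm_ordA h s))); rewrite addn2.
  exact: (ord_geM (og s) (hDA s)).
have hrB s : ord_ge n.+1 (rhsB A B s - rhsB A' B' s).
  have -> : rhsB A B s - rhsB A' B' s = (Fp A B s - Fp A' B' s) -
     ((gser A B s - gser A' B' s) * grad (B s) + gser A' B' s * (grad (B s) - grad (B' s))).
    rewrite /rhsB; move: (Fp A B s) (Fp A' B' s) (gser A B s) (gser A' B' s).
    by move: (grad (B s)) (grad (B' s)) => a1 a2 a3 a4 a5 a6; ring.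
  apply: ord_geB; first exact: hFp; apply: ord_geD.
    by apply: ord_ge_leq (ord_geM (hg s) (ord_ge_grad (adm_ordB h s))); rewrite addn2.
  exact: (ord_geM (og s) (hDB s)).
move=> t; split=> i j hij; rewrite !psB /stepA /stepB; case: eqP => _; rewrite ?subr0 //.
  (* [sol] depends on the right side as a function of time, so equal right sides give the same
     solution. *)
  have -> : (fun s => rhsA A B s i j) = (fun s => rhsA A' B' s i j); last by rewrite subrr.
  by apply/funext => s; apply/eqP; rewrite -subr_eq0; have := hrA s i j hij; rewrite !psB => ->.
have -> : (fun s => rhsB A B s i j) = (fun s => rhsB A' B' s i j); last by rewrite subrr.
by apply/funext => s; apply/eqP; rewrite -subr_eq0; have := hrB s i j hij; rewrite !psB => ->.
Qed.

(** * The limit of the iterates and the equations that it satisfies *)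

Fixpoint iter_step n : (R -> ps2 Cx) * (R -> ps2 Cx) :=
  if n is m.+1 then (stepA (iter_step m).1 (iter_step m).2, stepB (iter_step m).1 (iter_step m).2)
  else (fun=> 0, fun=> 0).

Lemma grad0 : grad 0 = 0 :> ps2 Cx.
Proof. by apply/ps2P => i j; rewrite /grad mulr0. Qed.

Lemma iter_step_admissible n : admissible (iter_step n).1 (iter_step n).2.
Proof.
elim: n => [|n IH] /=; last exact: step_admissible.
have n0 : nb rho (fun _ : R => 0) kap.
  exists 0; last by move=> _ i j; rewrite !ps0 cn0.
  split=> // n; rewrite /dsum big1 ?kap_ge0 // => i _.
  by rewrite big1 // => j _; rewrite /tm !ps0 mul0r.
split=> //; try exact: ctS_cst.
  by have -> : (fun _ : R => grad 0) = (fun=> 0 : ps2 Cx) by apply/funext => t; rewrite grad0.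
by have -> : (fun _ : R => grad 0) = (fun=> 0 : ps2 Cx) by apply/funext => t; rewrite grad0.
Qed.

Lemma iter_step_cauchy n t : ord_ge n ((iter_step n.+1).1 t - (iter_step n).1 t) /\
  ord_ge n ((iter_step n.+1).2 t - (iter_step n).2 t).
Proof.
elim: n t => [|n IH] t; first by split.
apply: step_causal; try exact: (iter_step_admissible n.+1); try exact: iter_step_admissible.
  by move=> s; have [] := IH s.
by move=> s; have [] := IH s.
Qed.

Lemma iter_step_stable n m t i j : (i + j < n)%N -> (n <= m)%N ->
  (iter_step m).1 t i j = (iter_step n).1 t i j /\ (iter_step m).2 t i j = (iter_step n).2 t i j.
Proof.
move=> hij; elim: m => [|m IH]; first by rewrite leqn0 => /eqP <-.
rewrite leq_eqVlt => /predU1P [<- //|]; rewrite ltnS => hm.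
have [e1 e2] := IH hm; have [h1 h2] := iter_step_cauchy m t.
have hm' : (i + j < m)%N by apply: leq_trans hm.
split; apply/eqP.
  by rewrite -e1 -subr_eq0; have := h1 i j hm'; rewrite !psB => ->.
by rewrite -e2 -subr_eq0; have := h2 i j hm'; rewrite !psB => ->.
Qed.

Definition limA : R -> ps2 Cx := fun t i j => (iter_step (i + j).+1).1 t i j.
Definition limB : R -> ps2 Cx := fun t i j => (iter_step (i + j).+1).2 t i j.

Lemma limA_iter n t : ord_ge n (limA t - (iter_step n).1 t).
Proof.
move=> i j hij; rewrite !psB /limA.
by have [-> _] := iter_step_stable t (ltnSn (i + j)) hij; rewrite subrr.
Qed.
Lemma limB_iter n t : ord_ge n (limB t - (iter_step n).2 t).
Proof.
move=> i j hij; rewrite !psB /limB.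
by have [_ ->] := iter_step_stable t (ltnSn (i + j)) hij; rewrite subrr.
Qed.

(** A partial sum involves finitely many coefficients, all taken from one iterate. As the majorants
    vary with the iterate, the limit is majorized by its exact suprema over time, which lie below
    each of them on the coefficients concerned. *)
Lemma nb_limit (N : R) (u : nat -> R -> ps2 Cx) v : (forall n, nb rho (u n) N) ->
  (forall n t i j, (i + j < n)%N -> v t i j = u n t i j) -> nb rho v N.
Proof.
move=> hu huv.
have lub i j : exists l, is_lub (fun y => exists t, y = cn (v t i j)) l.
  have [U _ hU] := hu (i + j).+1.
  have [||l hl] := completeness (fun y => exists t, y = cn (v t i j)).
  - by exists (U i j) => y [t ->]; apply/RleP; rewrite (huv _ _ _ _ (ltnSn _)); apply: hU.
  - by exists (cn (v 0 i j)), 0.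
  - by exists l.
pose V : ps2 R := fun i j => projT1 (cid (lub i j)).
have hV1 t i j : cn (v t i j) <= V i j.
  by rewrite /V; case: cid => l [hl _] /=; apply/RleP; apply: hl; exists t.
have hV2 i j G : (forall t, cn (v t i j) <= G) -> V i j <= G.
  move=> hG; rewrite /V; case: cid => l [_ hl] /=; apply/RleP; apply: hl => y [t ->].
  exact/RleP.
have V0 : nonneg V by move=> i j; apply: le_trans (hV1 0 i j); apply: cn_ge0.
exists V => //; split=> // n; have [U [hU hU'] dU] := hu (n + n)%N.
apply: le_trans (hU' n); have r0 : 0 <= rho := ltW rho0.
apply: ler_dsum => // [i j hi hj|i j]; last exact: nonneg_tm.
rewrite /tm ler_wpM2r ?mulr_ge0 ?exprn_ge0 //; apply: hV2 => t.
rewrite (huv (n + n)%N) ?dU //; exact: (leq_ltn_trans (leq_add (leqnn i) (ltnW hj)) (leq_add hi (leqnn n))).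
Qed.

Lemma lim_admissible : admissible limA limB.
Proof.
have a := iter_step_admissible.
have eA n t i j : (i + j < n)%N -> limA t i j = (iter_step n).1 t i j.
  by move=> h; apply/eqP; rewrite -subr_eq0; have := limA_iter t h; rewrite !psB => ->.
have eB n t i j : (i + j < n)%N -> limB t i j = (iter_step n).2 t i j.
  by move=> h; apply/eqP; rewrite -subr_eq0; have := limB_iter t h; rewrite !psB => ->.
split.
- by move=> i j; apply: adm_ctA (a _) i j.
- by move=> i j; apply: adm_ctB (a _) i j.
- by move=> t i j h; apply: (adm_ordA (a _) t).
- by move=> t i j h; apply: (adm_ordB (a _) t).
- by move=> t j; apply: (adm_resA (a _) t).
- by move=> t i; apply: (adm_resB (a _) t).
- by apply: (@nb_limit _ (fun n => (iter_step n).1)) => // n; apply: adm_nbA (a n).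
- by apply: (@nb_limit _ (fun n => (iter_step n).2)) => // n; apply: adm_nbB (a n).
- apply: (@nb_limit _ (fun n t => grad ((iter_step n).1 t))) => [n|n t i j h].
    exact: adm_nbDA (a n).
  by rewrite /grad (eA n).
- apply: (@nb_limit _ (fun n t => grad ((iter_step n).2 t))) => [n|n t i j h].
    exact: adm_nbDB (a n).
  by rewrite /grad (eB n).
Qed.

(** Up to any given order both sides agree with the same iterate, by [step_causal] and by
    stabilization. *)
Lemma lim_fixed t : stepA limA limB t = limA t /\ stepB limA limB t = limB t.
Proof.
have main n := step_causal lim_admissible (iter_step_admissible n) (@limA_iter n) (@limB_iter n) t.
split; apply/ps2P => i j; apply/eqP; rewrite -subr_eq0; apply/eqP.
  have [h _] := main (i + j)%N; have h' := @limA_iter (i + j).+1 t.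
  have := ord_geB h h'; move=> /(_ i j (ltnSn _)); rewrite !psB /= => <-.
  by ring.
have [_ h] := main (i + j)%N; have h' := @limB_iter (i + j).+1 t.
have := ord_geB h h'; move=> /(_ i j (ltnSn _)); rewrite !psB /= => <-.
by ring.
Qed.

Definition Adot t : ps2 Cx := fun i j => if i == j.+1 then 0 else
  rhsA limA limB t i j - rC (om * (j%:R - i%:R + 1)) * limA t i j.
Definition Bdot t : ps2 Cx := fun i j => if j == i.+1 then 0 else
  rhsB limA limB t i j - rC (om * (j%:R - i%:R - 1)) * limB t i j.

Lemma derS_limA : derS limA Adot.
Proof.
move=> t i j; rewrite /Adot; case h : (i == j.+1).
  rewrite (eqP h); have -> : (fun s => limA s j.+1 j) = (fun=> 0); last exact: derC_cst.
  by apply/funext => s; apply: adm_resA lim_admissible s j.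
have [hd _] := stepAP lim_admissible h.
have e s : stepA limA limB s i j = limA s i j by have [-> _] := lim_fixed s.
have := hd t; rewrite e.
by have -> : (fun s => stepA limA limB s i j) = (fun s => limA s i j) by apply/funext.
Qed.
Lemma derS_limB : derS limB Bdot.
Proof.
move=> t i j; rewrite /Bdot; case h : (j == i.+1).
  rewrite (eqP h); have -> : (fun s => limB s i i.+1) = (fun=> 0); last exact: derC_cst.
  by apply/funext => s; apply: adm_resB lim_admissible s i.
have [hd _] := stepBP lim_admissible h.
have e s : stepB limA limB s i j = limB s i j by have [_ ->] := lim_fixed s.
have := hd t; rewrite e.
by have -> : (fun s => stepB limA limB s i j) = (fun s => limB s i j) by apply/funext.
Qed.

Definition psol := pser limA limB.
Definition qsol := qser limB.
Definition gsol := gser limA limB.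
Definition Fpsol := Fp limA limB.
Definition Fqsol := Fq limA limB.
Definition omC : ps2 Cx := cst (rC om).
Definition pdot t := Adot t + res_P (grad (Adot t) * limB t + grad (limA t) * Bdot t).

Lemma derS_qsol : derS qsol Bdot.
Proof.
have := derSD (derS_cst QQ) derS_limB.
by move=> h t i j; have := h t i j; rewrite psD psD add0r.
Qed.

Lemma derS_res_P u ud : derS u ud -> derS (fun t => res_P (u t)) (fun t => res_P (ud t)).
Proof.
move=> hu t i j; rewrite /res_P; case: eqP => _; last exact: derC_cst.
exact: hu.
Qed.

Lemma derS_psol : derS psol pdot.
Proof.
have h1 := derS_res_P (derSM (derS_grad derS_limA) derS_limB).
have := derSD (derSD (derS_cst PP) derS_limA) h1.
by move=> h t i j; have := h t i j; rewrite !psD add0r.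
Qed.

Lemma rC_shift (i j : nat) (s : R) (c : Cx) : rC s = c ->
  rC (om * (j%:R - i%:R + s)) = rC om * (j%:R - i%:R + c).
Proof. by move=> <-; rewrite rCM !rCD rCN !rC_natr. Qed.

Lemma gsol_offdiag t k l : k != l -> gsol t k l = 0.
Proof. by rewrite /gsol /gser /res_diag => /negbTE ->. Qed.

(** Off resonance this is the fixed point property. On the monomials [P^i Q^(i+1)] the linear terms
    cancel and what is left is the definition of [gser]. *)
Lemma qsol_equation t :
  Bdot t = omC * qsol t + Fpsol t - (omC + gsol t) * grad (qsol t).
Proof.
have -> : omC * qsol t + Fpsol t - (omC + gsol t) * grad (qsol t) =
  Fpsol t - gsol t * grad (limB t) - omC * (grad (limB t) - limB t) - gsol t * QQ.
  rewrite /qsol /qser gradD grad_QQ.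
  by move: (grad (limB t)) (limB t) (Fpsol t) (gsol t) omC => a b c d e; ring.
apply/ps2P => i j; rewrite !psB /omC cstM !psB /Bdot.
have gQ : (gsol t * QQ) i j = if j == i.+1 then gsol t i i else 0.
  rewrite mulrC QQM; case: j => [|j] //; rewrite eqSS.
  by have [->|ne] := eqVneq j i; rewrite // gsol_offdiag // eq_sym.
rewrite gQ; case: eqP => [->|_].
  rewrite (diag_mul_zero (@gsol_offdiag t)) ?subr0; last first.
    move=> k l hk hl h; have -> : l = k.+1 by clear -h; lia.
    by rewrite /grad (adm_resB lim_admissible) mulr0.
  rewrite /grad (adm_resB lim_admissible) !mulr0 subrr mulr0 subr0.
  by rewrite /gsol /gser /res_diag eqxx subrr.
rewrite /rhsB !psB subr0 (@rC_shift _ _ (-1) (-1)); last by rewrite rCN (rC_natr 1).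
rewrite -/(Fpsol t) -/(gsol t).
move: (Fpsol t i j) ((gsol t * grad (limB t) : ps2 Cx) i j) => a b.
by rewrite /grad; move: (rC om) => c; ring.
Qed.

Definition resid t := pdot t + (omC + gsol t) * grad (psol t) + omC * psol t + Fqsol t.

Lemma grad_psol t : grad (psol t) = - PP + grad (limA t) - res_P (grad (limA t) * limB t).
Proof. by rewrite /psol /pser !gradD grad_PP grad_res_P. Qed.

Lemma resid_offres t i j : i != j.+1 -> resid t i j = 0.
Proof.
move=> hij.
have -> : resid t = (Adot t + omC * (grad (limA t) + limA t) + gsol t * grad (limA t) + Fqsol t)
  + res_P (grad (Adot t) * limB t + grad (limA t) * Bdot t)
  - gsol t * (PP + res_P (grad (limA t) * limB t)).
  rewrite /resid grad_psol /pdot /psol /pser.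
  set w1 := res_P (grad (Adot t) * _ + _); set w2 := res_P _; set DA := grad (limA t).
  move: w1 w2 DA (Fqsol t) (gsol t) omC (limA t) (Adot t) PP.
  by move=> a b c d e a' b' c' d'; ring.
rewrite psB psB diag_mul_zero; [|exact: gsol_offdiag|]; last first.
  move=> k l _ _ h; rewrite !psD PPE /res_P.
  have ne : (k == l.+1) = false.
    by apply/negbTE; apply: contraNneq hij => e; rewrite e in h; apply/eqP; clear -h; lia.
  rewrite ne addr0; case: k l ne {h} => [|[|k]] [|l] //=.
rewrite !psD /omC cstM !psD {1}/res_P (negbTE hij) addr0 subr0 /Adot (negbTE hij).
rewrite /rhsA !psB !psN (@rC_shift _ _ 1 1); last exact: (rC_natr 1).
rewrite -/(Fqsol t) -/(gsol t).
move: (Fqsol t i j) ((gsol t * grad (limA t) : ps2 Cx) i j) => a b.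
by rewrite /grad; move: (rC om) => c; ring.
Qed.

(** A monomial [P^(j+1) Q^j] becomes diagonal only when multiplied by some [P^i Q^(i+1)], and [limB]
    contains none. *)
Lemma graded_mul_zero (u : ps2 Cx) t m : (forall i j, i != j.+1 -> u i j = 0) ->
  (u * limB t) m m = 0.
Proof.
move=> hu; rewrite ps2M big1 // => k _; rewrite big1 // => l _.
have hk := ltn_ord k; have hl := ltn_ord l.
have [e|ne] := eqVneq (k : nat) l.+1; last by rewrite hu ?mul0r.
have -> : (m - l = (m - k).+1)%N by clear -e hk hl; lia.
by rewrite (adm_resB lim_admissible) mulr0.
Qed.

Lemma cn_natmul_eq0 k (z : Cx) : k.+1%:R * z = 0 -> z = 0.
Proof.
move=> /(congr1 cn); rewrite cnM cn_natr cn0 => /eqP; rewrite mulf_eq0 pnatr_eq0 /=.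
by move=> /eqP /cn_eq0.
Qed.

Definition jac t := br (psol t) (qsol t).

(** This is where the form of [pser] pays: [Q] times [- res_P w] cancels the diagonal of
    [w = grad A * B], and the remaining [- P Q] gives the value 1. *)
Lemma jac_diag t k : jac t k k = (k == 0%N)%:R.
Proof.
rewrite /jac br_diag.
suff -> : (grad (psol t) * qsol t) k.+1 k.+1 = - (k == 0%N)%:R.
  by case: k => [|k] /=; rewrite ?mulrN1 ?opprK // oppr0 mulr0.
rewrite grad_psol /qsol /qser; set w := res_P _; set DA := grad (limA t).
have -> : (- PP + DA - w) * (QQ + limB t) =
  QQ * (DA - w) - PP * QQ + DA * limB t - (PP + w) * limB t by ring.
rewrite !psD !psN (@graded_mul_zero (PP + w)); last first.
  move=> i j h; rewrite !psD PPE /w /res_P (negbTE h) addr0.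
  by case: i j h => [|[|i]] [|j].
rewrite QQM PPM QQE !psB /w /DA {1}/grad (adm_resA lim_admissible) mulr0 /res_P eqxx subr0.
by rewrite eqSS andbb; move: ((_ * _ : ps2 Cx) _ _) (_%:R) => a b; ring.
Qed.

Definition jacdot t := br (pdot t) (qsol t) + br (psol t) (Bdot t).
Lemma derS_jac : derS jac jacdot.
Proof. exact: derS_br derS_psol derS_qsol. Qed.

Lemma br_anti (u v : ps2 Cx) : br u v = - br v u.
Proof. by rewrite /br; ring. Qed.
Lemma brDl (u v w : ps2 Cx) : br (u + v) w = br u w + br v w.
Proof. by rewrite /br dPD dQD; ring. Qed.
Lemma brDr (u v w : ps2 Cx) : br w (u + v) = br w u + br w v.
Proof. by rewrite /br dPD dQD; ring. Qed.
Lemma brNl (u v : ps2 Cx) : br (- u) v = - br u v.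
Proof. by rewrite /br dPN dQN; ring. Qed.
Lemma brNr (u v : ps2 Cx) : br u (- v) = - br u v.
Proof. by rewrite /br dPN dQN; ring. Qed.
Lemma br_cstl c (u v : ps2 Cx) : br (cst c * u) v = cst c * br u v.
Proof. by rewrite /br dPM dQM dP_cst dQ_cst; ring. Qed.
Lemma br_cstr c (u v : ps2 Cx) : br u (cst c * v) = cst c * br u v.
Proof. by rewrite /br dPM dQM dP_cst dQ_cst; ring. Qed.
Lemma brr (u : ps2 Cx) : br u u = 0.
Proof. by rewrite /br; ring. Qed.

Lemma grad_omC_gsol t : grad (omC + gsol t) = 0.
Proof.
rewrite gradD /gsol /gser grad_res_diag addr0 gradE /omC dP_cst dQ_cst.
by rewrite !mulr0 subrr.
Qed.

(** The linear terms [- c p] and [c q] contribute opposite multiples of the bracket, and [z * grad]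
    acts on it as a derivation. *)
Lemma bracket_transport c (z e p q F1 F2 : ps2 Cx) : grad z = 0 ->
  br (e - z * grad p - cst c * p - F1) q + br p (cst c * q + F2 - z * grad q) =
  br e q - z * grad (br p q) + (br p F2 - br F1 q).
Proof.
move=> hz; rewrite grad_br -(grad_br_scale _ _ hz).
rewrite !(brDl, brDr, brNl, brNr) br_cstl br_cstr; ring.
Qed.

(** The two contributions of the perturbation both equal its composed mixed derivative times [jac]
    and cancel, as for any Hamiltonian vector field. *)
Lemma jacdotE t : jacdot t = br (resid t) (qsol t) - (omC + gsol t) * grad (jac t).
Proof.
have op := ord_ge_pser lim_admissible t; have oq := ord_ge_qser lim_admissible t.
have hFq : br (Fqsol t) (qsol t) =
    comp (dP (dQ (f t))) (psol t) (qsol t) * jac t.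
  by rewrite /Fqsol /Fq br_compl // brr mulr0 addr0.
have hFp : br (psol t) (Fpsol t) =
    comp (dP (dQ (f t))) (psol t) (qsol t) * jac t.
  rewrite br_anti /Fpsol /Fp br_compl // brr mulr0 add0r dPdQ /jac.
  by rewrite [br (qser _ _) _]br_anti mulrN opprK.
have hp : pdot t = resid t - (omC + gsol t) * grad (psol t) - omC * psol t - Fqsol t.
  rewrite /resid; move: (pdot t) (omC + gsol t) (grad (psol t)) (omC * psol t) (Fqsol t).
  by move=> a b c d e; ring.
rewrite /jacdot qsol_equation hp (bracket_transport _ _ _ _ _ _ (grad_omC_gsol t)) hFq hFp.
by rewrite subrr addr0.
Qed.

Lemma resid0 t : resid t = 0.
Proof.
have dz k : jacdot t k k = 0.
  have h := derS_jac t k k; apply: (derC_uniq h).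
  have -> : (fun s => jac s k k) = (fun=> (k == 0%N)%:R) by apply/funext => s; apply: jac_diag.
  exact: derC_cst.
have key k : (br (resid t) (qsol t)) k k = 0.
  have := dz k; rewrite jacdotE psB psB mulrDl !psD /omC cstM /grad.
  rewrite subrr mul0r mulr0 add0r diag_mul_zero ?subr0 //; first exact: gsol_offdiag.
  move=> i j _ _ h.
  have -> : i = j by clear -h; lia.
  by rewrite subrr mul0r.
apply/ps2P => i j; rewrite !ps0.
have [->|] := eqVneq i j.+1; last exact: resid_offres.
(* Only the term [Q] of [q] meets the resonant defect on the diagonal, which leaves
   [- resid t j.+1 j]. *)
have := key j; rewrite br_diag mulNr => /eqP; rewrite oppr_eq0 => /eqP /cn_natmul_eq0.
have hres a b : a != b.+1 -> grad (resid t) a b = 0.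
  by move=> h; rewrite /grad resid_offres ?mulr0.
rewrite /qsol /qser mulrDr psD psD graded_mul_zero // addr0 mulrC QQM /grad.
rewrite -[j.+1]addn1 natrD opprD addrA subrr add0r mulN1r addn1 => /eqP.
by rewrite oppr_eq0 => /eqP.
Qed.

Lemma psol_equation t :
  pdot t = - (omC + gsol t) * grad (psol t) - omC * psol t - Fqsol t.
Proof.
have := resid0 t; rewrite /resid; move: (pdot t) (omC + gsol t) (grad (psol t)) (omC * psol t) (Fqsol t).
move=> a b c d e h; apply/eqP; rewrite -subr_eq0 -[X in _ == X]h; apply/eqP; ring.
Qed.

Lemma nb_psol : nb rho psol (2 * rho). Proof. exact: nb_pser lim_admissible. Qed.
Lemma nb_qsol : nb rho qsol (2 * rho). Proof. exact: nb_qser lim_admissible. Qed.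

Lemma jac_bounded i j : exists G, forall t, cn (jac t i j) <= G.
Proof.
have h0 : 0 <= rho / 2 by rewrite divr_ge0 // ltW.
have h1 : rho / 2 < rho by have := rho0; lra.
have hj := nbB (nbM h0 (nb_dP h0 h1 nb_psol) (nb_dQ h0 h1 nb_qsol))
  (nbM h0 (nb_dQ h0 h1 nb_psol) (nb_dP h0 h1 nb_qsol)).
by case: hj => U _ hU; exists (U i j) => t; apply: hU.
Qed.

Lemma br0l (u : ps2 Cx) : br 0 u = 0.
Proof. by apply: (addrI (br 0 u)); rewrite -brDl !addr0. Qed.

Lemma gsol_ord t : ord_ge 1 (gsol t).
Proof. exact/ord_ge_res_diag/(ord_ge_Fp lim_admissible). Qed.

(** The induction is on the degree: [g] has no constant term, so [g * grad jac] involves only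
    off-diagonal coefficients of lower degree. What remains is a homogeneous scalar equation with
    multiplier [om * (j - i)]. *)
Lemma jac_offdiag n i j t : (i + j < n)%N -> i != j -> jac t i j = 0.
Proof.
elim: n i j t => [//|n IH] i j t hij ne; have [G hG] := jac_bounded i j.
have hl : om * (j%:R - i%:R) != 0.
  apply: mulf_neq0; first by rewrite gt_eqF.
  by rewrite subr_eq0 eqr_nat eq_sym.
apply: (homogeneous_zero (c := fun s => jac s i j) hl _ hG) => s.
have := derS_jac s i j; congr derC.
rewrite jacdotE resid0 br0l add0r psN psN mulrDl !psD /omC cstM.
have -> : (gsol s * grad (jac s)) i j = 0.
  rewrite ps2M big1 // => k _; rewrite big1 // => l _.
  have hk := ltn_ord k; have hl' := ltn_ord l.
  have [e|n'] := eqVneq (k : nat) l; last by rewrite gsol_offdiag ?mul0r.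
  have [k0|k0] := eqVneq (k : nat) 0%N.
    by rewrite -e k0 (gsol_ord s) ?mul0r.
  rewrite /grad IH ?mulr0 //; first by clear -e k0 hk hl' hij; lia.
  by apply: contraNneq ne => h; apply/eqP; clear -h e hk hl'; lia.
by rewrite addr0 /grad mulrA rCM rCD rCN !rC_natr.
Qed.

Lemma jac1 t : jac t = 1.
Proof.
apply/ps2P => i j; have [->|ne] := eqVneq i j.
  by rewrite jac_diag !ps1; case: j.
rewrite (jac_offdiag (n := (i + j).+1)) // !ps1.
by case: i j ne => [|i] [|j].
Qed.

End NormalForm.

(** * The momentum component and the normal form *)

Section Transformation.
Variables (om rho phi Rr M : R) (f : R -> ps2 Cx).
Hypotheses (om0 : 0 < om) (rho0 : 0 < rho).
Hypotheses (f_ct : ctS f) (f_ord : forall t, ord_ge 3 (f t)).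
Hypotheses (fP : nb (2 * rho) (fun t => dP (f t)) phi).
Hypotheses (fQ : nb (2 * rho) (fun t => dQ (f t)) phi).
Hypothesis phi_small : 16 * phi <= om * rho.
Hypotheses (f_nb : nb Rr f M) (rho_small : 2 * rho <= Rr).

Let p := psol om f.
Let q := qsol om f.
Let g := gsol om f.
Let z t : ps2 Cx := omC om + g t.

Let rho_ge0 : 0 <= rho. Proof. exact: ltW. Qed.
Let nb_p : nb rho p (2 * rho). Proof. exact: (nb_psol om0 rho0 f_ct f_ord fP fQ phi_small). Qed.
Let nb_q : nb rho q (2 * rho). Proof. exact: (nb_qsol om0 rho0 f_ct f_ord fP fQ phi_small). Qed.
Let adm := lim_admissible om0 rho0 f_ct f_ord fP fQ phi_small.
Let nb_g : nb rho g (phi / rho). Proof. exact: (nb_gser om0 rho0 fP phi_small adm). Qed.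
Let ord_p t : ord_ge 1 (p t). Proof. exact: (ord_ge_pser adm t). Qed.
Let ord_q t : ord_ge 1 (q t). Proof. exact: (ord_ge_qser adm t). Qed.

Lemma nb_cst (T : Type) (r : R) c : 0 <= r -> nb r (fun _ : T => cst c) (cn c).
Proof.
move=> hr; have h1 : nb r (fun _ : T => 1) 1.
  by exists 1; [exact: bd1 | move=> _; exact: dom1].
have := nb_coef (k := cn c) (cn_ge0 c) _ h1; rewrite mulr1; apply=> i j G hG t.
by rewrite -[cst c]mulr1 cstM cnM ler_wpM2l ?cn_ge0 //; apply: (hG t).
Qed.

Lemma nb_sub (T : Type) (r s N : R) (u : T -> ps2 Cx) : 0 <= r -> r <= s -> 0 < s ->
  nb s u N -> nb r u N.
Proof.
move=> hr hrs hs hu; have := nb_ord_ge (m := 0) hr hrs hs _ hu.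
by rewrite expr0 mul1r; apply.
Qed.

(** This is the primitive of [a = omega + g] in [x = P Q], as a series in [P] and [Q]; at [i = 0]
    the junk inverse meets a zero coefficient. [Jline] is the same primitive in [x] itself, kept as
    a two-variable series so that the evaluation lemmas apply. *)
Definition Jdiag t : ps2 Cx := fun i j => rC (i%:R^-1) * (PP * (QQ * z t) : ps2 Cx) i j.
Definition Jline t : ps2 Cx := fun i j => if j == 0%N then Jdiag t i i else 0.
(** It is what must be added to [E] for the transformed Hamiltonian to be [J + E]; that this shift
    is compatible with canonicity is the content of [energy_dP] and [energy_dQ]. *)
Definition energy t : ps2 Cx := Jdiag t - omC om * (p t * q t) - comp (f t) (p t) (q t).

Lemma z_offdiag t i j : i != j -> z t i j = 0.
Proof.
move=> h; rewrite /z !psD /g gsol_offdiag // addr0 /omC -[cst _]mulr1 cstM !ps1.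
by case: i j h => [|i] [|j] //=; rewrite mulr0.
Qed.

Lemma Jdiag_offdiag t i j : i != j -> Jdiag t i j = 0.
Proof.
rewrite /Jdiag PPM; case: i => [|i] h; first by rewrite mulr0.
rewrite QQM; case: j h => [|j] h; first by rewrite mulr0.
by rewrite z_offdiag ?mulr0.
Qed.

Lemma rC_invMn (n : nat) (c : Cx) : rC (n.+1%:R^-1) * c *+ n.+1 = c.
Proof.
have h : rC (n.+1%:R^-1) * n.+1%:R = 1 by rewrite -rC_natr -rCM mulVf ?pnatr_eq0 // (rC_natr 1).
by rewrite -mulrnAr -[c *+ _]mulr_natl mulrA h mul1r.
Qed.

Lemma dP_Jdiag t : dP (Jdiag t) = QQ * z t.
Proof.
by apply/ps2P => i j; rewrite dPE /Jdiag PPM rC_invMn.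
Qed.

Lemma dQ_Jdiag t : dQ (Jdiag t) = PP * z t.
Proof.
apply/ps2P => i j; rewrite dQE /Jdiag !PPM; case: i => [|i]; first by rewrite mulr0 mul0rn.
rewrite QQM; have [->|ne] := eqVneq i j; last by rewrite z_offdiag // mulr0 mul0rn.
by rewrite rC_invMn.
Qed.

Lemma nb_z : nb rho z (om + phi / rho).
Proof.
apply: nbD nb_g; have := nb_cst R (rC om) rho_ge0.
by rewrite cn_rC gtr0_norm.
Qed.

Definition normJ := rho * (rho * (om + phi / rho)).

Lemma nb_Jdiag : nb rho Jdiag normJ.
Proof.
have h := nbM rho_ge0 (nb_PP rho0 R) (nbM rho_ge0 (nb_QQ rho0 R) nb_z).
rewrite /normJ -[X in nb _ _ X]mul1r; apply: nb_coef h => // i j G hG t.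
rewrite mul1r; apply: le_trans (hG t); rewrite /Jdiag cnM cn_rC -[leRHS]mul1r.
rewrite ler_wpM2r ?cn_ge0 // ger0_norm ?invr_ge0 //.
by case: i {hG} => [|i]; rewrite ?invr0 // invf_le1 ?ltr0n // ler1n.
Qed.

Lemma sum_first_column (V : nmodType) n (x : nat -> nat -> V) :
  (forall i j, j != 0%N -> x i j = 0) -> dsum n x = \sum_(i < n) x i 0%N.
Proof.
move=> hx; case: n => [|n]; first by rewrite /dsum !big_ord0.
apply: eq_bigr => i _; rewrite big_ord_recl big1 ?addr0 // => j _.
by rewrite hx.
Qed.

Lemma sum_diagonal (V : nmodType) n (x : nat -> nat -> V) :
  (forall i j, i != j -> x i j = 0) -> dsum n x = \sum_(i < n) x i i.
Proof.
move=> hx; apply: eq_bigr => i _; rewrite (bigD1 i) //= big1 ?addr0 // => j hj.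
by rewrite hx // eq_sym.
Qed.

Lemma nb_Jline : nb (rho ^+ 2) Jline normJ.
Proof.
have [U [hU hU'] dU] := nb_Jdiag.
exists (fun i j => if j == 0%N then U i i else 0); last first.
  by move=> t i j; rewrite /Jline; case: ifP => _; [apply: dU | rewrite cn0].
split=> [i j|n]; first by case: ifP.
apply: le_trans (hU' n); rewrite sum_first_column; last first.
  by move=> i j /negbTE h; rewrite /tm h mul0r.
apply: ler_sum => i _; rewrite (bigD1 i) //= -[leLHS]addr0; apply: lerD.
  by rewrite /tm /= expr0 mulr1 -exprM mul2n -addnn exprD.
by apply: sumr_ge0 => j _; apply: nonneg_tm.
Qed.

Lemma ev_Jline t x y : cn x <= rho -> cn y <= rho -> ev (Jline t) (x * y) 0 = ev (Jdiag t) x y.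
Proof.
move=> hx hy; apply: has_dsum_ev.
have h := ev_has_dsum hx hy (nb_at t nb_Jdiag).
move=> e he; have [N hN] := h e he; exists N => n /hN.
rewrite sum_diagonal; last by move=> i j ne; rewrite /tm Jdiag_offdiag ?mul0r.
rewrite sum_first_column; last by move=> i j /negbTE ne; rewrite /tm /Jline ne mul0r.
congr (cn (_ - _) <= _); apply: eq_bigr => i _.
by rewrite /tm /Jline eqxx expr0 mulr1 exprMn.
Qed.

Definition normE := normJ + om * (2 * rho * (2 * rho)) + M.

Lemma nb_comp_sol : nb rho (fun t => comp (f t) (p t) (q t)) M.
Proof. exact: (nb_comp rho_ge0 f_nb nb_p nb_q rho_small rho_small). Qed.

Lemma nb_om_pq : nb rho (fun t => omC om * (p t * q t)) (om * (2 * rho * (2 * rho))).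
Proof.
have h := nb_cst R (rC om) rho_ge0; rewrite cn_rC (gtr0_norm om0) in h.
exact: (nbM rho_ge0 h (nbM rho_ge0 nb_p nb_q)).
Qed.

Lemma nb_energy : nb rho energy normE.
Proof. exact: nbB (nbB nb_Jdiag nb_om_pq) nb_comp_sol. Qed.

Lemma ord_energy t : ord_ge 1 (energy t).
Proof.
apply: ord_geB; first apply: ord_geB.
- by case=> [|i] [|j] // _; rewrite /Jdiag PPM mulr0.
- by apply: ord_geMl; apply: ord_geMl.
- by apply: comp_ord_ge => //; apply: ord_ge_leq (f_ord t).
Qed.

Lemma jac_sol t : dP (p t) * dQ (q t) - dQ (p t) * dP (q t) = 1.
Proof. exact: (jac1 om0 rho0 f_ct f_ord fP fQ phi_small t). Qed.

Let pd := pdot om f.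
Let qd := Bdot om f.

Lemma pd_equation t : pd t = - z t * grad (p t) - omC om * p t - comp (dQ (f t)) (p t) (q t).
Proof. exact: (psol_equation om0 rho0 f_ct f_ord fP fQ phi_small t). Qed.
Lemma qd_equation t : qd t = omC om * q t + comp (dP (f t)) (p t) (q t) - z t * grad (q t).
Proof. exact: (qsol_equation om0 rho0 f_ct f_ord fP fQ phi_small t). Qed.

Lemma dP_hamiltonian c (a u v w : ps2 Cx) :
  dP (a - cst c * (u * v) - w) = dP a - cst c * (dP u * v + u * dP v) - dP w.
Proof. by rewrite !(dPD, dPN, dPM) dP_cst mul0r add0r. Qed.
Lemma dQ_hamiltonian c (a u v w : ps2 Cx) :
  dQ (a - cst c * (u * v) - w) = dQ a - cst c * (dQ u * v + u * dQ v) - dQ w.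
Proof. by rewrite !(dQD, dQN, dQM) dQ_cst mul0r add0r. Qed.

(** This is the coefficient of dP and dt in the pulled back two-form. Inserting both evolution
    equations leaves [Q z (1 - {p, q})]. *)
Lemma energy_dP t : dP (p t) * qd t - pd t * dP (q t) + dP (energy t) = 0.
Proof.
have -> : dP (energy t) = QQ * z t - omC om * (dP (p t) * q t + p t * dP (q t)) -
   (comp (dP (f t)) (p t) (q t) * dP (p t) + comp (dQ (f t)) (p t) (q t) * dP (q t)).
  rewrite /energy /omC dP_hamiltonian dP_Jdiag.
  by rewrite (comp_derivation (ord_p t) (ord_q t) (f t) (@dPD _) (@dPM _) (@dP_cst _) (@ord_ge_dP _)).
rewrite pd_equation qd_equation !gradE.
have := jac_sol t.
move: (comp (dP (f t)) _ _) (comp (dQ (f t)) _ _) (omC om) (z t) => F1 F2 o w.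
move: (p t) (q t) => p' q'; move: (dP p') (dQ p') (dP q') (dQ q') => pP pQ qP qQ hj.
have -> : pP * (o * q' + F1 - w * (QQ * qQ - PP * qP)) - (- w * (QQ * pQ - PP * pP) - o * p' - F2) * qP
  + (QQ * w - o * (pP * q' + p' * qP) - (F1 * pP + F2 * qP)) = QQ * w * (1 - (pP * qQ - pQ * qP)).
  by ring.
by rewrite hj subrr mulr0.
Qed.

Lemma energy_dQ t : dQ (p t) * qd t - pd t * dQ (q t) + dQ (energy t) = 0.
Proof.
have -> : dQ (energy t) = PP * z t - omC om * (dQ (p t) * q t + p t * dQ (q t)) -
   (comp (dP (f t)) (p t) (q t) * dQ (p t) + comp (dQ (f t)) (p t) (q t) * dQ (q t)).
  rewrite /energy /omC dQ_hamiltonian dQ_Jdiag.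
  by rewrite (comp_derivation (ord_p t) (ord_q t) (f t) (@dQD _) (@dQM _) (@dQ_cst _) (@ord_ge_dQ _)).
rewrite pd_equation qd_equation !gradE.
have := jac_sol t.
move: (comp (dP (f t)) _ _) (comp (dQ (f t)) _ _) (omC om) (z t) => F1 F2 o w.
move: (p t) (q t) => p' q'; move: (dP p') (dQ p') (dP q') (dQ q') => pP pQ qP qQ hj.
have -> : pQ * (o * q' + F1 - w * (QQ * qQ - PP * qP)) - (- w * (QQ * pQ - PP * pP) - o * p' - F2) * qQ
  + (PP * w - o * (pQ * q' + p' * qQ) - (F1 * pQ + F2 * qQ)) = PP * w * (1 - (pP * qQ - pQ * qP)).
  by ring.
by rewrite hj subrr mulr0.
Qed.

Let half_ge0 : 0 <= rho / 2. Proof. by rewrite divr_ge0. Qed.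
Let half_lt : rho / 2 < rho. Proof. have := rho0; lra. Qed.

Lemma nb_grad_half (N : R) (u : R -> ps2 Cx) : nb rho u N ->
  nb (rho / 2) (fun t => grad (u t)) (rho / 2 * (N / (rho - rho / 2)) + rho / 2 * (N / (rho - rho / 2))).
Proof.
move=> hu; have r0 : 0 < rho / 2 by rewrite divr_gt0.
have -> : (fun t => grad (u t)) = (fun t => QQ * dQ (u t) - PP * dP (u t)).
  by apply/funext => t; rewrite gradE.
apply: nbB; apply: nbM => //; [exact: nb_QQ | exact: nb_dQ | exact: nb_PP | exact: nb_dP].
Qed.

Lemma nb_pd : exists N, nb (rho / 2) pd N.
Proof.
have s (N : R) u := @nb_sub R _ _ N u half_ge0 (ltW half_lt) rho0.
eexists; have -> : pd = (fun t => - z t * grad (p t) - omC om * p t - comp (dQ (f t)) (p t) (q t)).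
  by apply/funext => t; apply: pd_equation.
apply: nbB; first apply: nbB.
- by apply: nbM => //; [apply/nbN/s/nb_z | exact: nb_grad_half nb_p].
- by apply: nbM => //; [apply: nb_cst | apply/s/nb_p].
- by apply: s; apply: (nb_comp rho_ge0 fQ nb_p nb_q).
Qed.

Lemma nb_qd : exists N, nb (rho / 2) qd N.
Proof.
have s (N : R) u := @nb_sub R _ _ N u half_ge0 (ltW half_lt) rho0.
eexists; have -> : qd = (fun t => omC om * q t + comp (dP (f t)) (p t) (q t) - z t * grad (q t)).
  by apply/funext => t; apply: qd_equation.
apply: nbB; first apply: nbD.
- by apply: nbM => //; [apply: nb_cst | apply/s/nb_q].
- by apply: s; apply: (nb_comp rho_ge0 fP nb_p nb_q).
- by apply: nbM => //; [apply/s/nb_z | exact: nb_grad_half nb_q].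
Qed.

Lemma derS_p : derS p pd. Proof. exact: (derS_psol om0 rho0 f_ct f_ord fP fQ phi_small). Qed.
Lemma derS_q : derS q qd. Proof. exact: (derS_qsol om0 rho0 f_ct f_ord fP fQ phi_small). Qed.

Section Values.
Variables (x y : Cx) (t : R).
Hypotheses (hx : cn x <= rho / 2) (hy : cn y <= rho / 2).

Let hx' : cn x < rho. Proof. exact: le_lt_trans hx half_lt. Qed.
Let hy' : cn y < rho. Proof. exact: le_lt_trans hy half_lt. Qed.

Lemma ev_jac : ev (dP (p t)) x y * ev (dQ (q t)) x y - ev (dQ (p t)) x y * ev (dP (q t)) x y = 1.
Proof.
have a1 := nb_at t (nb_dP half_ge0 half_lt nb_p); have a2 := nb_at t (nb_dQ half_ge0 half_lt nb_p).
have a3 := nb_at t (nb_dP half_ge0 half_lt nb_q); have a4 := nb_at t (nb_dQ half_ge0 half_lt nb_q).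
rewrite -(evM hx hy a1 a4) -(evM hx hy a2 a3).
by rewrite -(evB hx hy (nbM half_ge0 a1 a4) (nbM half_ge0 a2 a3)) jac_sol ev1.
Qed.

Lemma ev_energy_dP : ev (dP (p t)) x y * ev (qd t) x y - ev (pd t) x y * ev (dP (q t)) x y +
  ev (dP (energy t)) x y = 0.
Proof.
have [N1 /(nb_at t) b1] := nb_pd; have [N2 /(nb_at t) b2] := nb_qd.
have a1 := nb_at t (nb_dP half_ge0 half_lt nb_p).
have a3 := nb_at t (nb_dP half_ge0 half_lt nb_q).
have a5 := nb_at t (nb_dP half_ge0 half_lt nb_energy).
rewrite -(evM hx hy a1 b2) -(evM hx hy b1 a3).
rewrite -(evB hx hy (nbM half_ge0 a1 b2) (nbM half_ge0 b1 a3)).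
by rewrite -(evD hx hy (nbB (nbM half_ge0 a1 b2) (nbM half_ge0 b1 a3)) a5) energy_dP ev0.
Qed.

Lemma ev_energy_dQ : ev (dQ (p t)) x y * ev (qd t) x y - ev (pd t) x y * ev (dQ (q t)) x y +
  ev (dQ (energy t)) x y = 0.
Proof.
have [N1 /(nb_at t) b1] := nb_pd; have [N2 /(nb_at t) b2] := nb_qd.
have a1 := nb_at t (nb_dQ half_ge0 half_lt nb_p).
have a3 := nb_at t (nb_dQ half_ge0 half_lt nb_q).
have a5 := nb_at t (nb_dQ half_ge0 half_lt nb_energy).
rewrite -(evM hx hy a1 b2) -(evM hx hy b1 a3).
rewrite -(evB hx hy (nbM half_ge0 a1 b2) (nbM half_ge0 b1 a3)).
by rewrite -(evD hx hy (nbB (nbM half_ge0 a1 b2) (nbM half_ge0 b1 a3)) a5) energy_dQ ev0.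
Qed.

Lemma ev_energy : rC om * (ev (p t) x y * ev (q t) x y) +
  (ev (energy t) x y + ev (f t) (ev (p t) x y) (ev (q t) x y)) = ev (Jline t) (x * y) 0.
Proof.
have hx1 := ltW hx'; have hy1 := ltW hy'.
have a1 := nb_at t nb_p; have a2 := nb_at t nb_q; have a3 := nb_at t nb_Jdiag.
have a4 := nb_at t nb_om_pq; have a5 := nb_at t nb_comp_sol.
rewrite ev_Jline // /energy (evB hx1 hy1 (nbB a3 a4) a5) (evB hx1 hy1 a3 a4).
rewrite /omC (evZ hx1 hy1 _ (nbM rho_ge0 a1 a2)) (evM hx1 hy1 a1 a2).
rewrite (ev_comp hx1 hy1 (nb_at t f_nb) a1 a2 rho_small rho_small (ord_p t) (ord_q t)).
by ring.
Qed.

End Values.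

Lemma ev_small (u : R -> ps2 Cx) (N s : R) t x y : 0 < s -> s <= rho -> (forall t, ord_ge 1 (u t)) ->
  nb rho u N -> cn x <= s -> cn y <= s -> cn (ev (u t) x y) <= s / rho * N.
Proof.
move=> hs hsr ho hu hx hy; have := nb_ord_ge (ltW hs) hsr rho0 ho hu.
by rewrite expr1 => /(nb_at t) /(ev_le hx hy).
Qed.

Lemma ev_origin u : ev u 0 0 = u 0%N 0%N.
Proof.
apply: has_dsum_ev => e he; exists 1%N => -[//|n] _.
rewrite sum_diagonal => [|i j]; last first.
  by case: i j => [|i] [|j] //; rewrite /tm !expr0n /= ?(mul0r, mulr0).
rewrite big_ord_recl big1 ?addr0 => [|i _]; last by rewrite /tm lift0 expr0n mul0r mulr0.
by rewrite /tm !expr0 !mulr1 subrr cn0 ltW.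
Qed.

Lemma Jline0 t : ev (Jline t) 0 0 = 0.
Proof. by rewrite ev_origin /Jline eqxx /Jdiag PPM mulr0. Qed.

Lemma dP_Jline0 t : ev (dP (Jline t)) 0 0 = rC om.
Proof.
have g0 : g t 0%N 0%N = 0 by exact: (gsol_ord om0 rho0 f_ct f_ord fP fQ phi_small).
rewrite ev_origin dPE mulr1n /Jline eqxx /Jdiag PPM QQM invr1 /z !psD g0 addr0.
by rewrite (rC_natr 1) mul1r.
Qed.

End Transformation.

(** * The perturbation as a series *)

(** A difference quotient within 1 of the derivative bounds the increment by [k * |t - t0|];
    composing with [Rabs] keeps all arguments on the half-line where the derivative is given. *)
Lemma C1_Rplus_continuity (h : R -> R) : C1_Rplus h -> continuity (fun t => h (Rabs t)).
Proof.
move=> [h' [hd _]] t0 eps /RltP he.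
have ht : 0 <= `|t0| by [].
have /RleP ht' : 0 <= Rabs t0 by rewrite RabsE.
have /RltP one : 0 < 1 :> R by [].
have [dl [/RltP hdl hdl']] := hd _ ht' _ one.
pose k := `|h' (Rabs t0)| + 1.
have hk : 0 < k by have := normr_ge0 (h' (Rabs t0)); rewrite /k; lra.
exists (Num.min dl (eps / k)); split.
  by apply/RltP; rewrite lt_min hdl divr_gt0.
move=> t [_ /RltP]; rewrite /= RdistE lt_min => /andP [l1 l2].
apply/RltP; rewrite RdistE.
have l0 : `| `|t| - `|t0| | <= `|t - t0| by apply: ler_dist_dist.
(* The increment of the absolute value can vanish for distinct times, and then there is no quotient
   to use. *)
have [e|ne] := eqVneq (`|t| - `|t0|) 0.
  by have -> : Rabs t = Rabs t0 by [rewrite !RabsE; lra]; rewrite subrr normr0.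
have e1 : Rabs t = Rplus (Rabs t0) (`|t| - `|t0|) by rewrite !RabsE RplusE; ring.
have := hdl' (`|t| - `|t0|) (elimN eqP ne).
rewrite -e1 !RabsE => hh.
have /RltP : Rlt `| Rminus (Rdiv (Rminus (h `|t|) (h `|t0|)) (`|t| - `|t0|)) (h' `|t0|) | 1.
  rewrite -RabsE; apply: hh; first by apply/RltP; exact: (le_lt_trans l0 l1).
  by apply/RleP; exact: normr_ge0.
rewrite !(RminusE, RdivE).
set u := h `|t| - h `|t0|; set v := `|t| - `|t0| in l0 ne *.
move=> hlt; have hv : `|u / v| <= k.
  have {1}-> : u / v = (u / v - h' `|t0|) + h' `|t0| by ring.
  by apply: le_trans (ler_normD _ _) _; rewrite /k RabsE; lra.
have -> : u = u / v * v by rewrite divfK.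
rewrite normrM; apply: (@le_lt_trans _ _ (k * `|v|)); first by rewrite ler_wpM2r.
by rewrite mulrC -ltr_pdivlMr //; apply: le_lt_trans l0 l2.
Qed.

Lemma sum_triangle_mask (V : nmodType) (F : nat -> nat -> V) m :
  \sum_(i < m) \sum_(k < i.+1) F k (i - k)%N =
  dsum m (fun k l => if (k + l < m)%N then F k l else 0).
Proof.
rewrite sum_triangle; apply: eq_bigr => k _.
rewrite (big_ord_widen m (fun l => F k l)) ?leq_subr // big_mkcond.
by apply: eq_bigr => l _; rewrite ltn_subRL.
Qed.

Section Perturbation.
Variables (Rr : R) (F : Cx -> Cx -> R -> Cx) (f : nat -> nat -> R -> Cx).
Hypotheses (HR : 0 < Rr) (HF : admissible_perturbation Rr F f) (HMF : taylor_norm_finite f Rr).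

(* The even extension to negative times makes the bounded solutions of the linear
   equations unique. *)
Definition fser (t : R) : ps2 Cx := fun a b => f a b `|t|.

Lemma ctS_fser : ctS fser.
Proof.
have [_ [_ [_ [_ [_ hc]]]]] := HF.
move=> a b; have [h1 h2] := hc a b.
have := C1_Rplus_continuity h1; have := C1_Rplus_continuity h2; rewrite /ctC /fser.
have -> : (fun t => Cim (f a b `|t|)) = (fun t => Cim (f a b (Rabs t))).
  by apply/funext => t; rewrite RabsE.
have -> : (fun t => Cre (f a b `|t|)) = (fun t => Cre (f a b (Rabs t))).
  by apply/funext => t; rewrite RabsE.
by split.
Qed.

Lemma ord_ge_fser t : ord_ge 3 (fser t).
Proof.
have [_ [_ [_ [_ [h0 _]]]]] := HF.
by move=> a b hab; apply: h0; apply/ssrnat.leP; rewrite -ltnS.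
Qed.

(** The hypothesis sums by degree, over triangles, while [bd] sums over squares; a square of side
    [n] lies in the triangle of degree [n + n]. The added 1 provides a positive constant for
    [radius_exists] to divide by. *)
Lemma fser_norm : exists2 M, nb Rr fser M & 0 < M.
Proof.
have [c [hc [L hL]]] := HMF.
have cub a b t : 0 <= t -> cn (f a b t) <= c a b.
  by move=> ht; have [h _] := hc a b; apply/RleP; apply: h; exists t; split=> //; apply/RleP.
have c0 : nonneg c by move=> a b; apply: le_trans (cub a b 0 (lexx _)); apply: cn_ge0.
have r0 : 0 <= Rr := ltW HR.
pose s N := \sum_(n < N.+1) \sum_(a < n.+1) tm c Rr Rr a (n - a)%N.
have sE N : sum_f_R0 (fun n => Rmult (sum_f_R0 (fun a => c a (Nat.sub n a)) n) (pow Rr n)) N = s N.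
  rewrite sum_f_R0E big_mkord; apply: eq_bigr => n _.
  rewrite sum_f_R0E big_mkord RmultE RpowE mulr_suml; apply: eq_bigr => a _.
  by rewrite /tm -exprD subnKC // -ltnS.
have term0 n : 0 <= \sum_(a < n.+1) tm c Rr Rr a (n - a)%N.
  by apply: sumr_ge0 => a _; apply: nonneg_tm.
have sL N : s N <= L.
  have gr : Un_growing s by move=> n; apply/RleP; rewrite /s [leRHS]big_ord_recr lerDl.
  apply/RleP; apply: (growing_ineq s L gr).
  by move=> e he; have [N0 h0] := hL e he; exists N0 => n hn; rewrite -sE; apply: h0.
have hM n : dsum n (tm c Rr Rr) <= L.
  apply: le_trans (sL (n + n)%N); rewrite /s sum_triangle_mask.
  apply: ler_dsum; first exact: leq_trans (leq_addr n n) (leqnSn _).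
    by move=> i j hi hj; rewrite ltnS leq_add // ltnW.
  by move=> i j; case: ifP => // _; apply: nonneg_tm.
exists (L + 1); last by have := sL 0%N; rewrite /s big_ord1; have := term0 0%N; lra.
exists c; last by move=> t a b; apply: cub.
split=> // n; apply: le_trans (hM n) _; lra.
Qed.

(** The Taylor expansion converges along triangles and evaluation along squares; a common summable
    majorant makes the limits agree. *)
Lemma F_ev t p q : 0 <= t -> cn p <= Rr -> cn q <= Rr -> F p q t = ev (fser t) p q.
Proof.
move=> ht hp hq; have [_ [_ [_ [htay _]]]] := HF.
have [M hM _] := fser_norm; have hM' := nb_at t hM.
have lim := ev_has_dsum hp hq hM'.
case: hM' => U [hU hU'] /(_ tt) dU.
have r0 : 0 <= Rr := ltW HR.
have dx := dom_tm dU hp hq.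
apply/eqP; rewrite -subr_eq0; apply/eqP/cn_eq0/eqP.
rewrite eq_le cn_ge0 andbT leNgt; apply/negP => hpos.
have he : 0 < cn (F p q t - ev (fser t) p q) / 4 by rewrite divr_gt0.
have [N1 h1] := htay t (elimT RleP ht) p q (conj (elimT RleP hp) (elimT RleP hq)) _ (elimT RltP he).
have [N2 h2] := lim _ he.
have [N3 h3] := dsum_cauchy (nonneg_tm r0 hU) hU' he.
pose n := (N2 + N3)%N; pose N := (N1 + (n + n))%N.
have /RltP := h1 N (elimT ssrnat.leP (leq_addr _ _)).
have {}h2 := h2 n (leq_addr _ _); have {}h3 := h3 n N.+1 (leq_addl _ _).
have -> : taylor_partial f p q t N =
  dsum N.+1 (fun k l => if (k + l < N.+1)%N then tm (fser t) p q k l else 0).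
  rewrite -sum_triangle_mask /taylor_partial CsumE; apply: eq_bigr => i _.
  by rewrite CsumE; apply: eq_bigr => k _; rewrite !CE /tm /fser ger0_norm.
rewrite CE -/(cn _) => h4.
set x := (fun k l => _) in h4.
have hx k l : cn (x k l) <= tm U Rr Rr k l.
  by rewrite /x; case: ifP => _; rewrite ?cn0 //; apply: nonneg_tm.
have hnN : (n <= N.+1)%N by rewrite /N addnA leqW // leq_addl.
have h5 := dsum_dom_split hnN hx.
have e : dsum n x = dsum n (tm (fser t) p q).
  apply: eq_bigr => k _; apply: eq_bigr => l _; rewrite /x ifT // ltnS /N.
  by rewrite (leq_trans _ (leq_addl _ _)) // leq_add // ltnW.
rewrite e in h5.
have : cn (F p q t - ev (fser t) p q) <= cn (dsum N.+1 x - F p q t) +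
   (cn (dsum N.+1 x - dsum n (tm (fser t) p q)) + cn (dsum n (tm (fser t) p q) - ev (fser t) p q)).
  have {1}-> : F p q t - ev (fser t) p q =
    - (dsum N.+1 x - F p q t) + ((dsum N.+1 x - dsum n (tm (fser t) p q)) +
       (dsum n (tm (fser t) p q) - ev (fser t) p q)) by ring.
  apply: le_trans (cnD _ _) _; rewrite cnN lerD2l; exact: cnD.
lra.
Qed.

End Perturbation.

(** * Differentiability in the extended phase space *)

(** The three components are affine in [E]: [c] is 0 for [p] and [q], and 1 for the momentum. *)
Lemma cdiff3_of_cdiff2 (h : Cx -> Cx -> Cx) x y e d1 d2 (c : Cx) : cdiff2 h x y d1 d2 ->
  cdiff3 (fun a b e => c * e + h a b) x y e d1 d2 c.
Proof.
move=> hd eps he; have [dl [hdl hdl']] := hd eps he; exists dl; split=> // h1 h2 h3 l1 l2 l3.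
apply: Rle_trans (_ : Rle _ (Rmult eps (Rplus (Cmod h1) (Cmod h2)))) _.
  have := hdl' h1 h2 l1 l2; congr (Rle (Cmod _) _); rewrite !CE.
  by move: (h _ _) (h x y) => a b; ring.
apply/RleP; rewrite !(RmultE, RplusE).
have /RltP/ltW e0 := he.
by rewrite ler_wpM2l // lerDl (cn_ge0 h3).
Qed.

Lemma cdiff3_ext (h h' : Cx -> Cx -> Cx -> Cx) x y e d1 d2 d3 :
  (forall a b c, h a b c = h' a b c) -> cdiff3 h x y e d1 d2 d3 -> cdiff3 h' x y e d1 d2 d3.
Proof.
move=> hh; have -> // : h = h'.
by apply/funext => a; apply/funext => b; apply/funext => c.
Qed.

Lemma cdiff1_of_cdiff2 (h : Cx -> Cx -> Cx) x y d1 d2 : cdiff2 h x y d1 d2 ->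
  cdiff1 (fun a => h a y) x d1.
Proof.
move=> hd eps he; have [dl [hdl hdl']] := hd eps he; exists dl; split=> // h1 l1.
have c0 : Cmod C0 = 0 := cn0.
have l0 : Rlt (Cmod C0) dl by rewrite c0.
have := hdl' h1 C0 l1 l0; rewrite c0 !CE !addr0 mulr0 addr0.
by rewrite RplusE addr0.
Qed.

Lemma radius_exists (om Rr M : R) (f : R -> ps2 Cx) : 0 < om -> 0 < Rr -> 0 < M ->
  nb Rr f M -> (forall t, ord_ge 3 (f t)) ->
  exists rho phi, [/\ 0 < rho, 2 * rho <= Rr, 16 * phi <= om * rho,
    nb (2 * rho) (fun t => dP (f t)) phi & nb (2 * rho) (fun t => dQ (f t)) phi].
Proof.
move=> om0 R0 M0 hf hord.
(* Cauchy's estimate at [Rr / 2] and the gain of two degrees give [phi = 32 * M * rho^2 / Rr^3], so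
   [16 * phi <= om * rho] reads [512 * M * rho <= om * Rr^3]. *)
pose rho := Num.min (Rr / 4) (om * Rr ^+ 3 / (512 * M)).
have M512 : 0 < 512 * M by rewrite mulr_gt0.
have rho0 : 0 < rho.
  by rewrite lt_min; apply/andP; split; apply: divr_gt0; rewrite // mulr_gt0 ?exprn_gt0.
have r1 : rho <= Rr / 4 by rewrite ge_min lexx.
have r2 : rho * (512 * M) <= om * Rr ^+ 3 by rewrite -ler_pdivlMr // ge_min lexx orbT.
have h0 : 0 <= Rr / 2 by apply: divr_ge0 => //; apply: ltW.
have h1 : Rr / 2 < Rr by lra.
have h2 : 0 < Rr / 2 by rewrite divr_gt0.
have h3 : 2 * rho <= Rr / 2 by lra.
have h4 : 0 <= 2 * rho by lra.
exists rho, ((2 * rho / (Rr / 2)) ^+ 2 * (M / (Rr - Rr / 2))); split=> //; first lra.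
- have Rn : Rr != 0 by rewrite gt_eqF.
  have -> : 16 * ((2 * rho / (Rr / 2)) ^+ 2 * (M / (Rr - Rr / 2))) =
    rho * (rho * (512 * M)) / Rr ^+ 3.
    by field; rewrite Rn.
  rewrite ler_pdivrMr ?exprn_gt0 // [om * rho]mulrC -mulrA ler_wpM2l //; exact: ltW.
- by apply: nb_ord_ge => //; [move=> t; apply/ord_ge_dP/hord | apply: nb_dP].
- by apply: nb_ord_ge => //; [move=> t; apply/ord_ge_dQ/hord | apply: nb_dQ].
Qed.

(** * The transformation as a map on complex domains *)

Section Assembly.
Variables (om rho phi Rr M : R) (f : R -> ps2 Cx) (F : Cx -> Cx -> R -> Cx).
Hypotheses (om0 : 0 < om) (rho0 : 0 < rho).
Hypotheses (f_ct : ctS f) (f_ord : forall t, ord_ge 3 (f t)).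
Hypotheses (fP : nb (2 * rho) (fun t => dP (f t)) phi).
Hypotheses (fQ : nb (2 * rho) (fun t => dQ (f t)) phi).
Hypothesis phi_small : 16 * phi <= om * rho.
Hypotheses (f_nb : nb Rr f M) (rho_small : 2 * rho <= Rr).
Hypothesis F_series : forall t x y, 0 <= t -> cn x <= Rr -> cn y <= Rr -> F x y t = ev (f t) x y.
Variable s : R.
Hypotheses (s0 : 0 < s) (s_small : s <= rho / 4).

Definition Mp (P Q E : Cx) t := ev (psol om f t) P Q.
Definition Mq (P Q E : Cx) t := ev (qsol om f t) P Q.
Definition Me (P Q E : Cx) t := E + ev (energy om f t) P Q.
Definition Jinf (x : Cx) t := ev (Jline om f t) x 0.

Let nb_p : nb rho (psol om f) (2 * rho). Proof. exact: (nb_psol om0 rho0 f_ct f_ord fP fQ phi_small). Qed.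
Let nb_q : nb rho (qsol om f) (2 * rho). Proof. exact: (nb_qsol om0 rho0 f_ct f_ord fP fQ phi_small). Qed.
Let nb_e : nb rho (energy om f) (normE om rho phi M).
Proof. exact: (nb_energy om0 rho0 f_ct f_ord fP fQ phi_small f_nb rho_small). Qed.
Let adm := lim_admissible om0 rho0 f_ct f_ord fP fQ phi_small.

Lemma inD_cn r P Q E : inD r P Q E -> [/\ cn P <= r, cn Q <= r & `|Cim E| <= r].
Proof. by move=> [[/RleP h1 /RleP h2] /RleP h3]; split=> //; rewrite -RabsE. Qed.

(** The series of [p], [q] and [energy] have no constant term, so their values are of order [s], and
    the image shrinks with the domain. *)
Lemma image_in_domain (R0 : R) P Q E t : 2 * s <= R0 -> s * (1 + normE om rho phi M / rho) <= R0 ->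
  inD s P Q E -> inD R0 (Mp P Q E t) (Mq P Q E t) (Me P Q E t).
Proof.
move=> h1 h2 /inD_cn [hP hQ hE].
have sr : s <= rho by have := rho0; have := s_small; lra.
have b u N := @ev_small rho rho0 u N s t P Q s0 sr.
have e2 : s / rho * (2 * rho) = 2 * s by have : rho != 0 by [rewrite gt_eqF]; move=> ne; field.
split; [split|]; apply/RleP; rewrite -/(cn _).
- by apply: le_trans h1; rewrite -e2; apply: b => // t'; apply: ord_ge_pser adm t'.
- by apply: le_trans h1; rewrite -e2; apply: b => // t'; apply: ord_ge_qser adm t'.
rewrite RabsE; have -> : Cim (Me P Q E t) = Cim E + Cim (ev (energy om f t) P Q) by [].
apply: le_trans h2; apply: le_trans (ler_normD _ _) _.
rewrite mulrDr mulr1 lerD //; apply: le_trans (cn_im _) _.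
rewrite mulrA mulrAC; apply: b => // t'.
exact: (ord_energy om0 rho0 f_ct f_ord fP fQ phi_small).
Qed.

Lemma transformation_cdiff3 P Q E t : cn P < rho -> cn Q < rho ->
  [/\ cdiff3 (fun a b c => Mp a b c t) P Q E (ev (dP (psol om f t)) P Q) (ev (dQ (psol om f t)) P Q) 0,
      cdiff3 (fun a b c => Mq a b c t) P Q E (ev (dP (qsol om f t)) P Q) (ev (dQ (qsol om f t)) P Q) 0 &
      cdiff3 (fun a b c => Me a b c t) P Q E (ev (dP (energy om f t)) P Q) (ev (dQ (energy om f t)) P Q) 1].
Proof.
move=> hP hQ; split.
- apply: cdiff3_ext (cdiff3_of_cdiff2 E 0 (ev_cdiff2 (nb_at t nb_p) hP hQ)) => a b c.
  by rewrite mul0r add0r.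
- apply: cdiff3_ext (cdiff3_of_cdiff2 E 0 (ev_cdiff2 (nb_at t nb_q) hP hQ)) => a b c.
  by rewrite mul0r add0r.
- apply: cdiff3_ext (cdiff3_of_cdiff2 E 1 (ev_cdiff2 (nb_at t nb_e) hP hQ)) => a b c.
  by rewrite mul1r.
Qed.

Lemma transformation_analytic t :
  analytic3_on (inD s) (fun a b c => Mp a b c t) /\
  analytic3_on (inD s) (fun a b c => Mq a b c t) /\
  analytic3_on (inD s) (fun a b c => Me a b c t).
Proof.
pose half : R := rho / 2.
have near P Q E w1 w2 : inD s P Q E -> Rlt (Cmod (Csub w1 P)) half ->
    Rlt (Cmod (Csub w2 Q)) half -> cn w1 < rho /\ cn w2 < rho.
  move=> /inD_cn [hP hQ _] /RltP l1 /RltP l2; rewrite CE -/(cn _) /half in l1; rewrite CE -/(cn _) /half in l2.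
  have d1 : cn w1 <= cn (w1 - P) + cn P by rewrite -{1}(subrK P w1); apply: cnD.
  have d2 : cn w2 <= cn (w2 - Q) + cn Q by rewrite -{1}(subrK Q w2); apply: cnD.
  by have := s_small; have := rho0; split; lra.
have r0 : 0 < half by rewrite divr_gt0.
split; [|split] => P Q E hD; exists half; (split; first exact/RltP) => w1 w2 w3 l1 l2 _;
  have [b1 b2] := near _ _ _ _ _ hD l1 l2; have [c1 c2 c3] := transformation_cdiff3 w3 t b1 b2.
- by do 3!eexists; exact: c1.
- by do 3!eexists; exact: c2.
- by do 3!eexists; exact: c3.
Qed.

(** The series are defined for every real time, so at [t = 0] the one-sided time derivatives are
    restrictions of two-sided ones. *)
Lemma transformation_canonical : canonical_on s Mp Mq Me.
Proof.
move=> P Q E t /inD_cn [hP hQ _] _.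
have half : s <= rho / 2 by have := s_small; have := rho0; lra.
have hP2 : cn P <= rho / 2 by apply: le_trans half.
have hQ2 : cn Q <= rho / 2 by apply: le_trans half.
have hlt : rho / 2 < rho by have := rho0; lra.
have h0 : 0 <= rho / 2 by apply: divr_ge0 => //; apply: ltW.
have [c1 c2 c3] := transformation_cdiff3 E t (le_lt_trans hP2 hlt) (le_lt_trans hQ2 hlt).
have [N1 d1] := nb_pd om0 rho0 f_ct f_ord fP fQ phi_small.
have [N2 d2] := nb_qd om0 rho0 f_ct f_ord fP fQ phi_small.
have t1 := ev_tderiv t (derS_p om0 rho0 f_ct f_ord fP fQ phi_small)
  (nb_sub h0 (ltW hlt) rho0 nb_p) d1 hP2 hQ2.
have t2 := ev_tderiv t (derS_q om0 rho0 f_ct f_ord fP fQ phi_small)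
  (nb_sub h0 (ltW hlt) rho0 nb_q) d2 hP2 hQ2.
have e1 := ev_jac om0 rho0 f_ct f_ord fP fQ phi_small t hP2 hQ2.
have e2 := ev_energy_dP om0 rho0 f_ct f_ord fP fQ phi_small f_nb rho_small t hP2 hQ2.
have e3 := ev_energy_dQ om0 rho0 f_ct f_ord fP fQ phi_small f_nb rho_small t hP2 hQ2.
do 11!eexists; split; first exact: c1; split; first exact: c2; split; first exact: c3.
split; first exact: t1; split; first exact: t2; rewrite !CE.
split; first exact: e1; split; first by rewrite mulr0 mul0r subrr.
split; first by rewrite mulr0 mul0r subrr.
split; first exact: e2; split; first exact: e3.
by rewrite mulr0 mul0r subrr add0r.
Qed.

Lemma normal_form_analytic t :
  analytic1_on (fun x => Rle (Cmod x) (pow s 2)) (fun x => Jinf x t) /\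
  Jinf C0 t = C0 /\ cdiff1 (fun x => Jinf x t) C0 (RtoC om).
Proof.
have hJ := nb_at t (nb_Jline om0 rho0 f_ct f_ord fP fQ phi_small).
have r2 : 0 < rho ^+ 2 by rewrite exprn_gt0.
have d x : cn x < rho ^+ 2 -> cdiff1 (fun x => Jinf x t) x (ev (dP (Jline om f t)) x 0).
  move=> hx; have c0 : cn 0 < rho ^+ 2 by rewrite cn0.
  exact: cdiff1_of_cdiff2 (ev_cdiff2 hJ hx c0).
split; [|split].
(* As [s ^+ 2 <= rho ^+ 2 / 16], a ball of radius [rho ^+ 2 / 2] stays inside the disc of
   convergence of [Jline]. *)
- move=> x /RleP hx; exists (rho ^+ 2 / 2); split; first by apply/RltP; rewrite divr_gt0.
  move=> w /RltP hw; eexists; apply: d.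
  rewrite CE -/(cn _) in hw; rewrite RpowE -/(cn _) in hx.
  have dw : cn w <= cn (w - x) + cn x by rewrite -{1}(subrK x w); apply: cnD.
  have h4 : s ^+ 2 <= (rho / 4) ^+ 2 by rewrite lerXn2r // ?nnegrE ?divr_ge0 // ltW.
  by move: h4 r2 hx hw dw; rewrite expr_div_n; lra.
- exact: Jline0.
- have := d C0; rewrite cn0 => /(_ r2).
  by rewrite (dP_Jline0 om0 rho0 f_ct f_ord fP fQ phi_small).
Qed.

Lemma normal_form_equation P Q E t : inD s P Q E -> 0 <= t ->
  Ham om F (Mp P Q E t) (Mq P Q E t) (Me P Q E t) t = Cadd (Jinf (Cmul P Q) t) E.
Proof.
move=> /inD_cn [hP hQ _] ht.
have half : s <= rho / 2 by have := s_small; have := rho0; lra.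
have hP2 : cn P <= rho / 2 by apply: le_trans half.
have hQ2 : cn Q <= rho / 2 by apply: le_trans half.
have hlt : rho / 2 <= rho by have := rho0; lra.
have bp : cn (Mp P Q E t) <= Rr.
  apply: le_trans rho_small; apply: (ev_le (le_trans hP2 hlt) (le_trans hQ2 hlt)).
  exact: nb_at nb_p.
have bq : cn (Mq P Q E t) <= Rr.
  apply: le_trans rho_small; apply: (ev_le (le_trans hP2 hlt) (le_trans hQ2 hlt)).
  exact: nb_at nb_q.
have e := ev_energy om0 rho0 f_ct f_ord fP fQ phi_small f_nb rho_small t hP2 hQ2.
rewrite /Ham !CE F_series // /Me /Jinf -e /Mp /Mq -/(rC om).
move: (ev (f t) _ _) (ev (energy om f t) _ _) => a b.
by move: (rC om * _) => c; ring.
Qed.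

End Assembly.

(** [D] is a sum that dominates every factor occurring in the constraints, so [R0 / D] satisfies
    them all. *)
Lemma target_radius_exists (rho N R0 : R) : 0 < rho -> 0 <= N -> 0 < R0 ->
  exists s, [/\ 0 < s, s < R0, s <= rho / 4, 2 * s <= R0 & s * (1 + N / rho) <= R0].
Proof.
move=> rho0 N0 hR0; pose D := 2 + N / rho + R0 * (4 / rho).
have n0 : 0 <= N / rho by rewrite divr_ge0 // ltW.
have m0 : 0 < R0 * (4 / rho) by rewrite mulr_gt0 // divr_gt0.
have D0 : 0 < D by rewrite /D; lra.
have main (k : R) : k <= D -> R0 / D * k <= R0.
  by move=> hk; rewrite mulrAC ler_pdivrMr // ler_wpM2l // ltW.
exists (R0 / D); split.
- by rewrite divr_gt0.
- by rewrite ltr_pdivrMr // ltr_pMr // /D; lra.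
- have h := main (R0 * (4 / rho)) ltac:(rewrite /D; lra).
  have {}h : R0 * (R0 / D * 4 / rho) <= R0 * 1.
    by rewrite mulr1; apply: le_trans h; rewrite le_eqVlt; apply/orP; left; apply/eqP; ring.
  by move: h; rewrite ler_pM2l // ler_pdivrMr // mul1r => h; rewrite ler_pdivlMr.
- by rewrite mulrC; apply: main; rewrite /D; lra.
- by apply: main; rewrite /D; lra.
Qed.

Local Open Scope R_scope.

Theorem theorem1
  (omega Rr : R) (F : Cx -> Cx -> R -> Cx) (f : nat -> nat -> R -> Cx)
  (Homega : 0 < omega <= 1) (HR : 0 < Rr <= 1 / 2)
  (HF : admissible_perturbation Rr F f)
  (HMF : taylor_norm_finite f Rr) :
  exists (Rstar R0 : R) (Mp Mq Me : Cx -> Cx -> Cx -> R -> Cx)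
         (J : Cx -> R -> Cx),
    0 < Rstar /\ Rstar < R0 /\ R0 <= Rr ^ 4 /\
    (* M maps D_{R*} into D_{R0} for every t *)
    (forall P Q E t, inD Rstar P Q E -> 0 <= t ->
       inD R0 (Mp P Q E t) (Mq P Q E t) (Me P Q E t)) /\
    (* M is analytic on D_{R*} for every t *)
    (forall t, 0 <= t ->
       analytic3_on (inD Rstar) (fun a b c => Mp a b c t) /\
       analytic3_on (inD Rstar) (fun a b c => Mq a b c t) /\
       analytic3_on (inD Rstar) (fun a b c => Me a b c t)) /\
    (* M is canonical in the extended phase space (t unchanged) *)
    canonical_on Rstar Mp Mq Me /\
    (* J is analytic in x (on the range of x = P Q) with J(0,t)=0, J_x(0,t)=omega *)
    (forall t, 0 <= t ->
       analytic1_on (fun x => Cmod x <= Rstar ^ 2) (fun x => J x t) /\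
       J C0 t = C0 /\
       cdiff1 (fun x => J x t) C0 (RtoC omega)) /\
    (* H o M = J(P Q, t) + E *)
    (forall P Q E t, inD Rstar P Q E -> 0 <= t ->
       Ham omega F (Mp P Q E t) (Mq P Q E t) (Me P Q E t) t
       = Cadd (J (Cmul P Q) t) E).
Proof.
have [/RltP om0 _] := Homega; have [/RltP hR _] := HR.
have [M fM M0] := fser_norm hR HMF.
have f_ct := ctS_fser HF; have f_ord := ord_ge_fser HF.
have [rho [phi [rho0 rho_small phi_small fP fQ]]] := radius_exists om0 hR M0 fM f_ord.
have F_series := F_ev hR HF HMF.
have hN := nb_ge0 (nb_energy om0 rho0 f_ct f_ord fP fQ phi_small fM rho_small).
have [s [s0 sR s4 s2 sN]] := target_radius_exists rho0 hN (exprn_gt0 4 hR).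
(* The target radius only constrains the size of the image, so it can be [Rr ^ 4] itself; the radius
   [s] of the source is shrunk to meet it. *)
exists s, (pow Rr 4), (Mp omega (fser f)), (Mq omega (fser f)), (Me omega (fser f)),
  (Jinf omega (fser f)).
have R4 : pow Rr 4 = (Rr ^+ 4)%R by rewrite RpowE.
split; first exact/RltP.
split; first by rewrite R4; apply/RltP.
split; first exact: Rle_refl.
split=> [P Q E t hD _|].
  by rewrite R4; apply: (image_in_domain om0 rho0 f_ct f_ord fP fQ phi_small fM rho_small s0 s4).
split=> [t _|]; first exact: (transformation_analytic om0 rho0 f_ct f_ord fP fQ phi_small fM rho_small s4).
split; first exact: (transformation_canonical om0 rho0 f_ct f_ord fP fQ phi_small fM rho_small s4).
split=> [t _|]; first exact: (normal_form_analytic om0 rho0 f_ct f_ord fP fQ phi_small s0 s4).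
move=> P Q E t hD /RleP ht.
exact: (normal_form_equation om0 rho0 f_ct f_ord fP fQ phi_small fM rho_small F_series s4).
Qed.
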